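(* Let $m\ge 1$, $N\ge 2$, $R>0$, and let $\Omega\subset\mathbb{R}^m$ be an open bounded domain with Lipschitz boundary. Let $G:\mathbb{R}^m\times\mathbb{R}^m\times\mathcal{S}^{N-1}\times\mathcal{S}^{N-1}\to\mathbb{R}$ be a Borel function such that (boundedness) $\sup\{|G(\alpha,\beta,u,v)|:\alpha,\beta\in\mathbb{R}^m,\ u,v\in\mathcal{S}^{N-1}\}<\infty$; (periodicity) there exists $l\in\mathbb{N}$, $l\ge 1$, such that $G(\alpha+l e_i,\beta+l e_i,u,v)=G(\alpha,\beta,u,v)$ for all $\alpha,\beta\in\mathbb{R}^m$, $u,v\in\mathcal{S}^{N-1}$ and $i=1,\dots,m$; (lower semicontinuity) $G$ is lower semicontinuous. For $\varepsilon>0$ and $u:\mathbb{Z}_\varepsilon(\Omega)\to\mathcal{S}^{N-1}$ let $$E_\varepsilon(u;\Omega)=\sum_{\substack{\xi\in\mathbb{Z}^m\\ |\xi|\le R}}\ \sum_{\alpha\in R_\varepsilon^\xi(\Omega)}\varepsilon^m\,G^\xi\Bigl(\frac{\alpha}{\varepsilon},u(\alpha),u(\alpha+\varepsilon\xi)\Bigr),$$ extended to $+\infty$ on functions that are not piecewise-constant extensions of such discrete functions. Then, as $\varepsilon\to0$, $E_\varepsilon(\cdot;\Omega)$ $\Gamma$-converges, with respect to weak$^*$ convergence in $L^\infty$ of the piecewise-constant extensions, to the functional $$E_0(u)=\int_\Omega G_{\hom}(u)\,dx$$ defined for $u\in L^\infty(\Omega,B_1^N)$, where $G_{\hom}:B_1^N\to\mathbb{R}$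 is given by the asymptotic formula $$G_{\hom}(z)=\lim_{T\to\infty}\frac1{T^m}\inf\Bigl\{E_1(u;Q_T)\ :\ u:\mathbb{Z}_1(Q_T)\to\mathcal{S}^{N-1},\ \langle u\rangle^{d,1}_{Q_T}=z\Bigr\}.$$
   Context: $\mathcal{S}^{N-1}$ is the unit sphere of $\mathbb{R}^N$, $B_1^N$ the closed unit ball of $\mathbb{R}^N$, $e_1,\dots,e_m$ the standard basis of $\mathbb{R}^m$, $|\cdot|$ the Euclidean norm, and $Q_T=(0,T)^m$. For an open bounded set $A\subset\mathbb{R}^m$, $\varepsilon>0$ and $\xi\in\mathbb{Z}^m$: $\mathbb{Z}_\varepsilon(A)=\{\alpha\in\varepsilon\mathbb{Z}^m:(\alpha+[0,\varepsilon)^m)\cap A\ne\emptyset\}$; $R_\varepsilon^\xi(A)=\{\alpha\in\mathbb{Z}_\varepsilon(A):\alpha\in A,\ \alpha+\varepsilon\xi\in A\}$; for $v:\mathbb{Z}_\varepsilon(A)\to\mathcal{S}^{N-1}$ the discrete average is $\langle v\rangle_A^{d,\varepsilon}=\frac{1}{\#\mathbb{Z}_\varepsilon(A)}\sum_{\alpha\in\mathbb{Z}_\varepsilon(A)}v(\alpha)$. $G^\xi(\alpha,u,v)=G(\alpha,\alpha+\xi,u,v)$. In particular, for $u:\mathbb{Z}_1(Q_T)\to\mathcal{S}^{N-1}$, $E_1(u;Q_T)=\sum_{\xi\in\mathbb{Z}^m,|\xi|\le R}\sum_{\beta\in R_1^\xi(Q_T)}G^\xi(\beta,u(\beta),u(\beta+\xi))$.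 The piecewise-constant extension of $u:\mathbb{Z}_\varepsilon(\Omega)\to\mathcal{S}^{N-1}$ is $\tilde u(t)=u(\alpha)$ for $t\in\alpha+[0,\varepsilon)^m$, $\alpha\in\mathbb{Z}_\varepsilon(\Omega)$; discrete functions are identified with their extensions (restricted to $\Omega$). Given $\varepsilon_j\to0$, a sequence $u_j:\mathbb{Z}_{\varepsilon_j}(\Omega)\to\mathcal{S}^{N-1}$ converges to $u$ if $\tilde u_j\rightharpoonup^* u$ weakly$^*$ in $L^\infty(\Omega)$; the limit takes values in $B_1^N$ a.e. $\Gamma$-convergence of $E_\varepsilon$ to $E_0$ means: for every $\varepsilon_j\to0^+$ and every $u\in L^\infty(\Omega,B_1^N)$, (i) $\liminf_j E_{\varepsilon_j}(u_j;\Omega)\ge E_0(u)$ for every sequence $u_j:\mathbb{Z}_{\varepsilon_j}(\Omega)\to\mathcal{S}^{N-1}$ with $\tilde u_j\rightharpoonup^* u$ weakly$^*$ in $L^\infty(\Omega)$; (ii) there exists a sequence $u_j:\mathbb{Z}_{\varepsilon_j}(\Omega)\to\mathcal{S}^{N-1}$ with $\tilde u_j\rightharpoonup^* u$ weakly$^*$ in $L^\infty(\Omega)$ and $\limsup_j E_{\varepsilon_j}(u_j;\Omega)\le E_0(u)$. *)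

(* Defs.v *)
From HB Require Import structures.
From mathcomp Require Import all_boot all_order all_algebra finmap.
From mathcomp Require Import all_classical all_reals all_analysis.
From mathcomp Require Import lra.

Set Implicit Arguments.
Unset Strict Implicit.
Unset Printing Implicit Defensive.

Import Order.TTheory GRing.Theory Num.Theory.
Import numFieldNormedType.Exports.

Local Open Scope classical_set_scope.
Local Open Scope ring_scope.

Definition measure_rV_display : measure_display -> measure_display.
Proof. exact. Qed.

(* Measurable sets of R^n: the sigma-algebra generated by the coordinates, as
   the library does for tuples; [measurable_rVE] below identifies it with the
   Borel sigma-algebra. *)
Section measurable_rV.
Context {R : realType} (n : nat).

Let coors : 'I_n -> 'rV[R]_n -> R := fun i x => x ord0 i.

Let rV_set0 : g_sigma_preimage coors set0.
Proof. exact: sigma_algebra0. Qed.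

Let rV_setC A : g_sigma_preimage coors A -> g_sigma_preimage coors (~` A).
Proof. exact: sigma_algebraC. Qed.

Let rV_bigcup (F : (set 'rV[R]_n)^nat) :
  (forall i, g_sigma_preimage coors (F i)) ->
  g_sigma_preimage coors (\bigcup_i (F i)).
Proof. exact: sigma_algebra_bigcup. Qed.

HB.instance Definition _ := @isMeasurable.Build
  (measure_rV_display default_measure_display)
  'rV[R]_n (g_sigma_preimage coors) rV_set0 rV_setC rV_bigcup.

Lemma measurable_coord (i : 'I_n) :
  measurable_fun [set: 'rV[R]_n] (fun x : 'rV[R]_n => x ord0 i).
Proof.
move=> _ Y mY; rewrite setTI; apply: sub_sigma_algebra => /=.
rewrite -bigcup_seq/=; exists i => /=; first by rewrite mem_index_enum.
by exists Y => //; rewrite setTI.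
Qed.

Lemma measurable_fun_coord d (T : measurableType d) (f : T -> 'rV[R]_n) :
  (forall i, measurable_fun [set: T] (fun t => f t ord0 i)) ->
  measurable_fun [set: T] f.
Proof.
move=> mf _ Y mY; rewrite setTI.
suff: g_sigma_preimage coors `<=` [set B | measurable (f @^-1` B)] by exact.
apply: smallest_sub.
  split=> [|B mB|F mF] /=.
  - by rewrite preimage_set0.
  - by rewrite setTD -preimage_setC; exact: measurableC.
  - by rewrite preimage_bigcup; exact: bigcupT_measurable.
move=> B; rewrite -bigcup_seq => -[i _ [C mC <-]] /=.
rewrite setTI -[X in measurable X]setTI; exact: mf.
Qed.

End measurable_rV.

Section measurable_rVE.
Context {R : realType} (n : nat).

Lemma open_measurable_rV (U : set 'rV[R]_n) : open U -> measurable U.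
Proof.
move=> oU.
pose slab (p : 'rV[rat]_n * rat) (i : 'I_n) : set 'rV[R]_n :=
  [set x | x ord0 i \in
    `]ratr (p.1 ord0 i) - ratr p.2, ratr (p.1 ord0 i) + ratr p.2[].
pose box p : set 'rV[R]_n := \bigcap_(i in [set: 'I_n]) slab p i.
have mbox p : measurable (box p).
  apply: fin_bigcap_measurable => // i _.
  rewrite -[X in measurable X]setTI.
  exact: (@measurable_coord R n i _ _ (measurable_itv _)).
have -> : U = \bigcup_(p in [set: 'rV[rat]_n * rat])
    (if pselect (box p `<=` U) then box p else set0).
  apply/seteqP; split=> [x Ux|x [p _]]; last by case: pselect => // + /=; exact.
  have /nbhs_ballP[e /= e0 eU] : nbhs x U by exact: open_nbhs_nbhs.
  have /rat_in_itvoo[r /andP[r0 re]] : 0 < e / 2 by rewrite divr_gt0.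
  have {}r0 : 0 < ratr r :> R by [].
  have {}re : ratr r < e / 2 by [].
  have /choice[q qP] : forall i, exists q : rat,
      x ord0 i < ratr q < x ord0 i + ratr r.
    move=> i; have /rat_in_itvoo[q] : x ord0 i < x ord0 i + ratr r by rewrite ltrDl.
    by rewrite in_itv /=; exists q.
  exists (\row_i q i, r) => //.
  case: pselect => [? /=|/=].
    by move=> i _; rewrite /slab /= mxE in_itv /=; have := qP i; lra.
  case=> y yp; apply: eU; split => // i j; rewrite ord1.
  rewrite /ball /= ltr_norml.
  by have := yp j I; rewrite /slab /= mxE in_itv /=; have := qP j; lra.
apply: countable_bigcupT_measurable; first exact: countableP.
by move=> p; case: pselect => ?; [exact: mbox|exact: measurable0].
Qed.

Lemma measurable_rVE : @measurable _ 'rV[R]_n = <<s [set U | open U] >>.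
Proof.
apply/seteqP; split; last first.
  apply: smallest_sub; first exact: sigma_algebra_measurable.
  by move=> U; exact: open_measurable_rV.
apply: smallest_sub; first exact: smallest_sigma_algebra.
move=> B; rewrite -bigcup_seq => -[i _ [C mC <-]]; rewrite setTI.
pose oU := [set U : set 'rV[R]_n | open U].
suff: (@measurable_realfun.RGenOpens.G R).-sigma.-measurable `<=`
    [set D | <<s oU >> ((fun x : 'rV[R]_n => x ord0 i) @^-1` D)].
  by apply; rewrite -measurable_realfun.RGenOpens.measurableE.
apply: smallest_sub.
  split=> [|D mD|F mF] /=.
  - by rewrite preimage_set0; exact: sigma_algebra0.
  - by rewrite setTD -preimage_setC -setTD; exact: sigma_algebraCD.
  - by rewrite preimage_bigcup; exact: sigma_algebra_bigcup.
move=> _ [a [b ->]]; apply: sub_sigma_algebra => /=.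
apply: open_comp; last exact: interval_open.
by move=> x _; exact: coord_continuous.
Qed.

End measurable_rVE.

Section lebesgue_rV.
Context {R : realType}.

Definition rV_cons n (p : R * 'rV[R]_n) : 'rV[R]_n.+1 := row_mx p.1%:M p.2.

Section step.
Context (n : nat) (mu : {sigma_finite_measure set 'rV[R]_n -> \bar R}).
Local Open Scope ereal_scope.

Definition lebesgue_rV_step : set 'rV[R]_n.+1 -> \bar R :=
  pushforward (lebesgue_measure \x mu) (@rV_cons n).

Let mrV_cons : measurable_fun [set: measurableTypeR R * 'rV[R]_n] (@rV_cons n).
Proof.
apply: measurable_fun_coord => i; rewrite /rV_cons.
have [j ->|j ->] := split_ordP (i : 'I_(1 + n)).
  apply: eq_measurable_fun (@measurable_fst _ _ (measurableTypeR R) 'rV[R]_n).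
  by move=> p _ /=; apply/esym/(etrans (row_mxEl _ _ _ _)); rewrite mxE !ord1.
apply: eq_measurable_fun (measurableT_comp (measurable_coord j)
  (@measurable_snd _ _ (measurableTypeR R) 'rV[R]_n)).
by move=> p _ /=; apply/esym/(etrans (row_mxEr _ _ _ _)).
Qed.

Let rV_uncons (x : 'rV[R]_n.+1) : measurableTypeR R * 'rV[R]_n :=
  ((x : 'rV[R]_(1 + n)) ord0 (lshift n ord0), rsubmx (x : 'rV[R]_(1 + n))).

Let mrV_uncons : measurable_fun [set: 'rV[R]_n.+1] rV_uncons.
Proof.
apply: measurable_fun_pair; first exact: measurable_coord.
apply: measurable_fun_coord => i.
apply: eq_measurable_fun (measurable_coord (rshift 1 i : 'I_n.+1)).
by move=> x _ /=; rewrite mxE.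
Qed.

Let rV_consK : cancel (@rV_cons n) rV_uncons.
Proof.
case=> a x; congr (_, _); last exact: row_mxKr.
by apply: (etrans (row_mxEl _ _ _ _)); rewrite mxE.
Qed.

Let step0 : lebesgue_rV_step set0 = 0.
Proof. by rewrite /lebesgue_rV_step /pushforward preimage_set0 measure0. Qed.

Let step_ge0 A : 0 <= lebesgue_rV_step A.
Proof. exact: measure_ge0. Qed.

Let step_sigma_additive : semi_sigma_additive lebesgue_rV_step.
Proof.
move=> F mF tF mUF; rewrite /lebesgue_rV_step /pushforward preimage_bigcup.
apply: measure_semi_sigma_additive.
- by move=> k; rewrite -[X in measurable X]setTI; exact: mrV_cons.
- apply/trivIsetP => /= i j _ _ ij; rewrite -preimage_setI.
  by move/trivIsetP : tF => /(_ _ _ _ _ ij) ->//; rewrite preimage_set0.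
- by rewrite -preimage_bigcup -[X in measurable X]setTI; exact: mrV_cons.
Qed.

HB.instance Definition _ := isMeasure.Build _ _ _ lebesgue_rV_step
  step0 step_ge0 step_sigma_additive.

Let step_sigma_finite : sigma_finite setT lebesgue_rV_step.
Proof.
have /sigma_finiteP[F [TF ndF Foo]] := sigma_finiteT (@lebesgue_measure R).
have /sigma_finiteP[G [TG ndG Goo]] := sigma_finiteT mu.
exists (fun k => rV_uncons @^-1` (F k `*` G k)).
  rewrite -preimage_bigcup (_ : \bigcup_k _ = setT) ?preimage_setT//.
  apply/seteqP; split=> // -[x y] _.
  have [k _ Fx] : (\bigcup_k F k) x by rewrite -TF.
  have [l _ Gy] : (\bigcup_k G k) y by rewrite -TG.
  exists (maxn k l) => //; split.
  - by move: x Fx; exact/subsetPset/ndF/leq_maxl.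
  - by move: y Gy; exact/subsetPset/ndG/leq_maxr.
move=> k; have [mFk Fkoo] := Foo k; have [mGk Gkoo] := Goo k; split.
  by rewrite -[X in measurable X]setTI; apply: mrV_uncons => //;
    exact: measurableX.
rewrite /lebesgue_rV_step /pushforward -comp_preimage.
rewrite (_ : _ \o _ = id); last exact/funext/rV_consK.
by rewrite preimage_id product_measure1E// lte_mul_pinfty// ge0_fin_numE.
Qed.

HB.instance Definition _ := Measure_isSigmaFinite.Build _ _ _ lebesgue_rV_step
  step_sigma_finite.

End step.

(* R^0 is a point of mass 1 and R^(n+1) = R x R^n carries the product measure. *)
Fixpoint lebesgue_rV n : {sigma_finite_measure set 'rV[R]_n -> \bar R} :=
  match n with
  | 0 => dirac (0 : 'rV[R]_0)
  | n'.+1 => lebesgue_rV_step (lebesgue_rV n')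
  end.

Lemma lebesgue_rV_box n (I : 'I_n -> set R) :
  (forall i, measurable (I i)) ->
  lebesgue_rV n [set x | forall i, I i (x ord0 i)] =
    (\prod_(i < n) lebesgue_measure (I i))%E.
Proof.
elim: n I => [|n IH] I mI /=.
  rewrite big_ord0 /= diracE mem_set // => -[]//.
rewrite /lebesgue_rV_step /pushforward big_ord_recl -IH//.
have mJ : measurable [set x : 'rV[R]_n | forall i, I (lift ord0 i) (x ord0 i)].
  rewrite (_ : mkset _ = \bigcap_(i in [set: 'I_n])
    ((fun x : 'rV[R]_n => x ord0 i) @^-1` I (lift ord0 i))).
    apply: fin_bigcap_measurable => // i _.
    by rewrite -[X in measurable X]setTI; exact: measurable_coord.
  by apply/seteqP; split=> x /= + i => /(_ i); [move=> + _|apply].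
transitivity ((lebesgue_measure \x lebesgue_rV n)%E
    (I ord0 `*` [set x : 'rV[R]_n | forall i, I (lift ord0 i) (x ord0 i)]));
  last by rewrite product_measure1E//; exact: mI.
have cons0 a (x : 'rV[R]_n) : rV_cons (a, x) ord0 ord0 = a.
  have -> : (ord0 : 'I_n.+1) = lshift n (ord0 : 'I_1) by exact: val_inj.
  by apply: (etrans (row_mxEl _ _ _ _)); rewrite mxE.
have consS a (x : 'rV[R]_n) i : rV_cons (a, x) ord0 (lift ord0 i) = x ord0 i.
  have -> : lift (ord0 : 'I_n.+1) i = rshift 1 i by exact: val_inj.
  exact: (etrans (row_mxEr _ _ _ _)).
congr (_ _); apply/seteqP; split=> -[a x] /=.
  by move=> h; split=> [|i]; [rewrite -(cons0 a x)|rewrite -(consS a)].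
by move=> [Ia Ix] i; case: (unliftP ord0 i) => [j|] ->;
  rewrite ?consS ?cons0.
Qed.

End lebesgue_rV.

Section euclidean.
Context {R : realType} {n : nat}.
Implicit Types x y : 'rV[R]_n.

Definition dotv x y : R := \sum_(i < n) x ord0 i * y ord0 i.

(* The library's norm `|x| on 'rV_n is the sup norm. *)
Definition enorm x : R := Num.sqrt (dotv x x).

Definition usphere : set 'rV[R]_n := [set x | enorm x = 1].

Definition uball : set 'rV[R]_n := [set x | enorm x <= 1].

Definition intv (k : 'rV[int]_n) : 'rV[R]_n := map_mx intr k.

End euclidean.

Section lipschitz_domain.
Context {R : realType} {m : nat}.
Implicit Types A : set 'rV[R]_m.+1.

(* Near each boundary point, A is the strict epigraph of a Lipschitz function
   of m variables in the coordinates (x - x0) *m Q, Q orthogonal; coordinate 0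
   is the vertical one. *)
Definition lipschitz_boundary A : Prop :=
  forall x0, (closure A `\` interior A) x0 ->
  exists (Q : 'M[R]_m.+1) (r : R) (g : 'rV[R]_m -> R),
    [/\ Q *m Q^T = 1%:M, 0 < r, [lipschitz g y | y in setT] &
      forall x, enorm (x - x0) < r ->
        (A x <->
         let y := (x - x0) *m Q in
         g (\row_i y ord0 (lift ord0 i)) < y ord0 ord0)].

Definition lipschitz_domain A : Prop :=
  [/\ A !=set0, open A, connected A, bounded_set A & lipschitz_boundary A].

End lipschitz_domain.

Section discrete.
Context {R : realType} {m N : nat}.
Implicit Types (e : R) (A : set 'rV[R]_m) (u : 'rV[R]_m -> 'rV[R]_N).

Definition cell e (a : 'rV[R]_m) : set 'rV[R]_m :=
  [set t | forall i, a ord0 i <= t ord0 i < a ord0 i + e].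

Definition Zlat e A : set 'rV[R]_m :=
  [set a | (exists k : 'rV[int]_m, a = e *: intv k) /\
           (cell e a `&` A) !=set0].

Definition Rlat e (xi : 'rV[int]_m) A : set 'rV[R]_m :=
  [set a | [/\ Zlat e A a, A a & A (a + e *: intv xi)]].

(* A function Zlat e A -> S^(N-1) is a total function constrained on Zlat e A
   only; nothing below depends on its other values. *)
Definition discrete_fun e A u : Prop := forall a, Zlat e A a -> usphere (u a).

(* The sums below range over finite sets as soon as A is bounded. *)
Definition daverage e A u : 'rV[R]_N :=
  (#|` fset_set (Zlat e A)|%:R)^-1 *: \sum_(a \in Zlat e A) u a.

(* e * floor (t_i / e) is the corner of the cell containing t. *)
Definition pc_ext e u : 'rV[R]_m -> 'rV[R]_N :=
  fun t => u (\row_i (e * (Num.floor (t ord0 i / e))%:~R)).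

(* The domain R^m x R^m x S^(N-1) x S^(N-1) of a density G; as for discrete
   functions, its values elsewhere are irrelevant. *)
Definition density_dom : set ('rV[R]_m * 'rV[R]_m * 'rV[R]_N * 'rV[R]_N) :=
  [set p | usphere p.1.2 /\ usphere p.2].

Definition uncurry4 (G : 'rV[R]_m -> 'rV[R]_m -> 'rV[R]_N -> 'rV[R]_N -> R)
    (p : 'rV[R]_m * 'rV[R]_m * 'rV[R]_N * 'rV[R]_N) : R :=
  G p.1.1.1 p.1.1.2 p.1.2 p.2.

Definition energy (rho : R)
    (G : 'rV[R]_m -> 'rV[R]_m -> 'rV[R]_N -> 'rV[R]_N -> R) e A u : R :=
  \sum_(xi \in [set xi : 'rV[int]_m | enorm (intv xi : 'rV[R]_m) <= rho])
    \sum_(a \in Rlat e xi A)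
      e ^+ m * G (e^-1 *: a) (e^-1 *: a + intv xi) (u a) (u (a + e *: intv xi)).

Definition cube (T : R) : set 'rV[R]_m :=
  [set t | forall i, 0 < t ord0 i < T].

(* The infimum is +oo when no discrete function has average z. *)
Definition cell_energy rho G (z : 'rV[R]_N) (T : R) : \bar R :=
  ((T ^- m)%:E * ereal_inf [set (energy rho G 1 (cube T) u)%:E | u in
    [set u | discrete_fun 1 (cube T) u /\ daverage 1 (cube T) u = z]])%E.

Definition Ghom rho G (z : 'rV[R]_N) : \bar R :=
  lim (cell_energy rho G z T @[T --> +oo%R]).

End discrete.

Section gamma.
Context {R : realType} {m N : nat}.
Implicit Types (A : set 'rV[R]_m) (u : 'rV[R]_m -> 'rV[R]_N).

Definition Linfty_uball A u : Prop :=
  measurable_fun A u /\ {ae lebesgue_rV m, forall x, A x -> uball (u x)}.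

(* Weak* convergence, tested against the predual L^1(A; R^N). *)
Definition weak_star_cvg A (u_ : nat -> 'rV[R]_m -> 'rV[R]_N) u : Prop :=
  forall phi : 'rV[R]_m -> 'rV[R]_N,
    (forall i, (lebesgue_rV m).-integrable A (fun x => (phi x ord0 i)%:E)) ->
    (\int[lebesgue_rV m]_(x in A) dotv (phi x) (u_ j x))%R @[j --> \oo] -->
    (\int[lebesgue_rV m]_(x in A) dotv (phi x) (u x))%R.

(* E e is +oo off the piecewise-constant extensions of discrete functions, so
   only sequences of discrete functions are tested. *)
Definition gamma_cvg A (E : R -> ('rV[R]_m -> 'rV[R]_N) -> R)
    (E0 : ('rV[R]_m -> 'rV[R]_N) -> \bar R) : Prop :=
  forall e : nat -> R, (forall j, 0 < e j) -> e @ \oo --> (0 : R) ->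
  forall u, Linfty_uball A u ->
  (forall u_ : nat -> 'rV[R]_m -> 'rV[R]_N,
     (forall j, discrete_fun (e j) A (u_ j)) ->
     weak_star_cvg A (fun j => pc_ext (e j) (u_ j)) u ->
     (E0 u <= limn_einf (fun j => (E (e j) (u_ j))%:E))%E) /\
  (exists u_ : nat -> 'rV[R]_m -> 'rV[R]_N,
     [/\ forall j, discrete_fun (e j) A (u_ j),
         weak_star_cvg A (fun j => pc_ext (e j) (u_ j)) u &
         (limn_esup (fun j => (E (e j) (u_ j))%:E) <= E0 u)%E]).

End gamma.

(* Main.v *)
(* A lattice field on a union of boxes that are further apart than the range of
   interaction has the sum of the energies of the boxes, and every other lattice
   point costs at most a constant. Tiling a large box by translates of a smaller
   one along the period therefore shows that the normalized minimal energies of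
   the boxes, at prescribed average z, converge to the infimum phi(z) of these
   energies corrected by a multiple of 1/n; this limit is G_hom(z). It is lower
   semicontinuous: for |z| < 1 the average of a pattern is adjusted by filling a
   slightly larger box, and for |z| = 1 an average close to z forces most spins
   to be close to z, so that the semicontinuity of G applies. The boundary of the
   domain is null, as it has disjoint vertical translates, so that the lattice
   points that remain outside the boxes below are negligible.

   Lower bound: in the cells of a fixed grid the averages of the fields converge
   to the means of u, and the semicontinuity of phi bounds the liminf from below
   by a Riemann sum of phi at these means. Replacing phi by a Lipschitz minorant,
   the Riemann sums exceed the integral up to the L^1 oscillation of u on the
   grid, which vanishes with the mesh.

   Upper bound: in each cell of a grid of mesh about e^(1/2), take a value z of u
   for which phi(z) + Lambda |z - mean of u| does not exceed its average over the
   cell, and fill a box of the cell with a nearly optimal pattern of average z.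
   If Lambda tends to infinity so slowly that Lambda times the oscillation of u
   vanishes, the energies are at most the integral of phi(u) in the limit and the
   averages over the cells are those of u up to an error that vanishes in L^1. *)

(* The average is prescribed exactly, and N >= 2 makes this affordable: sums of n >= 2 unit vectors
   fill the closed ball of radius n, so that free lattice points absorb a defect of the average at a
   bounded cost per point. For |z| = 1 no such room is left, because the constant field is the only
   one with average z; this forces the separate argument on the sphere.

   The main obstacle is that phi is only known to be lower semicontinuous. Its value at a mean of u
   is then not controlled from above by phi(u), which is why the upper bound takes a value of u
   itself in each cell and pays for its distance to the mean. For the same reason patterns that are
   nearly optimal uniformly in z are obtained only for approximate averages, which weak convergence
   tolerates.

   The two bounds use different grids. From below the mesh stays fixed while e tends to 0, so that
   weak convergence can be tested on each cell. From above the mesh is tied to e, and a diagonal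
   choice of tolerances replaces the iterated limit. *)
Require Import Defs.
From HB Require Import structures.
From mathcomp Require Import all_boot all_order all_algebra finmap.
From mathcomp Require Import all_classical all_reals all_analysis.
From mathcomp Require Import measurable_realfun ring lra zify.

Set Implicit Arguments.
Unset Strict Implicit.
Unset Printing Implicit Defensive.

Import Order.TTheory GRing.Theory Num.Theory.
Import numFieldNormedType.Exports.

Local Open Scope classical_set_scope.
Local Open Scope ring_scope.

(** * Euclidean geometry *)

Section euclidean_space.
Context {R : realType} {n : nat}.
Implicit Types x y z : 'rV[R]_n.

Lemma dotvC x y : dotv x y = dotv y x.
Proof. by apply: eq_bigr => i _; rewrite mulrC. Qed.

Lemma dotvDl x y z : dotv (x + y) z = dotv x z + dotv y z.
Proof. by rewrite /dotv -big_split; apply: eq_bigr => i _; rewrite mxE mulrDl. Qed.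

Lemma dotvZl a x y : dotv (a *: x) y = a * dotv x y.
Proof. by rewrite /dotv mulr_sumr; apply: eq_bigr => i _; rewrite mxE mulrA. Qed.

Lemma dotvDr x y z : dotv x (y + z) = dotv x y + dotv x z.
Proof. by rewrite dotvC dotvDl !(dotvC x). Qed.

Lemma dotvZr a x y : dotv x (a *: y) = a * dotv x y.
Proof. by rewrite dotvC dotvZl (dotvC x). Qed.

Lemma dotvNr x y : dotv x (- y) = - dotv x y.
Proof. by rewrite -scaleN1r dotvZr mulN1r. Qed.

Lemma dotvBl x y z : dotv (x - y) z = dotv x z - dotv y z.
Proof. by rewrite dotvDl -scaleN1r dotvZl mulN1r. Qed.

Lemma dotv_suml (I : Type) (s : seq I) (F : I -> 'rV[R]_n) y :
  dotv (\sum_(i <- s) F i) y = \sum_(i <- s) dotv (F i) y.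
Proof.
elim: s => [|i s IH]; last by rewrite !big_cons dotvDl IH.
by rewrite !big_nil -(scale0r y) dotvZl mul0r.
Qed.

Lemma dotv_ge0 x : 0 <= dotv x x.
Proof. by apply: sumr_ge0 => i _; rewrite -expr2 sqr_ge0. Qed.

Lemma enorm_ge0 x : 0 <= enorm x.
Proof. exact: sqrtr_ge0. Qed.

Lemma sqr_enorm x : enorm x ^+ 2 = dotv x x.
Proof. by rewrite sqr_sqrtr// dotv_ge0. Qed.

Lemma enorm0 : enorm (0 : 'rV[R]_n) = 0.
Proof. by rewrite /enorm /dotv big1 ?sqrtr0// => i _; rewrite mxE mul0r. Qed.

Lemma enormZ a x : enorm (a *: x) = `|a| * enorm x.
Proof.
by rewrite /enorm dotvZl dotvZr mulrA -expr2 sqrtrM ?sqr_ge0// sqrtr_sqr.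
Qed.

Lemma enormN x : enorm (- x) = enorm x.
Proof. by rewrite -scaleN1r enormZ normrN1 mul1r. Qed.

Lemma abs_coord_le_enorm x i : `|x ord0 i| <= enorm x.
Proof.
rewrite -sqrtr_sqr ler_sqrt ?dotv_ge0// /dotv (bigD1 i)//= -expr2 lerDl.
by apply: sumr_ge0 => j _; rewrite -expr2 sqr_ge0.
Qed.

Lemma enorm_eq0 x : enorm x = 0 -> x = 0.
Proof.
move=> x0; apply/rowP => i; rewrite mxE; apply/eqP.
by rewrite -normr_le0 -x0 abs_coord_le_enorm.
Qed.

(** Cauchy-Schwarz: expand the nonnegative square of x minus its projection on y. *)
Lemma dotv_le_enorm x y : dotv x y <= enorm x * enorm y.
Proof.
have [y0|y0] := eqVneq (enorm y) 0.
  rewrite y0 mulr0 (enorm_eq0 y0) dotvC -(scale0r (0 : 'rV_n)) dotvZl mul0r.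
  exact: lexx.
have yp : 0 < enorm y by rewrite lt_def y0 enorm_ge0.
apply: le_trans (ler_norm _) _.
rewrite -ler_sqr ?nnegrE ?mulr_ge0 ?enorm_ge0// exprMn !sqr_enorm.
have D0 : 0 < dotv y y by rewrite -sqr_enorm exprn_gt0.
have := dotv_ge0 (x - (dotv x y / dotv y y) *: y).
rewrite dotvBl dotvDr dotvNr dotvZr dotvZl dotvDr dotvNr dotvZr (dotvC y x).
rewrite real_normK ?num_real//.
set a := dotv x x; set b := dotv x y; set c := dotv y y.
have -> : a - b / c * b - b / c * (b - b / c * c) = a - b ^+ 2 / c.
  by field; rewrite gt_eqF.
by rewrite subr_ge0 ler_pdivrMr.
Qed.

Lemma enormD x y : enorm (x + y) <= enorm x + enorm y.
Proof.
rewrite -ler_sqr ?nnegrE ?addr_ge0 ?enorm_ge0// sqr_enorm dotvDl !dotvDr.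
rewrite (dotvC y x) sqrrD -!sqr_enorm.
have := dotv_le_enorm x y; lra.
Qed.

Lemma enorm_sum (I : Type) (r : seq I) (P : pred I) (F : I -> 'rV[R]_n) :
  enorm (\sum_(i <- r | P i) F i) <= \sum_(i <- r | P i) enorm (F i).
Proof.
elim/big_ind2 : _ => //; first by rewrite enorm0.
by move=> a b c d ab cd; exact: le_trans (enormD _ _) (lerD ab cd).
Qed.

Lemma abs_coord_le_norm x i : `|x ord0 i| <= `|x|.
Proof.
have -> : `|x| = mx_norm x by [].
by rewrite mx_normrE; exact: (@le_bigmax _ _ _ 0 (fun ij : 'I_1 * 'I_n => `|x ij.1 ij.2|) (ord0, i)).
Qed.

Lemma norm_leP x e : 0 <= e -> (forall i, `|x ord0 i| <= e) -> `|x| <= e.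
Proof.
move=> e0 H; have -> : `|x| = mx_norm x by [].
rewrite mx_normrE; apply/bigmax_leP; split=> // -[i j] _ /=.
by rewrite ord1; exact: H.
Qed.

Lemma norm_le_enorm x : `|x| <= enorm x.
Proof. by apply: norm_leP; [exact: enorm_ge0|exact: abs_coord_le_enorm]. Qed.

Lemma enorm_le_norm x : enorm x <= n%:R * `|x|.
Proof.
rewrite [X in enorm X]matrix_sum_delta big_ord1.
apply: le_trans (enorm_sum _ _ _) _.
rewrite -[n in n%:R]card_ord -sum1_card natr_sum mulr_suml.
apply: ler_sum => i _; rewrite enormZ mul1r.
suff -> : enorm (delta_mx 0 i : 'rV[R]_n) = 1 by rewrite mulr1 abs_coord_le_norm.
rewrite /enorm /dotv (bigD1 i)//= big1 ?addr0; first by rewrite !mxE !eqxx mulr1 sqrtr1.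
by move=> j ji; rewrite !mxE (negPf ji) mul0r.
Qed.

End euclidean_space.

(** * Sums of unit vectors *)

Section sphere_fill.
Context {R : realType} {N : nat} (hN : (2 <= N)%N).
Implicit Types v : 'rV[R]_N.

Lemma usphere_normalize v : v != 0 -> usphere ((enorm v)^-1 *: v).
Proof.
move=> v0; rewrite /usphere /= enormZ ger0_norm ?invr_ge0 ?enorm_ge0// mulVf//.
by apply: contra_neq v0 => /enorm_eq0.
Qed.

Lemma exists_orthogonal v : exists2 b, usphere b & dotv b v = 0.
Proof.
pose i0 := Ordinal (ltnW hN); pose i1 := Ordinal hN.
have i01 : i0 != i1 by [].
have dot_delta i w : dotv (delta_mx ord0 i) w = w ord0 i :> R.
  rewrite /dotv (bigD1 i)//= big1 ?addr0; first by rewrite mxE !eqxx mul1r.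
  by move=> j ji; rewrite mxE (negPf ji) andbF mul0r.
(* A quarter turn of v in the plane of the first two coordinates. If it vanishes, so does the first
   coordinate of v, and the first basis vector is orthogonal to v. *)
pose b := v ord0 i1 *: delta_mx ord0 i0 - v ord0 i0 *: delta_mx ord0 i1 : 'rV[R]_N.
have [b0|b0] := eqVneq b 0; last first.
  exists ((enorm b)^-1 *: b); first exact: usphere_normalize.
  by rewrite dotvZl /b dotvBl !dotvZl !dot_delta (mulrC (v ord0 i1)) subrr mulr0.
exists (delta_mx ord0 i0).
  by rewrite /usphere /= /enorm dot_delta mxE !eqxx sqrtr1.
rewrite dot_delta; have /rowP/(_ i1) := b0.
rewrite !mxE !eqxx (eq_sym i1) (negPf i01) mulr0 mulr1 add0r => /eqP.
by rewrite oppr_eq0 => /eqP.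
Qed.

Lemma exists_usphere : exists v, usphere v.
Proof. by have [b] := exists_orthogonal 0; exists b. Qed.

(** A rhombus with diagonal v: the two vectors are v/2 + tc and v/2 - tc, with c a unit vector
    orthogonal to v and t chosen to give them length 1. *)
Lemma sphere_pair v : enorm v <= 2 -> exists a b, [/\ usphere a, usphere b & a + b = v].
Proof.
move=> v2; have [c c1 cv] := exists_orthogonal v.
pose t := Num.sqrt (1 - (enorm v / 2) ^+ 2).
have t2 : t ^+ 2 = 1 - (enorm v / 2) ^+ 2.
  rewrite sqr_sqrtr// subr_ge0 exprn_ile1 ?divr_ge0 ?enorm_ge0//; lra.
have c2 : dotv c c = 1 by rewrite -sqr_enorm c1 expr1n.
have h s : s ^+ 2 = 1 -> usphere (2^-1 *: v + (s * t) *: c).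
  move=> s2; rewrite /usphere /= -[RHS]sqrtr1; congr Num.sqrt.
  rewrite dotvDl !dotvDr !dotvZl !dotvZr (dotvC v c) cv c2 -sqr_enorm.
  have -> : s * t * (s * t * 1) = s ^+ 2 * t ^+ 2 by ring.
  by rewrite s2 t2; field.
exists (2^-1 *: v + (1 * t) *: c), (2^-1 *: v + (-1 * t) *: c); split.
- by apply: h; rewrite expr1n.
- by apply: h; rewrite sqrrN expr1n.
rewrite addrACA -scalerDl -scalerDl mul1r mulN1r subrr scale0r addr0.
by rewrite (_ : 2^-1 + 2^-1 = 1) ?scale1r//; field.
Qed.

(** Removing the unit vector v/|v| leaves a vector of length ||v| - 1|, still at most the number of
    remaining points; [sphere_pair] settles the last two. This is how prescribed averages in the
    closed ball are attained exactly. *)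
Lemma sphere_fill (T : eqType) (D : seq T) v : uniq D -> (2 <= size D)%N ->
  enorm v <= (size D)%:R ->
  exists w : T -> 'rV[R]_N, (forall k, usphere (w k)) /\ \sum_(k <- D) w k = v.
Proof.
elim: D v => [//|a [//|b D] IH] v /[dup] uD /= /andP[aD _] _.
case: D => [|c D] in IH uD aD *.
  move=> /sphere_pair[x [y [x1 y1 xy]]].
  exists (fun k => if k == a then x else y); split; first by move=> k; case: ifP.
  rewrite !big_cons big_nil addr0 eqxx ifF//.
  by move: aD; rewrite inE eq_sym => /negPf.
have [x x1 xv] : exists2 x, usphere x & enorm (v - x) <= (size [:: b, c & D])%:R ->
    exists w : T -> 'rV[R]_N, (forall k, usphere (w k)) /\
      \sum_(k <- [:: b, c & D]) w k = v - x.
  have [x x1] := exists_usphere; exists x => // vx; apply: IH => //.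
  by move: uD => /= /andP[].
move=> vD; have [y y1 yv] : exists2 y, usphere y & enorm (v - y) <= (size [:: b, c & D])%:R.
  have [v0|v0] := eqVneq v 0.
    have [z z1] := exists_usphere; exists z => //; rewrite v0 sub0r enormN z1.
    by rewrite ler1n.
  exists ((enorm v)^-1 *: v); first exact: usphere_normalize.
  rewrite -[X in X - _]scale1r -scalerBl enormZ.
  have vp : 0 < enorm v.
    by rewrite lt_def enorm_ge0 andbT; apply: contra_neq v0 => /enorm_eq0.
  rewrite -[X in _ * X]ger0_norm ?enorm_ge0// -normrM mulrBl mul1r mulVf ?gt_eqF//.
  move: vD => /=; rewrite -!natr1 => vD; have := ler0n R (size D).
  by rewrite ler_norml; lra.
have [w [w1 wv]] : exists w : T -> 'rV[R]_N, (forall k, usphere (w k)) /\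
      \sum_(k <- [:: b, c & D]) w k = v - y.
  by apply: IH => //; move: uD => /= /andP[].
exists (fun k => if k == a then y else w k); split; first by move=> k; case: ifP.
rewrite big_cons eqxx (eq_big_seq w) ?wv ?subrKC// => k kD.
by case: eqP => // ka; rewrite -ka kD in aD.
Qed.

End sphere_fill.

(** * Pair energies on the lattice *)

Lemma sum_fsetU (K : choiceType) (Z : zmodType) (A B : {fset K}) (F : K -> Z) :
  [disjoint A & B]%fset ->
  \sum_(k <- (A `|` B)%fset) F k = \sum_(k <- A) F k + \sum_(k <- B) F k.
Proof.
move=> AB; rewrite (big_fsetID _ (mem A)); congr (_ + _); apply: eq_fbigl => k;
  rewrite !inE /=; case kA: (k \in A) => //=; rewrite ?orbF ?andbT ?andbF//.
by apply/esym/negbTE/(fdisjointP AB).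
Qed.

Lemma card_sum_mem (R : realType) (K : choiceType) (Y Z : {fset K}) :
  (Z `<=` Y)%fset -> #|` Z|%:R = \sum_(k <- Y) (k \in Z)%:R :> R.
Proof.
move=> ZY; rewrite -(@big_fset_incl _ _ _ _ Z Y) //; last first.
  by move=> k _ /negbTE ->.
rewrite (eq_big_seq (fun=> 1)); last by move=> k ->.
by rewrite big_const_seq count_predT iter_addr addr0.
Qed.

Lemma card_sum_notin (R : realType) (K : choiceType) (X Y : {fset K}) :
  (X `<=` Y)%fset -> #|` Y|%:R - #|` X|%:R = \sum_(k <- Y) (k \notin X)%:R :> R.
Proof.
move=> XY; rewrite (card_sum_mem R (fsubset_refl Y)) (card_sum_mem R XY) -sumrB.
apply: eq_big_seq => k kY.
by rewrite kY; case: (k \in X); rewrite ?subrr ?subr0.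
Qed.

Section lattice_energy.
Context {R : realType} {d N : nat}.
Local Notation V := 'rV[int]_d.
Context (Xi : {fset V}) (g : V -> V -> 'rV[R]_N -> 'rV[R]_N -> R).
Implicit Types (X Y : {fset V}) (w : V -> 'rV[R]_N) (k p q xi : V).

Definition sphere_valued w := forall k, usphere (w k).

(** The energy at unit scale with free boundary: a pair counts only if both of its points lie in X.
    [energy_lattice] relates it to the functionals of the theorem. *)
Definition pair_energy X w : R :=
  \sum_(xi <- Xi) \sum_(k <- X | k + xi \in X) g xi k (w k) (w (k + xi)).

Lemma eq_pair_energy X w w' : {in X, w =1 w'} -> pair_energy X w = pair_energy X w'.
Proof.
move=> ww'; apply: eq_bigr => xi _; rewrite big_seq_cond [RHS]big_seq_cond.
by apply: eq_bigr => k /andP[kX kxiX]; rewrite !ww'.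
Qed.

Lemma pair_energyU X Y w : [disjoint X & Y]%fset ->
  {in Xi, forall xi, {in X & Y, forall k k', k + xi != k' /\ k' + xi != k}} ->
  pair_energy (X `|` Y)%fset w = pair_energy X w + pair_energy Y w.
Proof.
move=> XY sep; rewrite /pair_energy -big_split; apply: eq_big_seq => xi xiXi /=.
rewrite big_mkcond sum_fsetU//= -!big_mkcond/=; congr (_ + _); last first.
  rewrite [LHS]big_seq_cond [RHS]big_seq_cond; apply: eq_bigl => k.
  case kY: (k \in Y) => //=; rewrite inE orbC.
  case: (k + xi \in Y) => //=; apply/negbTE/negP => kX.
  by have [_] := sep _ xiXi _ _ kX kY; rewrite eqxx.
rewrite [LHS]big_seq_cond [RHS]big_seq_cond; apply: eq_bigl => k.
case kX: (k \in X) => //=; rewrite inE.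
case: (k + xi \in X) => //=; apply/negbTE/negP => kY.
by have [] := sep _ xiXi _ _ kX kY; rewrite eqxx.
Qed.

Lemma pair_energy_shift X q w :
  (forall xi k a b, usphere a -> usphere b -> g xi (q + k) a b = g xi k a b) ->
  sphere_valued w ->
  pair_energy [fset (q + k)%R | k in X]%fset w = pair_energy X (fun k => w (q + k)).
Proof.
move=> gq w1; apply: eq_bigr => xi _.
have qI : injective (fun k => q + k) by move=> k k' /addrI.
rewrite big_mkcond big_imfset/=; last by move=> k k' _ _; exact: qI.
rewrite [RHS]big_mkcond; apply: eq_bigr => k _.
by rewrite -addrA mem_imfset//= gq.
Qed.

Context (M : R) (gM : forall xi k a b, usphere a -> usphere b -> `|g xi k a b| <= M).

Lemma pair_bound_ge0 w : sphere_valued w -> 0 <= M.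
Proof. by move=> w1; apply: le_trans (gM 0 0 (w1 0) (w1 0)). Qed.

(** A bound on the energy of all pairs through one point, which can be the first or the second point
    of a pair for each xi. *)
Definition pair_cost : R := 2 * #|` Xi|%:R * M.

(** A pair of Y that is lost in X has its first or its second point in Y outside X, and for fixed xi
    either point determines the pair. *)
Lemma pair_energy_sub X Y w : sphere_valued w -> (X `<=` Y)%fset ->
  `|pair_energy Y w - pair_energy X w| <= pair_cost * (#|` Y|%:R - #|` X|%:R).
Proof.
move=> w1 XY; have M0 := pair_bound_ge0 w1.
have cardE := @card_sum_mem R V Y; have Ybound := card_sum_notin R XY.
rewrite /pair_energy -sumrB.
have -> : pair_cost * (#|` Y|%:R - #|` X|%:R) =
    \sum_(xi <- Xi) (2 * M * (#|` Y|%:R - #|` X|%:R)).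
  rewrite big_const_seq count_predT iter_addr addr0 -[RHS]mulr_natl /pair_cost; ring.
apply: le_trans (ler_norm_sum _ _ _) _; apply: ler_sum => xi _.
have -> : \sum_(k <- X | k + xi \in X) g xi k (w k) (w (k + xi)) =
    \sum_(k <- Y) (if (k \in X) && (k + xi \in X) then g xi k (w k) (w (k + xi)) else 0).
  rewrite big_mkcond -[RHS](big_fset_incl _ XY); last by move=> k _ /negbTE ->.
  by apply: eq_big_seq => k kX; rewrite kX.
rewrite big_mkcond -sumrB.
(* Translation by xi is injective and maps the points counted on the left into Y minus X. *)
have shiftB : \sum_(k <- Y) ((k + xi \in Y) && (k + xi \notin X))%:R <=
    \sum_(k <- Y) (k \notin X)%:R :> R.
  rewrite -Ybound -natrB ?fsubset_leq_card//.
  pose A := [fset k in Y | ((k + xi)%R \in Y) && ((k + xi)%R \notin X)]%fset.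
  rewrite (_ : \sum_(k <- Y) _ = #|` A|%:R); last first.
    rewrite (cardE A); last by apply/fsubsetP => k; rewrite !inE /= => /andP[].
    by apply: eq_big_seq => k kY; rewrite !inE /= kY.
  rewrite ler_nat -cardfsDS//.
  have xiI : injective (fun k => k + xi) by move=> k k' /addIr.
  have <- : #|` [fset (k + xi)%R | k in A]%fset| = #|` A| by exact: card_imfset.
  rewrite fsubset_leq_card//; apply/fsubsetP => _ /imfsetP[k + ->].
  by rewrite !inE /= => /andP[_ /andP[-> ->]].
have : M * (\sum_(k <- Y) (k \notin X)%:R +
    \sum_(k <- Y) ((k + xi \in Y) && (k + xi \notin X))%:R) <=
    2 * M * (#|` Y|%:R - #|` X|%:R).
  rewrite Ybound (mulrC 2) -mulrA; apply: ler_wpM2l => //.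
  by rewrite mulr_natl mulr2n lerD2l.
apply: le_trans; rewrite -big_split mulr_sumr.
apply: le_trans (ler_norm_sum _ _ _) _; apply: ler_sum => k _ /=.
have gk := gM xi k (w1 k) (w1 (k + xi)).
have kxiY : k + xi \in X -> k + xi \in Y by exact: (fsubsetP XY).
case: (k + xi \in X) kxiY => [->//|_] /=;
  case: (k \in X) => /=; case: (k + xi \in Y) => /=;
  rewrite ?subrr ?subr0 ?normr0 ?addr0 ?add0r ?mulr1 ?mulr0//.
by apply: le_trans gk _; rewrite mulrDr mulr1 lerDl.
Qed.

End lattice_energy.

(** * Separated boxes of lattice points *)

Section boxes.
Context {d : nat}.
Local Notation V := 'rV[int]_d.
Implicit Types (k p : V) (n : nat).

(* [lia] does not recognize the additions that [mxE] leaves on the entries of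
   integer matrices. *)
Lemma coordD k p i : (k + p) ord0 i = k ord0 i + p ord0 i.
Proof. by rewrite mxE. Qed.

Lemma coordN k i : (- k) ord0 i = - k ord0 i.
Proof. by rewrite mxE. Qed.

Lemma coordZ (a : int) k i : (a *: k) ord0 i = a * k ord0 i.
Proof. by rewrite mxE. Qed.

Lemma exists_coord_neq (k k' : V) : k != k' -> exists i, k ord0 i != k' ord0 i.
Proof.
move=> kk'; apply/existsP; apply: contra_neqT kk' => /existsPn H; apply/rowP => i.
by have := H i; rewrite negbK => /eqP.
Qed.

Definition box p n : {fset V} :=
  [fset (p + \row_i (f i : nat)%:Z)%R | f : {ffun 'I_d -> 'I_n} in predT]%fset.

Lemma in_box k p n :
  (k \in box p n) = [forall i, p ord0 i <= k ord0 i < p ord0 i + n%:Z].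
Proof.
apply/imfsetP/forallP => [[f _ ->] i|H].
  by rewrite coordD mxE; case: (f i) => o /= on; lia.
have Hn i : (`|k ord0 i - p ord0 i| < n)%N by have := H i; lia.
exists [ffun i => Ordinal (Hn i)] => //; apply/rowP => i; rewrite coordD mxE ffunE /=.
have : k ord0 i = p ord0 i + `|k ord0 i - p ord0 i|%N%:Z by have := H i; lia.
exact.
Qed.

Lemma in_boxP k p n :
  reflect (forall i, p ord0 i <= k ord0 i < p ord0 i + n%:Z) (k \in box p n).
Proof. by rewrite in_box; exact: forallP. Qed.

Lemma card_box p n : #|` box p n| = (n ^ d)%N.
Proof.
rewrite card_imfset /=; first by rewrite -cardE card_ffun !card_ord.
move=> f f' /addrI /rowP ff'; apply/ffunP => i; apply: val_inj => /=.
by have := ff' i; rewrite !mxE => -[].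
Qed.

Lemma box_subset p n p' n' :
  (forall i, p' ord0 i <= p ord0 i) ->
  (forall i, p ord0 i + n%:Z <= p' ord0 i + n'%:Z) -> (box p n `<=` box p' n')%fset.
Proof.
move=> H H'; apply/fsubsetP => k /in_boxP kp; apply/in_boxP => i.
by have := H i; have := H' i; have := kp i; lia.
Qed.

Lemma box_leq p n n' : (n <= n')%N -> (box p n `<=` box p n')%fset.
Proof. by move=> nn'; apply: box_subset => i //; lia. Qed.

Lemma box_shift p (q : V) n : box (q + p) n = [fset (q + k)%R | k in box p n]%fset.
Proof.
apply/fsetP => k; apply/in_boxP/imfsetP => [H|[k' /in_boxP H ->] i].
  exists (k - q); last by rewrite addrC subrK.
  apply/in_boxP => i; have := H i; rewrite ?coordD ?coordN; lia.
have := H i; rewrite ?coordD ?coordN; lia.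
Qed.

Context {K : choiceType} (P : K -> V) (n r : nat).
Implicit Types I : seq K.

(** The boxes have side n, so corners n + r apart in some coordinate leave points of different boxes
    more than r apart in it: no interaction of range r joins them. *)
Definition spaced I := {in I &, forall q q', q != q' -> exists i,
  P q ord0 i + (n + r)%:Z <= P q' ord0 i \/ P q' ord0 i + (n + r)%:Z <= P q ord0 i}.

Definition boxes I : {fset V} := (\bigcup_(q <- I) box (P q) n)%fset.

Lemma in_boxesP I k : reflect (exists2 q, q \in I & k \in box (P q) n) (k \in boxes I).
Proof.
apply: (iffP (bigfcupP _ _ _ _)) => [[q]|[q qI kq]].
  by rewrite andbT => ? ?; exists q.
by exists q => //; rewrite andbT.
Qed.

Lemma spaced_cons q I : spaced (q :: I) -> spaced I.
Proof. by move=> S a b aI bI; apply: S; rewrite inE ?aI ?bI orbT. Qed.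

Lemma spaced_head q I k k' : spaced (q :: I) -> q \notin I ->
  k \in box (P q) n -> k' \in boxes I ->
  exists i, k ord0 i + r%:Z < k' ord0 i \/ k' ord0 i + r%:Z < k ord0 i.
Proof.
move=> S qI /in_boxP kq /in_boxesP[q' q'I /in_boxP k'q'].
have qq' : q != q' by apply: contraNneq qI => ->.
have [||i Hi] := S q q' _ _ qq'; first by rewrite inE eqxx.
  by rewrite inE q'I orbT.
exists i; have := kq i; have := k'q' i; move=> Hr.
set a := P q ord0 i; set b := P q' ord0 i; lia.
Qed.

Lemma boxes_cons q I : boxes (q :: I) = (box (P q) n `|` boxes I)%fset.
Proof. by rewrite /boxes big_cons. Qed.

Lemma boxes_disjoint q I : spaced (q :: I) -> q \notin I ->
  [disjoint box (P q) n & boxes I]%fset.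
Proof.
move=> S qI; apply/fdisjointP => k kq; apply/negP => kI.
by have [i] := spaced_head S qI kq kI; lia.
Qed.

Lemma sum_boxes (Z : zmodType) I (F : V -> Z) : uniq I -> spaced I ->
  \sum_(k <- boxes I) F k = \sum_(q <- I) \sum_(k <- box (P q) n) F k.
Proof.
elim: I => [|q I IH]; first by rewrite /boxes !big_nil.
move=> /= /andP[qI uI] S; rewrite boxes_cons sum_fsetU ?boxes_disjoint//.
by rewrite big_cons IH//; exact: spaced_cons S.
Qed.

Lemma card_boxes I : uniq I -> spaced I -> #|` boxes I| = (size I * n ^ d)%N.
Proof.
elim: I => [|q I IH]; first by rewrite /boxes big_nil cardfs0.
move=> /= /andP[qI uI] S; rewrite boxes_cons cardfsU.
have /eqP -> : (box (P q) n `&` boxes I == fset0)%fset by exact: boxes_disjoint.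
rewrite cardfs0 subn0 card_box IH ?mulSn//; exact: spaced_cons S.
Qed.

Lemma pair_energy_boxes (R : realType) N (Xi : {fset V})
    (g : V -> V -> 'rV[R]_N -> 'rV[R]_N -> R) I (w : V -> 'rV[R]_N) :
  (forall (xi : V) i, xi \in Xi -> - r%:Z <= xi ord0 i <= r%:Z) -> uniq I -> spaced I ->
  pair_energy Xi g (boxes I) w = \sum_(q <- I) pair_energy Xi g (box (P q) n) w.
Proof.
move=> rXi; elim: I => [|q I IH].
  by rewrite /boxes !big_nil /pair_energy big1// => xi _; rewrite big_mkcond big_seq_fset0.
move=> /= /andP[qI uI] S; rewrite boxes_cons big_cons pair_energyU ?boxes_disjoint//.
  by rewrite IH//; exact: spaced_cons S.
move=> xi xiXi k k' kq k'I; have [i Hi] := spaced_head S qI kq k'I.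
have Hr := rXi xi i xiXi.
by split; apply/eqP => kk'; move: Hi; rewrite -kk' coordD; lia.
Qed.

End boxes.

Lemma spaced_of_gap d (P : 'rV[int]_d -> 'rV[int]_d) n r (I : seq 'rV[int]_d) :
  (forall (k k' : 'rV[int]_d) i, k ord0 i < k' ord0 i ->
    P k ord0 i + (n + r)%N%:Z <= P k' ord0 i) -> spaced P n r I.
Proof.
move=> gap k k' _ _ /exists_coord_neq[i ki].
by exists i; move: ki; rewrite neq_lt => /orP[/gap|/gap]; [left|right].
Qed.

(** * The cell problem *)

(** Bernoulli's inequality. With x a ratio of side lengths, it bounds the fraction of volume lost
    when a cube shrinks. *)
Lemma onemX_le (R : realType) (x : R) n : 0 <= x <= 1 -> 1 - x ^+ n <= n%:R * (1 - x).
Proof.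
move=> /andP[x0 x1]; elim: n => [|n IH]; first by rewrite expr0 mul0r subrr.
have xn : x ^+ n <= 1 by rewrite exprn_ile1.
rewrite exprS -natr1; nra.
Qed.

(** It turns two spare units of side length into two spare lattice points, the least number that
    [sphere_fill] can work with. *)
Lemma ltn_exp_gap a b d : (0 < d)%N -> (b <= a)%N -> (a - b <= a ^ d - b ^ d)%N.
Proof.
case: d => // d _ ba; rewrite !expnS.
have [->|a0] := posnP a; first by rewrite !mul0n sub0n.
have ad : (0 < a ^ d)%N by rewrite expn_gt0 a0.
have bad : (b ^ d <= a ^ d)%N by case: d ad => // d _; rewrite leq_exp2r.
nia.
Qed.

Lemma expn_addn_ge n c d : (0 < d)%N -> (n ^ d + c <= (n + c) ^ d)%N.
Proof.
move=> d0; have := @ltn_exp_gap (n + c) n d d0 (leq_addr _ _); rewrite addKn.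
have : (n ^ d <= (n + c) ^ d)%N by rewrite leq_exp2r// leq_addr.
lia.
Qed.

(** Slots of pitch L, each occupied on its first n integers: Euclidean division recovers the slot of
    a point, so a pattern can be read off without choosing a box that contains the point. *)
Lemma divz_slot (n L : nat) (a b k : int) :
  a + L%:Z * b <= k < a + L%:Z * b + n%:Z -> (n <= L)%N -> ((k - a) %/ L)%Z = b.
Proof.
move=> kab nL; have -> : k - a = b * L%:Z + (k - a - L%:Z * b) by lia.
rewrite divzMDl; last by lia.
by rewrite divz_small ?addr0//; lia.
Qed.

Lemma slot_range (L l n s t : nat) (a b c k : int) :
  c <= a < c + l%:Z -> 0 <= b < 0 + s%:Z -> a + L%:Z * b <= k < a + L%:Z * b + n%:Z ->
  (n <= L)%N -> (l + s * L <= t)%N -> c <= k < c + t%:Z.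
Proof.
move=> ca bs kab nL lt.
have : L%:Z * b + L%:Z <= s%:Z * L%:Z by nia.
have : 0 <= L%:Z * b by nia.
move: kab; move: (L%:Z * b) => Lb; nia.
Qed.

Lemma tile_fits (n L l s t : nat) : (0 < l)%N -> (n < L)%N -> (l + s * L <= t)%N ->
  (2 <= t)%N -> (s * n + 2 <= t)%N.
Proof.
move=> l0 nL; have : (s * n + s <= s * L)%N by rewrite addnC -mulnS leq_mul2l nL orbT.
by case: s => [|s]; lia.
Qed.

(** The estimate 1 - sn/t <= (r + l)/n + (n + r + 2l)/t without denominators. The first term is the
    loss in the gaps between tiles, the second the loss at the rim. *)
Lemma tile_waste (n L r l s t : nat) : (n + r < L)%N -> (L <= n + r + l)%N ->
  (l + s * L <= t)%N -> (t < l + s.+1 * L)%N ->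
  (t * n <= s * n * n + (r + l) * t + (n + r + 2 * l) * n)%N.
Proof.
move=> nL Ln st ts; have sn : (s * n <= t)%N.
  by apply: leq_trans st; apply: leq_trans (leq_addl _ _); rewrite leq_mul2l; lia.
have tn : (t * n <= (l + L + s * L) * n)%N by rewrite leq_mul2r; lia.
have Ln2 : (s * L <= s * n + s * (r + l))%N by rewrite -mulnDr leq_mul2l; lia.
have Ln3 : (s * L * n <= s * n * n + (r + l) * (s * n))%N.
  by apply: (leq_trans (leq_mul Ln2 (leqnn n))); rewrite mulnDl; lia.
have Ln4 : ((r + l) * (s * n) <= (r + l) * t)%N by rewrite leq_mul2l sn orbT.
have Ln5 : ((l + L) * n <= (n + r + 2 * l) * n)%N by rewrite leq_mul2r; lia.
by move: tn; rewrite mulnDl; lia.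
Qed.

(** The data of G on the unit lattice, with the bounds on the sphere. Semicontinuity is stated at
    the diagonal points (z, z) because the competitor at |z| = 1 is the constant field z. *)
Record lattice_density (R : realType) (d N : nat) := LatticeDensity {
  ld_range : {fset 'rV[int]_d};
  ld_fun : 'rV[int]_d -> 'rV[int]_d -> 'rV[R]_N -> 'rV[R]_N -> R;
  ld_bound : R;
  ld_radius : nat;
  ld_period : nat;
  ld_funM : forall xi k a b, usphere a -> usphere b ->
    `|ld_fun xi k a b| <= ld_bound;
  ld_rangeP : forall (xi : 'rV[int]_d) i, xi \in ld_range ->
    - ld_radius%:Z <= xi ord0 i <= ld_radius%:Z;
  ld_period_gt0 : (0 < ld_period)%N;
  ld_periodic : forall (q : 'rV[int]_d) xi k a b, usphere a -> usphere b ->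
    ld_fun xi (ld_period%:Z *: q + k) a b = ld_fun xi k a b;
  ld_lsc : forall xi k z e, usphere z -> 0 < e -> exists2 del, 0 < del &
    forall a b, usphere a -> usphere b -> `|a - z| < del -> `|b - z| < del ->
      ld_fun xi k z z - e <= ld_fun xi k a b
}.

Section cell_problem.
Context {R : realType} {d N : nat} (d0 : (0 < d)%N) (hN : (2 <= N)%N).
Context (D : lattice_density R d N).
Local Notation V := 'rV[int]_d.
Local Notation Xi := (ld_range D).
Local Notation g := (ld_fun D).
Local Notation M := (ld_bound D).
Local Notation r := (ld_radius D).
Local Notation l := (ld_period D).
Local Notation gM := (@ld_funM _ _ _ D).
Local Notation rXi := (@ld_rangeP _ _ _ D).
Local Notation l0 := (ld_period_gt0 D).
Local Notation g_per := (@ld_periodic _ _ _ D).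
Implicit Types (w : V -> 'rV[R]_N) (p k : V) (n t : nat) (z : 'rV[R]_N).

Local Notation C := (pair_cost Xi M).
Local Notation E p n w := (pair_energy Xi g (box p n) w).

Lemma bound_ge0 : 0 <= M.
Proof. by have [v v1] := @exists_usphere R _ hN; exact: pair_bound_ge0 gM (fun=> v) _. Qed.

Lemma pair_cost_ge0 : 0 <= C.
Proof. by rewrite !mulr_ge0// ?ler0n// bound_ge0. Qed.

Lemma pair_energy0 w : pair_energy Xi g fset0 w = 0.
Proof. by rewrite /pair_energy big1// => xi _; rewrite big_mkcond big_seq_fset0. Qed.

Lemma pair_energy_le (X : {fset V}) w : sphere_valued w ->
  `|pair_energy Xi g X w| <= C * #|` X|%:R.
Proof.
move=> w1; have := pair_energy_sub Xi gM w1 (fsub0set X).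
by rewrite pair_energy0 cardfs0 !subr0.
Qed.

(** The field is kept on X, and [sphere_fill] chooses it on the remaining points so that the total
    becomes v; each new point costs at most [C]. *)
Lemma extend_fill (X Y : {fset V}) w v : sphere_valued w -> (X `<=` Y)%fset ->
  (#|` X| + 2 <= #|` Y|)%N ->
  enorm (v - \sum_(k <- X) w k) <= #|` Y|%:R - #|` X|%:R ->
  exists w', [/\ sphere_valued w', \sum_(k <- Y) w' k = v &
    pair_energy Xi g Y w' <= pair_energy Xi g X w + C * (#|` Y|%:R - #|` X|%:R)].
Proof.
move=> w1 XY card2 vX; set Z := (Y `\` X)%fset.
have cardZ : #|` Z| = (#|` Y| - #|` X|)%N by rewrite cardfsDS.
have [||w0 [w01 w0v]] := @sphere_fill R N hN V Z (v - \sum_(k <- X) w k) (fset_uniq _).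
- by rewrite -/(#|` Z|) cardZ; lia.
- by rewrite -/(#|` Z|) cardZ natrB ?fsubset_leq_card.
have w'1 : sphere_valued (fun k => if k \in X then w k else w0 k).
  by move=> k; case: ifP.
exists (fun k => if k \in X then w k else w0 k); split=> //.
  have -> : Y = (X `|` Z)%fset.
    apply/fsetP => k; rewrite !inE.
    by case kX: (k \in X) => //=; rewrite (fsubsetP XY).
  rewrite sum_fsetU; last first.
    by apply/fdisjointP => k kX; rewrite inE kX.
  rewrite (eq_big_seq w); last by move=> k ->.
  rewrite addrC (eq_big_seq w0) ?w0v ?subrK// => k.
  by rewrite inE => /andP[/negbTE ->].
have := pair_energy_sub Xi gM w'1 XY.
rewrite (@eq_pair_energy _ _ _ _ _ X _ w); last by move=> k ->.
by rewrite ler_norml => /andP[_]; rewrite lerBlDl.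
Qed.

Lemma tile p n w z m' t p' s : sphere_valued w -> uball z ->
  (0 < n)%N -> (n + r < l * m')%N -> (l + s * (l * m') <= t)%N -> (2 <= t)%N ->
  \sum_(k <- box p n) w k = (n ^ d)%:R *: z ->
  exists w', [/\ sphere_valued w', \sum_(k <- box p' t) w' k = (t ^ d)%:R *: z &
    E p' t w' <= (s ^ d)%:R * E p n w + C * ((t ^ d)%:R - (s ^ d * n ^ d)%:R)].
Proof.
move=> w1 z1 n0 nm' st t2 wz.
(* Rounding in each coordinate makes l c + p the first translate of p along the period that is not
   below p'. Alignment thus wastes less than l. *)
pose c : V := \row_i (- ((p ord0 i - p' ord0 i) %/ l)%Z).
pose sh (q : V) : V := c + m'%:Z *: q.
pose P (q : V) : V := l%:Z *: sh q + p.
have cP i : p' ord0 i <= l%:Z * c ord0 i + p ord0 i < p' ord0 i + l%:Z.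
  rewrite mxE; have := divz_eq (p ord0 i - p' ord0 i) l.
  have : 0 <= ((p ord0 i - p' ord0 i) %% l)%Z < l%:Z.
    by rewrite modz_ge0 ?ltz_pmod//; lia.
  set a := (_ %/ _)%Z; set b := (_ %% _)%Z; nia.
have PE q i : P q ord0 i = l%:Z * c ord0 i + p ord0 i + (l * m')%:Z * q ord0 i.
  by rewrite coordD coordZ coordD coordZ; lia.
pose I0 : {fset V} := box 0 s.
have sep : spaced P n r I0.
  move=> q q' _ _ /exists_coord_neq[i qi].
  exists i; rewrite !PE; move: qi; set a := q ord0 i; set b := q' ord0 i => ab.
  have [ab'|ab'] : a + 1 <= b \/ b + 1 <= a by lia.
  - by left; nia.
  - by right; nia.
(* Each point is sent back to the original box by the translation of its slot. Since the
   translations are multiples of l, the energy of every tile is that of the pattern. *)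
pose w0 k := w (k - l%:Z *: sh (\row_i ((k ord0 i - (l%:Z * c ord0 i + p ord0 i)) %/ (l * m')%:Z)%Z)).
have w01 : sphere_valued w0 by move=> k; exact: w1.
have w0P q : {in box (P q) n, w0 =1 fun k => w (k - l%:Z *: sh q)}.
  move=> k /in_boxP kP; rewrite /w0; congr (w (_ - _ *: sh _)); apply/rowP => i; rewrite mxE.
  by apply: (@divz_slot n); [rewrite -PE; exact: kP|lia].
have sumP q : \sum_(k <- box (P q) n) w0 k = (n ^ d)%:R *: z.
  rewrite (eq_big_seq _ (w0P q)) -wz box_shift big_imfset /=.
    by apply: eq_bigr => k _; rewrite addrC addKr.
  by move=> a b _ _ /addrI.
have EP q : E (P q) n w0 = E p n w.
  rewrite (eq_pair_energy _ _ (w0P q)) box_shift pair_energy_shift; last by move=> k; exact: w1.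
    by apply: eq_pair_energy => k _; rewrite addrC addKr.
  by move=> xi k a b; exact: g_per.
have ub : uniq I0 by exact: fset_uniq.
have sub : (boxes P n I0 `<=` box p' t)%fset.
  apply/fsubsetP => k /in_boxesP[q /in_boxP q0 /in_boxP kq]; apply/in_boxP => i.
  have := kq i; have := q0 i; rewrite PE mxE => q0i kqi.
  by apply: slot_range (cP i) q0i kqi _ st; lia.
have cb : #|` boxes P n I0| = (s ^ d * n ^ d)%N.
  by rewrite (card_boxes ub sep) -/(#|` I0|) card_box.
(* At least two points stay outside the tiles, and they bring the average to exactly z. *)
have gap : (s ^ d * n ^ d + 2 <= t ^ d)%N.
  have sn : (s * n + 2 <= t)%N by apply: tile_fits st t2; [exact: l0|lia].
  rewrite -expnMn; have := @ltn_exp_gap t (s * n) d d0; lia.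
have [||w' [w'1 w't w'E]] := @extend_fill (boxes P n I0) (box p' t) w0 ((t ^ d)%:R *: z) w01 sub.
- by rewrite cb card_box.
- rewrite (sum_boxes _ ub sep) (eq_bigr _ (fun q _ => sumP q)) big_const_seq count_predT iter_addr addr0.
  have -> : (n ^ d)%:R *: z *+ #|` I0| = (s ^ d * n ^ d)%:R *: z.
    by rewrite card_box scalerMnl -mulrnA mulnC.
  rewrite -scalerBl enormZ card_box cb.
  rewrite ger0_norm; last by rewrite subr_ge0 ler_nat; lia.
  by rewrite ler_piMr// subr_ge0 ler_nat; lia.
exists w'; split => //; apply: le_trans w'E _.
rewrite card_box cb lerD2r (pair_energy_boxes g w0 rXi ub sep).
rewrite (eq_bigr _ (fun q _ => EP q)) big_const_seq count_predT iter_addr addr0.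
by rewrite -/(#|` I0|) card_box mulr_natl.
Qed.

(** 2C bounds C - x for a normalized energy x, and d comes from 1 - y^d <= d (1 - y), where y is the
    fraction of the side covered by tiles. *)
Definition cell_const : R := 2 * C * d%:R.

Lemma cell_const_ge0 : 0 <= cell_const.
Proof. by rewrite mulr_ge0// mulr_ge0// pair_cost_ge0. Qed.

Lemma tile_bound p n w z t p' : sphere_valued w -> uball z ->
  (0 < n)%N -> (l <= t)%N -> (2 <= t)%N ->
  \sum_(k <- box p n) w k = (n ^ d)%:R *: z ->
  exists w', [/\ sphere_valued w', \sum_(k <- box p' t) w' k = (t ^ d)%:R *: z &
    E p' t w' / (t ^ d)%:R <= E p n w / (n ^ d)%:R +
      cell_const * ((r + l)%:R / n%:R + (n + r + 2 * l)%:R / t%:R)].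
Proof.
(* l m' is the smallest multiple of the period exceeding n + r, and s is the number of such pitches
   that fit once l is set aside for the alignment. *)
move=> w1 z1 n0 lt t2 wz; pose m' := ((n + r) %/ l).+1; pose s := ((t - l) %/ (l * m'))%N.
have nm' : (n + r < l * m')%N by rewrite mulnC; apply: ltn_ceil; exact: l0.
have m'n : (l * m' <= n + r + l)%N.
  have -> : (l * m' = l + (n + r) %/ l * l)%N by rewrite /m' mulnS (mulnC l).
  by have := leq_divM (n + r) l; lia.
have st : (l + s * (l * m') <= t)%N by have := leq_divM (t - l) (l * m'); rewrite /s; lia.
have ts : (t < l + (s.+1) * (l * m'))%N.
  by have := @ltn_ceil (t - l) (l * m') _; rewrite -/s; lia.
have [w' [w'1 w't w'E]] := tile p' w1 z1 n0 nm' st t2 wz; exists w'; split => //.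
have nd : 0 < (n ^ d)%:R :> R by rewrite ltr0n expn_gt0 n0.
have td : 0 < (t ^ d)%:R :> R by rewrite ltr0n expn_gt0; lia.
have t0 : 0 < t%:R :> R by rewrite ltr0n; lia.
have n0' : 0 < n%:R :> R by rewrite ltr0n.
have Ew : `|E p n w / (n ^ d)%:R| <= C.
  by rewrite normrM normfV (gtr0_norm nd) ler_pdivrMr// -(card_box p) pair_energy_le.
set x := E p n w / (n ^ d)%:R in Ew *.
pose y : R := (s * n)%:R / t%:R.
have y01 : 0 <= y <= 1.
  rewrite /y divr_ge0//= ler_pdivrMr// mul1r ler_nat.
  by have := tile_fits l0 (leq_ltn_trans (leq_addr r n) nm') st t2; lia.
have ydE : (s ^ d * n ^ d)%:R = y ^+ d * (t ^ d)%:R :> R.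
  by rewrite /y expr_div_n -!natrX divfK ?gt_eqF// -expnMn.
have w'E2 : E p' t w' / (t ^ d)%:R <= y ^+ d * x + C * (1 - y ^+ d).
  rewrite ler_pdivrMr//; apply: le_trans w'E _.
  rewrite mulrDl; apply: lerD.
    have Ex : E p n w = x * (n ^ d)%:R by rewrite divfK// gt_eqF.
    suff -> : (s ^ d)%:R * E p n w = y ^+ d * x * (t ^ d)%:R by [].
    by rewrite Ex mulrCA -natrM ydE; ring.
  rewrite ydE; set T := (t ^ d)%:R.
  by have -> : C * (1 - y ^+ d) * T = C * (T - y ^+ d * T) by ring.
have yd : 1 - y ^+ d <= d%:R * (1 - y) by exact: onemX_le.
have yd0 : 0 <= 1 - y ^+ d by rewrite subr_ge0 exprn_ile1//; case/andP: y01.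
have y1 : 1 - y <= (r + l)%:R / n%:R + (n + r + 2 * l)%:R / t%:R.
  have H := tile_waste nm' m'n st ts.
  rewrite lerBlDl /y addrA -[leLHS](@mulfK _ (n%:R * t%:R)) ?mulf_neq0 ?gt_eqF//.
  rewrite ler_pdivrMr ?mulr_gt0// !mulrDl mul1r.
  have -> : (s * n)%:R / t%:R * (n%:R * t%:R) = (s * n * n)%:R :> R.
    by rewrite !natrM; field; rewrite gt_eqF.
  have -> : (r + l)%:R / n%:R * (n%:R * t%:R) = ((r + l) * t)%:R :> R.
    by rewrite !natrM; field; rewrite gt_eqF.
  have -> : (n + r + 2 * l)%:R / t%:R * (n%:R * t%:R) = ((n + r + 2 * l) * n)%:R :> R.
    by rewrite !natrM; field; rewrite gt_eqF.
  by rewrite -natrM -!natrD ler_nat (mulnC n).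
apply: le_trans w'E2 _.
have -> : y ^+ d * x + C * (1 - y ^+ d) = x + (C - x) * (1 - y ^+ d) by ring.
rewrite lerD2l /cell_const; move: pair_cost_ge0 Ew; move: C => C' C0.
rewrite ler_norml => /andP[xC _].
apply: le_trans (_ : (2 * C') * (1 - y ^+ d) <= _).
  by apply: ler_wpM2r => //; lra.
rewrite -[leRHS]mulrA; apply: ler_wpM2l; first lra.
by apply: le_trans yd _; exact: ler_wpM2l.
Qed.

Definition averages p n z w :=
  sphere_valued w /\ \sum_(k <- box p n) w k = (n ^ d)%:R *: z.

Definition phi_set z : set R :=
  [set y | exists p n w, [/\ (0 < n)%N, averages p n z w &
     y = E p n w / (n ^ d)%:R + cell_const * ((r + l)%:R / n%:R)]].

(* The second summand of [phi_set] absorbs the cost of tiling a larger box, so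
   that the infimum is the limit of the normalized minimal energies. *)
Definition phi z : R := inf (phi_set z).

Definition phi_rate : R := cell_const * (r + l)%:R.

Lemma phi_rate_ge0 : 0 <= phi_rate.
Proof. by rewrite mulr_ge0// cell_const_ge0. Qed.

Lemma normalized_energy_le p n w : (0 < n)%N -> sphere_valued w ->
  `|E p n w / (n ^ d)%:R| <= C.
Proof.
move=> n0 w1; have nd : 0 < (n ^ d)%:R :> R by rewrite ltr0n expn_gt0 n0.
by rewrite normrM normfV (gtr0_norm nd) ler_pdivrMr// -(card_box p) pair_energy_le.
Qed.

Lemma phi_set_nonempty z : uball z -> phi_set z !=set0.
Proof.
move=> z1; have [v v1] := @exists_usphere R _ hN.
(* Side 2 is enough: the box has at least two points, all of them free. *)
have [||||w [w1 wz _]] := @extend_fill fset0 (box 0 2) (fun=> v) ((2 ^ d)%:R *: z).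
- by [].
- exact: fsub0set.
- by rewrite cardfs0 card_box; case: (d) d0 => // d' _; rewrite expnS leq_pmulr// expn_gt0.
- rewrite big_seq_fset0 subr0 cardfs0 subr0 card_box enormZ ger0_norm//.
  by rewrite ler_piMr.
by eexists; exists 0, 2%N, w; split.
Qed.

Lemma phi_set_lbound z : lbound (phi_set z) (- C).
Proof.
move=> _ [p [n [w [n0 [w1 _] ->]]]]; have := normalized_energy_le p n0 w1.
rewrite ler_norml => /andP[H _]; apply: le_trans H _; rewrite lerDl.
by rewrite mulr_ge0 ?cell_const_ge0// divr_ge0.
Qed.

Lemma phi_le p n w z : (0 < n)%N -> averages p n z w ->
  phi z <= E p n w / (n ^ d)%:R + phi_rate / n%:R.
Proof.
move=> n0 wz; rewrite -mulrA; apply: ge_inf; first by exists (- C); exact: phi_set_lbound.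
by exists p, n, w.
Qed.

(** Tile by a nearly minimal element of [phi_set]: its correction term pays for the gaps, and the
    rim of the large box becomes negligible. Together with [phi_le], this makes [phi] the limit of
    the normalized minima at exact average z. *)
Lemma phi_approx z e : uball z -> 0 < e -> exists t0 : nat, forall t, (t0 <= t)%N ->
  forall p, exists2 w, averages p t z w & E p t w / (t ^ d)%:R <= phi z + e.
Proof.
move=> z1 e0; have e20 : 0 < e / 2 by rewrite divr_gt0.
have [_ [p [n [w [n0 [w1 wz] ->]]]] H] := inf_adherent e20
  (conj (phi_set_nonempty z1) (ex_intro _ _ (@phi_set_lbound z))).
pose c := cell_const * (n + r + 2 * l)%:R.
have c0 : 0 <= c by rewrite mulr_ge0 ?cell_const_ge0.
exists (maxn l (maxn 2 (Num.truncn (c / (e / 2))).+1)) => t.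
rewrite !geq_max => /and3P[lt t2 tc] p'.
have [w' [w'1 w't w'E]] := tile_bound p' w1 z1 n0 lt t2 wz.
exists w'; first by split.
apply: le_trans w'E _; rewrite mulrDr addrA.
suff : cell_const * ((n + r + 2 * l)%:R / t%:R) <= e / 2.
  by move=> H2; move: H; rewrite -/(phi z); lra.
have t0 : 0 < t%:R :> R by rewrite ltr0n; lia.
rewrite mulrA ler_pdivrMr// (mulrC (e / 2)) -ler_pdivrMr//.
by apply: le_trans (ltW (truncnS_gt _)) _; rewrite ler_nat.
Qed.

Lemma phi_bounded z : uball z -> `|phi z| <= C + phi_rate.
Proof.
move=> z1; rewrite ler_norml; apply/andP; split.
  have : - C <= phi z by apply: lb_le_inf; [exact: phi_set_nonempty|exact: phi_set_lbound].
  by have := phi_rate_ge0; lra.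
have [t0 H] := phi_approx z1 ltr01; have [w wz _] := H (maxn t0 1) (leq_maxl _ _) 0.
have t1 : (0 < maxn t0 1)%N by rewrite leq_max orbT.
apply: le_trans (phi_le t1 wz) _; apply: lerD.
  by case: wz => w1 _; apply: le_trans (ler_norm _) (normalized_energy_le _ t1 w1).
by rewrite ler_pdivrMr ?ltr0n// ler_peMr ?phi_rate_ge0// ler1n.
Qed.

End cell_problem.

Lemma common_radius (R : realType) (T : eqType) (s : seq T) (P : T -> R -> Prop) :
  (forall x e e', P x e -> 0 < e' -> e' <= e -> P x e') ->
  (forall x, x \in s -> exists2 e, 0 < e & P x e) ->
  exists2 e, 0 < e & forall x, x \in s -> P x e.
Proof.
move=> mono; elim: s => [|x s IH] H; first by exists 1.
have [e1 e10 Pe1] := H x (mem_head _ _).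
have [|e2 e20 Pe2] := IH; first by move=> y ys; apply: H; rewrite inE ys orbT.
have m0 : 0 < Num.min e1 e2 by rewrite lt_min e10.
exists (Num.min e1 e2) => // y; rewrite inE => /predU1P[->|ys].
  by apply: mono Pe1 _ _ => //; rewrite ge_min lexx.
by apply: mono (Pe2 y ys) _ _ => //; rewrite ge_min lexx orbT.
Qed.

(** A diagonal choice: if every fixed tolerance is eventually admissible, some vanishing sequence of
    tolerances is. It provides both the accuracy of the patterns and the rate at which the penalty
    in the upper bound may grow. *)
Lemma slow_tolerance (R : realType) (P : nat -> R -> Prop) :
  (forall e, 0 < e -> exists n0 : nat, forall n, (n0 <= n)%N -> P n e) ->
  exists eta : nat -> R, [/\ forall n, 0 < eta n, eta @ \oo --> (0 : R) &
    \forall n \near \oo, P n (eta n)].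
Proof.
(* Index q stands for the tolerance 1/(q + 1), required from n on. The largest admissible q is
   sought among 0, ..., n to keep the maximum finite; it is 0 by convention as long as no index is
   admissible. *)
move=> H; pose ok n (q : nat) := `[< forall n', (n <= n')%N -> P n' (q.+1%:R^-1) >].
pose q n := (\max_(i < n.+1 | ok n i) (i : nat))%N.
have okq q0 : exists n0 : nat, forall n, (n0 <= n)%N -> ok n q0.
  have [|n0 Hn0] := H (q0.+1%:R^-1); first by rewrite invr_gt0.
  exists n0 => n nn0; apply/asboolP => n' nn'; apply: Hn0; exact: leq_trans nn'.
exists (fun n => (q n).+1%:R^-1); split=> [n||].
- by rewrite invr_gt0.
- apply/cvgrPdist_le => e e0; pose q0 := Num.truncn e^-1.
  have [n0 Hn0] := okq q0; near=> n.
  have nn0 : (n0 <= n)%N by near: n; exact: nbhs_infty_ge.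
  have nq0 : (q0 < n.+1)%N by near: n; exact: nbhs_infty_ge.
  have qq0 : (q0 <= q n)%N by exact: (@leq_bigmax_cond _ _ _ (Ordinal nq0) (Hn0 n nn0)).
  rewrite sub0r normrN gtr0_norm ?invr_gt0// invf_ple ?posrE//.
  by apply: le_trans (ltW (truncnS_gt _)) _; rewrite ler_nat ltnS.
- have [n0 Hn0] := okq 0; near=> n.
  have nn0 : (n0 <= n)%N by near: n; exact: nbhs_infty_ge.
  have [|i oki qi] := @eq_bigmax_cond _ (fun i : 'I_n.+1 => ok n i) (fun i => i : nat).
    by apply/card_gt0P; exists ord0; exact: Hn0.
  by rewrite /q qi; move/asboolP : oki; exact.
Unshelve. all: by end_near. Qed.

(** * Lower semicontinuity of the cell energy, and uniform patterns *)

Section cell_formula.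
Context {R : realType} {d N : nat} (d0 : (0 < d)%N) (hN : (2 <= N)%N).
Context (D : lattice_density R d N).
Local Notation V := 'rV[int]_d.
Local Notation Xi := (ld_range D).
Local Notation g := (ld_fun D).
Local Notation l := (ld_period D).
Implicit Types (w : V -> 'rV[R]_N) (p k : V) (n t : nat) (z : 'rV[R]_N).

Local Notation C := (pair_cost Xi (ld_bound D)).
Local Notation E p n w := (pair_energy Xi g (box p n) w).

Local Notation rate := (phi_rate D).

(** A nearly optimal pattern of average y in a box of side n is completed to average z in a box of
    side about (1 + b) n. The added layer can correct the sum because |z| < 1. *)
Lemma phi_lsc_interior z e : enorm z < 1 -> 0 < e -> exists2 del, 0 < del &
  forall y, uball y -> `|y - z| < del -> phi D z <= phi D y + e.
Proof.
(* The final error is e/3 + 2Kb: the layer has volume fraction at most 2db and changes the energy by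
   at most 2C + [rate] there, and the correction of [phi_le] is at most 2b [rate]. *)
move=> z1 e0; pose K : R := d%:R * (2 * C + rate) + rate.
have K0 : 0 <= K.
  by rewrite addr_ge0 ?phi_rate_ge0// mulr_ge0// addr_ge0 ?phi_rate_ge0// mulr_ge0// pair_cost_ge0.
pose b := e / (3 * K + 3).
have b0 : 0 < b by rewrite divr_gt0//; lra.
have bK : 2 * (K * b) <= 2 * (e / 3).
  rewrite ler_pM2l// /b mulrA ler_pdivrMr; last lra.
  by rewrite mulrC; nra.
have N0 : 0 < N%:R :> R by rewrite ltr0n; lia.
(* The T - Nn new unit vectors must supply (T - Nn) z + Nn (z - y), hence Nn |z - y| has to be at
   most (T - Nn)(1 - |z|), where T - Nn >= b Nn. The factor N compares the Euclidean and the sup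
   norm. *)
exists (b * (1 - enorm z) / N%:R); first by rewrite divr_gt0// mulr_gt0// subr_gt0.
move=> y y1 yz; have e30 : 0 < e / 3 by rewrite divr_gt0.
have [t0 H] := phi_approx d0 hN D y1 e30.
pose n := maxn (maxn t0 1) (Num.truncn (3 / b)).+1.
have nt0 : (t0 <= n)%N by rewrite /n !leq_max leqnn.
have n1 : (0 < n)%N by rewrite /n !leq_max orbT.
have n0 : 0 < n%:R :> R by rewrite ltr0n.
have nb : 3 / n%:R <= b.
  rewrite ler_pdivrMr// -ler_pdivrMl// mulrC.
  by apply: le_trans (ltW (truncnS_gt _)) _; rewrite ler_nat /n leq_max leqnn orbT.
have [w [w1 wy] wE] := H n nt0 0.
(* c lies between bn and bn + 2 and is at least 2, which leaves the two free points needed for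
   filling. As bn >= 3, the layer has relative width at most 2b. *)
pose c := (Num.truncn (b * n%:R)).+2; pose t := (n + c)%N.
have cn : b * n%:R <= c%:R.
  by apply: le_trans (ltW (truncnS_gt _)) _; rewrite ler_nat.
have cn' : c%:R <= b * n%:R + 2.
  by rewrite -[c]addn2 natrD lerD2r truncn_le// mulr_ge0// ltW.
have t0' : 0 < t%:R :> R by rewrite ltr0n /t addn_gt0 n1.
have tE : t%:R = n%:R + c%:R :> R by rewrite natrD.
pose T := (t ^ d)%:R : R; pose Nn := (n ^ d)%:R : R.
have T0 : 0 < T by rewrite ltr0n expn_gt0 /t addn_gt0 n1.
have Nn0 : 0 < Nn by rewrite ltr0n expn_gt0 n1.
have TN : b * Nn <= T - Nn.
  have tn1 : 1 <= t%:R / n%:R :> R by rewrite ler_pdivlMr// mul1r ler_nat leq_addr.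
  have : t%:R / n%:R <= (t%:R / n%:R) ^+ d :> R by exact: ler_eXnr.
  rewrite expr_div_n -!natrX -/T -/Nn ler_pdivlMr// tE mulrDl divff ?gt_eqF//.
  have : b <= c%:R / n%:R by rewrite ler_pdivlMr.
  by move: (c%:R / n%:R) => x; nra.
have sub : (box (0 : V) n `<=` box 0 t)%fset.
  exact/box_leq/leq_addr.
have gap : (#|` box (0 : V) n| + 2 <= #|` box (0 : V) t|)%N.
  by rewrite !card_box; apply: leq_trans (expn_addn_ge _ _ d0); rewrite leq_add2l.
have [|w' [w'1 w'z w'E]] := extend_fill (v := T *: z) d0 hN D w1 sub gap.
  rewrite wy !card_box -/T -/Nn.
  have -> : T *: z - Nn *: y = (T - Nn) *: z + Nn *: (z - y).
    by rewrite scalerBl scalerBr addrA subrK.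
  apply: le_trans (enormD _ _) _; rewrite !enormZ (gtr0_norm Nn0) ger0_norm; last by nra.
  have zy : enorm (z - y) <= b * (1 - enorm z).
    apply: le_trans (enorm_le_norm _) _; rewrite distrC mulrC.
    by rewrite -ler_pdivlMr// ltW.
  have : Nn * enorm (z - y) <= Nn * (b * (1 - enorm z)) by rewrite ler_pM2l.
  have : (b * Nn) * (1 - enorm z) <= (T - Nn) * (1 - enorm z) by apply: ler_wpM2r => //; lra.
  by move: (enorm (z - y)) => x; lra.
have t1 : (0 < t)%N by rewrite addn_gt0 n1.
apply: le_trans (phi_le hN D t1 (conj w'1 w'z)) _.
rewrite !card_box -/T -/Nn in w'E *.
have wE' : E 0 n w <= (phi D y + e / 3) * Nn by rewrite -ler_pdivrMr.
have TNle : 1 - Nn / T <= d%:R * (c%:R / t%:R).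
  have -> : c%:R / t%:R = 1 - n%:R / t%:R :> R by rewrite tE; field; rewrite -tE gt_eqF.
  rewrite /Nn /T !natrX -expr_div_n; apply: onemX_le.
  by rewrite divr_ge0//= ler_pdivrMr// mul1r ler_nat leq_addr.
have ct : c%:R / t%:R <= 2 * b.
  rewrite ler_pdivrMr// tE; have : 3 <= b * n%:R by rewrite -ler_pdivrMr.
  have : 0 <= b * c%:R by rewrite mulr_ge0// ltW.
  by move: cn'; lra.
have phiC := phi_bounded d0 hN D y1.
have Cpos := pair_cost_ge0 hN D; have rpos := phi_rate_ge0 hN D.
set F := phi D y in wE' phiC *; set CC := C in phiC Cpos w'E K0 bK *.
pose a : R := 1 - Nn / T.
have a0 : 0 <= a by rewrite subr_ge0 ler_pdivrMr// mul1r; nra.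
have step1 : E 0 t w' / T <= F + e / 3 + a * (CC - F - e / 3).
  rewrite ler_pdivrMr//; apply: le_trans w'E _.
  have -> : (F + e / 3 + a * (CC - F - e / 3)) * T = (F + e / 3) * Nn + CC * (T - Nn).
    by rewrite /a; field; rewrite gt_eqF.
  exact: lerD.
have ab : a <= d%:R * (2 * b) by apply: le_trans TNle _; exact: ler_wpM2l.
have step2 : a * (CC - F - e / 3) <= d%:R * (2 * b) * (2 * CC + rate).
  apply: le_trans (_ : a * (2 * CC + rate) <= _).
    by apply: ler_wpM2l => //; move: phiC; rewrite ler_norml; lra.
  by apply: ler_wpM2r => //; lra.
have step3 : rate / t%:R <= 2 * b * rate.
  rewrite mulrC; apply: ler_wpM2r => //; rewrite -div1r ler_pdivrMr// tE.
  have : 3 <= b * n%:R by rewrite -ler_pdivrMr.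
  have : 0 <= b * c%:R by rewrite mulr_ge0// ltW.
  lra.
have KE : d%:R * (2 * b) * (2 * CC + rate) + 2 * b * rate = 2 * (K * b) by rewrite /K -/CC; ring.
by move: step1 step2 step3 KE bK; lra.
Qed.

Lemma usphere_dist (a z : 'rV[R]_N) : usphere a -> usphere z ->
  enorm (a - z) ^+ 2 = 2 * (1 - dotv a z).
Proof.
rewrite /usphere /= => a1 z1.
by rewrite sqr_enorm dotvBl !dotvDr !dotvNr -!sqr_enorm a1 z1 (dotvC z a); ring.
Qed.

(** By periodicity only finitely many pairs (xi, k) matter, so one radius serves all of them. *)
Lemma uniform_lsc z e : usphere z -> 0 < e -> exists2 del, 0 < del &
  forall xi k a b, xi \in Xi -> usphere a -> usphere b -> `|a - z| < del -> `|b - z| < del ->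
    g xi k z z - e <= g xi k a b.
Proof.
move=> z1 e0.
pose P (x : V * V) del := forall a b, usphere a -> usphere b ->
  `|a - z| < del -> `|b - z| < del -> g x.1 x.2 z z - e <= g x.1 x.2 a b.
pose s := [seq (xi, k) | xi <- (Xi : seq V), k <- (box (0 : V) l : seq V)].
have [|x _|del del0 Hdel] := @common_radius R _ s P.
- move=> x e1 e2 Pe _ e21 a b a1 b1 az bz; apply: Pe => //; exact: lt_le_trans e21.
- exact: ld_lsc.
exists del => // xi k a b xiXi a1 b1 az bz.
have l0 := ld_period_gt0 D.
pose q : V := \row_i (k ord0 i %/ l)%Z; pose k0 : V := k - l%:Z *: q.
have kE : k = l%:Z *: q + k0 by rewrite /k0 addrC subrK.
rewrite kE !ld_periodic//; apply: (Hdel (xi, k0)) => //.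
apply/allpairsP; exists (xi, k0); split=> //=; apply/in_boxP => i.
rewrite /k0 coordD coordN coordZ !mxE; have := divz_eq (k ord0 i) l.
have : 0 <= (k ord0 i %% l)%Z < l%:Z by rewrite modz_ge0 ?ltz_pmod//; lia.
by set x := (_ %% _)%Z; set y := (_ %/ _)%Z; set u := k ord0 i; lia.
Qed.

(** The constant field z is compared with a pattern w of average y. On points where w is close to z
    the semicontinuity of the density applies; the other points are few and cost at most [pair_cost]
    each, once for each of the two fields. Each of the four errors is at most e/4. *)
Lemma phi_lsc_sphere z e : usphere z -> 0 < e -> exists2 del, 0 < del &
  forall y, uball y -> `|y - z| < del -> phi D z <= phi D y + e.
Proof.
move=> z1 e0; pose e1 := e / (4 * (#|` Xi|%:R + 1)).
have Xi0 : 0 < #|` Xi|%:R + 1 :> R by rewrite ltr_wpDl.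
have e10 : 0 < e1 by rewrite divr_gt0// mulr_gt0.
have [h h0 Hh] := uniform_lsc z1 e10.
have N0 : 0 < N%:R :> R by rewrite ltr0n; lia.
set CC := C; have CC0 : 0 <= CC by exact: pair_cost_ge0.
have D0 : 0 < 16 * (CC + 1) * N%:R by rewrite !mulr_gt0// ltr_wpDl.
(* With at most 2N |y - z| Nn / h^2 bad points, this radius keeps their cost for both fields below
   e/4 per point of the box. *)
exists (e * h ^+ 2 / (16 * (CC + 1) * N%:R)).
  by rewrite divr_gt0// mulr_gt0// exprn_gt0.
move=> y y1 yz; have e40 : 0 < e / 4 by rewrite divr_gt0.
have [t0 H] := phi_approx d0 hN D y1 e40.
pose n := maxn (maxn t0 1) (Num.truncn (rate / (e / 4))).+1.
have nt0 : (t0 <= n)%N by rewrite /n !leq_max leqnn.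
have n1 : (0 < n)%N by rewrite /n !leq_max orbT.
have n0 : 0 < n%:R :> R by rewrite ltr0n.
have nr : rate / n%:R <= e / 4.
  rewrite ler_pdivrMr// mulrC -ler_pdivrMr//.
  by apply: le_trans (ltW (truncnS_gt _)) _; rewrite ler_nat /n leq_max leqnn orbT.
have [w [w1 wy] wE] := H n nt0 0.
set Nn := (n ^ d)%:R in wE wy.
have Nn0 : 0 < Nn :> R by rewrite ltr0n expn_gt0 n1.
pose B := box (0 : V) n.
pose X := [fset k in B | `|w k - z| < h]%fset.
pose bad : R := #|` B|%:R - #|` X|%:R.
have XB : (X `<=` B)%fset by apply/fsubsetP => k; rewrite !inE => /andP[].
have z1' : sphere_valued (fun _ : V => z) by [].
have avz : averages (0 : V) n z (fun=> z).
  by split => //; rewrite big_const_seq count_predT iter_addr addr0 -/(#|` B|) card_box scaler_nat.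
have := phi_le hN D n1 avz; rewrite -/B -/Nn.
have := pair_energy_sub Xi (@ld_funM _ _ _ D) w1 XB.
have := pair_energy_sub Xi (@ld_funM _ _ _ D) z1' XB.
rewrite -/bad -/CC !ler_norml => /andP[_ Ez] /andP[Ew _] phiz.
have Bn : #|` B|%:R = Nn :> R by rewrite card_box.
have Xn : #|` X|%:R <= Nn :> R by rewrite -Bn ler_nat fsubset_leq_card.
have EX : pair_energy Xi g X (fun=> z) <= pair_energy Xi g X w + e / 4 * Nn.
  rewrite -lerBlDl /pair_energy -sumrB.
  apply: le_trans (_ : \sum_(xi <- Xi) e1 * Nn <= _).
    rewrite big_seq [leRHS]big_seq; apply: ler_sum => xi xiXi; rewrite -sumrB.
    apply: le_trans (_ : \sum_(k <- X) e1 <= _); last first.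
      by rewrite big_const_seq count_predT iter_addr addr0 -mulr_natr ler_wpM2l// ltW.
    rewrite big_mkcond big_seq [leRHS]big_seq; apply: ler_sum => k kX.
    case: ifP => [kxiX|_]; last exact: ltW.
    move: kX kxiX; rewrite !inE => /andP[_ wk] /andP[_ wkxi].
    by have := Hh xi k _ _ xiXi (w1 k) (w1 (k + xi)) wk wkxi; lra.
  rewrite big_const_seq count_predT iter_addr addr0.
  have -> : e1 * Nn *+ #|` Xi| = e1 * #|` Xi|%:R * Nn by rewrite -mulr_natr mulrAC.
  apply: ler_wpM2r; first exact: ltW.
  rewrite /e1 mulrAC ler_pdivrMr ?mulr_gt0//.
  by have := ltW e0; lra.
(* Chebyshev's inequality: a bad point contributes at least h^2 to the sum of |w k - z|^2 = 2 (1 - w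
   k . z), and that sum is 2 Nn (1 - y . z) since y is the average of w. *)
have badE : bad * h ^+ 2 <= 2 * N%:R * `|y - z| * Nn.
  rewrite /bad (card_sum_notin R XB) mulr_suml.
  apply: le_trans (_ : \sum_(k <- B) 2 * (1 - dotv (w k) z) <= _).
    rewrite big_seq [leRHS]big_seq; apply: ler_sum => k kB.
    rewrite -usphere_dist//; case kX : (k \in X) => /=; first by rewrite mul0r sqr_ge0.
    rewrite mul1r ler_sqr ?nnegrE ?enorm_ge0//; last exact: ltW.
    apply: le_trans (norm_le_enorm _); rewrite leNgt; apply/negP => wk.
    by move: kX; rewrite !inE kB wk.
  rewrite -mulr_sumr sumrB -dotv_suml wy dotvZl.
  rewrite big_const_seq count_predT iter_addr addr0 -/(#|` B|) Bn.
  have -> : 2 * (Nn - Nn * dotv y z) = 2 * (Nn * (1 - dotv y z)) by ring.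
  have -> : 2 * N%:R * `|y - z| * Nn = 2 * (Nn * (N%:R * `|y - z|)) by ring.
  rewrite ler_pM2l// ler_pM2l//.
  have -> : 1 - dotv y z = dotv (z - y) z by rewrite dotvBl -sqr_enorm z1 expr1n.
  apply: le_trans (dotv_le_enorm _ _) _.
  by rewrite z1 mulr1 distrC enorm_le_norm.
have badC : 2 * CC * bad <= e / 4 * Nn.
  have h20 : 0 < h ^+ 2 by rewrite exprn_gt0.
  rewrite -(ler_pM2r h20) -[leLHS]mulrA.
  apply: le_trans (ler_wpM2l _ badE) _; first by rewrite mulr_ge0.
  have yz' : `|y - z| * (16 * (CC + 1) * N%:R) <= e * h ^+ 2 by rewrite -ler_pdivlMr// ltW.
  have -> : 2 * CC * (2 * N%:R * `|y - z| * Nn) =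
      4^-1 * Nn * (`|y - z| * (16 * CC * N%:R)) by field.
  have -> : e / 4 * Nn * h ^+ 2 = 4^-1 * Nn * (e * h ^+ 2) by field.
  apply: ler_wpM2l; first by rewrite mulr_ge0// ltW.
  apply: le_trans yz'; apply: ler_wpM2l => //.
  by apply: ler_wpM2r => //; apply: ler_wpM2l => //; rewrite lerDl.
have wE' : E 0 n w <= (phi D y + e / 4) * Nn by rewrite -ler_pdivrMr.
apply: le_trans phiz _.
apply: le_trans (_ : (phi D y + e / 4 + e / 4 + e / 4) + e / 4 <= _); last lra.
apply: lerD => //; rewrite ler_pdivrMr//.
by move: Ez Ew EX badC wE'; rewrite -/B; lra.
Qed.

Lemma phi_lsc z e : uball z -> 0 < e -> exists2 del, 0 < del &
  forall y, uball y -> `|y - z| < del -> phi D z <= phi D y + e.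
Proof.
rewrite /uball /= le_eqVlt => /predU1P[z1|z1] e0; first exact: phi_lsc_sphere.
exact: phi_lsc_interior.
Qed.

(** The threshold in [phi_approx] depends on z. The ball is therefore cut into finitely many classes
    of diameter at most e, and a whole class uses the patterns of a single point y of it at which
    [phi] is nearly minimal. The price is an error e in the average. *)
Lemma uniform_patterns e : 0 < e -> exists n0 : nat, forall n, (n0 <= n)%N ->
  forall z p, uball z -> exists w, [/\ sphere_valued w,
    `|(n ^ d)%:R^-1 *: (\sum_(k <- box p n) w k) - z| <= e &
    E p n w / (n ^ d)%:R <= phi D z + e].
Proof.
move=> e0; have e20 : 0 < e / 2 by rewrite divr_gt0.
pose K := Num.truncn (2 / e).
(* The cube of side e that contains z, in a subdivision of [-1, 1]^N. *)
pose c z : {ffun 'I_N -> 'I_K.+1} := [ffun i => inord (Num.truncn ((z ord0 i + 1) / e))].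
have zi z i : uball z -> 0 <= (z ord0 i + 1) / e <= 2 / e.
  move=> z1; have := le_trans (abs_coord_le_enorm z i) z1; rewrite ler_norml => /andP[z0 z2].
  apply/andP; split; first by apply: divr_ge0; [lra|exact: ltW].
  by apply: ler_wpM2r; [rewrite invr_ge0 ltW|lra].
have cE z y : uball z -> uball y -> c z = c y -> `|z - y| <= e.
  move=> z1 y1 /ffunP czy; apply: norm_leP => [|i]; first exact: ltW.
  have /andP[z0 z2] := zi z i z1; have /andP[y0 y2] := zi y i y1.
  have := czy i; rewrite !ffunE => /(congr1 val); rewrite /= !inordK ?ltnS ?le_truncn// => E.
  have := truncn_itv z0; have := truncn_itv y0; rewrite E.
  move=> /andP[y3 y4] /andP[z3 z4].
  have : `|(z ord0 i + 1) / e - (y ord0 i + 1) / e| <= 1.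
    by rewrite ler_norml; move: y3 y4 z3 z4; rewrite -natr1; lra.
  rewrite -mulrBl normrM normfV (gtr0_norm e0) ler_pdivrMr// mul1r !mxE.
  by rewrite opprD addrACA subrr addr0.
have /choice[h Hh] : forall j : {ffun 'I_N -> 'I_K.+1}, exists h : nat, forall n, (h <= n)%N ->
    forall z p, uball z -> c z = j -> exists w, [/\ sphere_valued w,
      `|(n ^ d)%:R^-1 *: (\sum_(k <- box p n) w k) - z| <= e &
      E p n w / (n ^ d)%:R <= phi D z + e].
  move=> j; pose A := [set phi D z | z in [set z | uball z /\ c z = j]].
  have [[z0 [z01 z0j]]|nex] := pselect (exists z, uball z /\ c z = j); last first.
    by exists 0%N => n _ z p z1 zj; exfalso; apply: nex; exists z.
  have A0 : A !=set0 by exists (phi D z0), z0.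
  have lbA : has_lbound A.
    exists (- (C + rate)) => _ [z [z1 _] <-].
    by have := phi_bounded d0 hN D z1; rewrite ler_norml => /andP[].
  have [_ [y [y1 yj] <-] yA] := inf_adherent e20 (conj A0 lbA).
  have [t0 Ht0] := phi_approx d0 hN D y1 e20.
  exists (maxn t0 1) => n; rewrite geq_max => /andP[nt0 n1] z p z1 zj.
  have [w [w1 wy] wE] := Ht0 n nt0 p; exists w; split=> //.
    rewrite wy scalerA mulVf ?scale1r; last by rewrite gt_eqF// ltr0n expn_gt0 n1.
    by apply: cE => //; rewrite zj yj.
  apply: le_trans wE _; have : inf A <= phi D z by apply: ge_inf => //; exists z.
  by move: yA; lra.
exists (\max_j h j)%N => n nh z p z1; apply: (Hh (c z)) => //.
by apply: leq_trans nh; exact: (@leq_bigmax _ h (c z)).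
Qed.

End cell_formula.

(** * The cell formula *)

Section lattice_points.
Context {R : realType} {m : nat}.
Implicit Types (k p : 'rV[int]_m) (A : set 'rV[R]_m).
Local Notation intv := (@intv R m).

Lemma intvD k p : intv (k + p) = intv k + intv p.
Proof. by apply/rowP => i; rewrite !mxE intrD. Qed.

Lemma intv_inj : injective intv.
Proof.
by move=> k p /rowP kp; apply/rowP => i; have := kp i; rewrite !mxE => /intr_inj.
Qed.

Lemma intvZ (a : int) k : intv (a *: k) = a%:~R *: intv k.
Proof. by apply/rowP => i; rewrite !mxE intrM. Qed.

Lemma intv_coord k i : intv k ord0 i = (k ord0 i)%:~R.
Proof. by rewrite mxE. Qed.

Lemma scaler_intv_inj e : 0 < e -> injective (fun k => e *: intv k).
Proof. by move=> e0 k p /scalerI H; apply/intv_inj/H; rewrite gt_eqF. Qed.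

Lemma bounded_lattice (b : R) (P : set 'rV[int]_m) :
  (forall k i, P k -> `|(k ord0 i)%:~R| <= b :> R) -> finite_set P.
Proof.
move=> Pb; pose r := (Num.truncn b).+1.
apply: (@sub_finite_set _ _ [set` box (const_mx (- r%:Z)) (r + r).+1]); last exact: finite_fset.
move=> k Pk; apply/in_boxP => i; rewrite mxE.
have : (`|(k ord0 i)| <= r%:Z).
  rewrite -(ler_int R) intr_norm; apply: le_trans (Pb k i Pk) _.
  exact: ltW (truncnS_gt _).
by rewrite ler_norml; move: (k ord0 i) => x; lia.
Qed.

Lemma bounded_setP A : bounded_set A -> exists2 b : R, 0 < b & forall x, A x -> `|x| <= b.
Proof.
move=> [M [_ HM]]; exists (`|M| + 1); first by rewrite ltr_wpDl.
by apply: HM; apply: le_lt_trans (ler_norm M) _; rewrite ltrDl.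
Qed.

Definition lattice_in e A : set 'rV[int]_m := [set k | A (e *: intv k)].

Lemma finite_lattice_in e A : 0 < e -> bounded_set A -> finite_set (lattice_in e A).
Proof.
move=> e0 /bounded_setP[b b0 Ab]; apply: (@bounded_lattice (b / e)) => k i /Ab kb.
rewrite ler_pdivlMr// mulrC -{1}(gtr0_norm e0) -normrM.
by apply: le_trans kb; have := abs_coord_le_norm (e *: intv k) i; rewrite !mxE.
Qed.

Lemma cell_self e (a : 'rV[R]_m) : 0 < e -> cell e a a.
Proof. by move=> e0 i; rewrite lexx ltrDl. Qed.

End lattice_points.

Section energy_lattice.
Context {R : realType} {m N : nat} (hN : (2 <= N)%N) (rho : R).
Context (G : 'rV[R]_m.+1 -> 'rV[R]_m.+1 -> 'rV[R]_N -> 'rV[R]_N -> R).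
Local Notation V := 'rV[int]_m.+1.
Implicit Types (A : set 'rV[R]_m.+1) (k q xi : V).

Definition lattice_range : {fset V} :=
  fset_set [set xi : V | enorm (intv xi : 'rV[R]_m.+1) <= rho].

Definition lattice_fun xi k (a b : 'rV[R]_N) : R := G (intv k) (intv k + intv xi) a b.

Lemma finite_lattice_range : finite_set [set xi : V | enorm (intv xi : 'rV[R]_m.+1) <= rho].
Proof.
apply: (@bounded_lattice R _ rho) => k i /= kr.
by apply: le_trans kr; rewrite -intv_coord abs_coord_le_enorm.
Qed.

Lemma lattice_rangeP xi i : xi \in lattice_range ->
  - ((Num.truncn rho).+1)%:Z <= xi ord0 i <= ((Num.truncn rho).+1)%:Z.
Proof.
rewrite in_fset_set ?inE /=; last exact: finite_lattice_range.
move=> xir; rewrite -ler_norml -(ler_int R) intr_norm -intv_coord.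
by apply: le_trans (abs_coord_le_enorm _ _) _; apply: le_trans xir (ltW (truncnS_gt _)).
Qed.

(** A lattice point in A starts a cell that meets A, so the condition on [Zlat] is automatic and the
    pairs are those with both points in A. *)
Lemma energy_lattice e A (u : 'rV[R]_m.+1 -> 'rV[R]_N) : 0 < e -> bounded_set A ->
  energy rho G e A u = e ^+ m.+1 *
    pair_energy lattice_range lattice_fun (fset_set (lattice_in e A)) (fun k => u (e *: intv k)).
Proof.
move=> e0 bA; have fin := finite_lattice_in e0 bA.
rewrite /energy fsbig_finite ?mulr_sumr/=; last exact: finite_lattice_range.
apply: eq_bigr => xi _.
pose Q := [set k | lattice_in e A k /\ lattice_in e A (k + xi)].
have RE : Rlat e xi A = (fun k => e *: intv k) @` Q.
  apply/seteqP; split => [_ [[[k ->] _] Ak Akxi]|_ [k [Ak Akxi] <-]].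
    by exists k => //; split => //; rewrite /lattice_in /= intvD scalerDr.
  split => //; last by rewrite -scalerDr -intvD.
  by split; [exists k|exists (e *: intv k); split => //; exact: cell_self].
have finQ : finite_set Q by apply: sub_finite_set fin => k [].
rewrite RE fsbig_image; last by move=> k p _ _; exact: scaler_intv_inj.
rewrite fsbig_finite// mulr_sumr [RHS]big_fset_condE; apply: eq_fbig => [k|k _ /=].
  rewrite !inE /= !in_fset_set// /Q; apply/idP/andP; rewrite !inE.
    by case.
  by case.
by rewrite /lattice_fun intvD scalerDr !scalerA mulVf ?gt_eqF// !scale1r.
Qed.

Context (M : R) (G_bounded : forall a b u v, usphere u -> usphere v -> `|G a b u v| <= M).
Context (l : nat) (l0 : (1 <= l)%N) (G_periodic : forall a b u v i,
  usphere u -> usphere v ->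
  G (a + l%:R *: delta_mx ord0 i) (b + l%:R *: delta_mx ord0 i) u v = G a b u v).
Context (G_lsc : lower_semicontinuous ((fun p => (uncurry4 G p)%:E) :
  subspace (@density_dom R m.+1 N) -> \bar R)).

Lemma periodic_lattice q a b u v : usphere u -> usphere v ->
  G (a + l%:R *: intv q) (b + l%:R *: intv q) u v = G a b u v.
Proof.
move=> u1 v1.
have step (c : int) i a' b' : G (a' + (l%:R * c%:~R) *: delta_mx ord0 i)
    (b' + (l%:R * c%:~R) *: delta_mx ord0 i) u v = G a' b' u v.
  have nat_step (j : nat) a1 b1 : G (a1 + (l%:R * j%:R) *: delta_mx ord0 i)
      (b1 + (l%:R * j%:R) *: delta_mx ord0 i) u v = G a1 b1 u v.
    elim: j => [|j IH]; first by rewrite mulr0 scale0r !addr0.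
    by rewrite -natr1 mulrDr mulr1 scalerDl !addrA G_periodic.
  case: c => j; first exact: nat_step.
  rewrite NegzE mulrNz mulrN scaleNr -[RHS](nat_step j.+1) -[LHS](nat_step j.+1).
  by rewrite !subrK nat_step.
rewrite [intv q]matrix_sum_delta big_ord1 scaler_sumr.
elim: (index_enum _) a b => [|i s IH] a b; first by rewrite !big_nil !addr0.
by rewrite !big_cons !addrA IH scalerA intv_coord step.
Qed.

Lemma lattice_fun_lsc xi k z e : usphere z -> 0 < e -> exists2 del, 0 < del &
  forall a b, usphere a -> usphere b -> `|a - z| < del -> `|b - z| < del ->
    lattice_fun xi k z z - e <= lattice_fun xi k a b.
Proof.
move=> z1 e0; pose p0 : 'rV[R]_m.+1 * 'rV[R]_m.+1 * 'rV[R]_N * 'rV[R]_N :=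
  (intv k, intv k + intv xi, z, z).
have p0D : density_dom p0 by [].
have [|V] := G_lsc (x := p0) (a := uncurry4 G p0 - e); first by rewrite lte_fin ltrBlDr ltrDl.
rewrite -[nbhs _]/(nbhs_subspace _) -nbhs_subspace_in// => /nbhs_ballP[del /= del0 H] HV.
exists del => // a b a1 b1 az bz.
have /HV : V (intv k, intv k + intv xi, a, b).
  apply: H => //; split => /=; last by rewrite mx_norm_ball /ball_ /= distrC.
  by split => /=; [exact: ballxx|rewrite mx_norm_ball /ball_ /= distrC].
by rewrite lte_fin => /ltW.
Qed.

(** Transparent, so that its range and its density reduce to [lattice_range] and [lattice_fun]. *)
Definition density_of : lattice_density R m.+1 N.
Proof.
apply: (@LatticeDensity R m.+1 N lattice_range lattice_fun M (Num.truncn rho).+1 l).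
- by move=> xi k a b a1 b1; exact: G_bounded.
- exact: lattice_rangeP.
- exact: l0.
- move=> q xi k a b a1 b1; rewrite /lattice_fun intvD intvZ.
  by rewrite -addrA !(addrC (_ *: _)) periodic_lattice.
- exact: lattice_fun_lsc.
Defined.

End energy_lattice.

(** With n < T <= n + 1, also for integral T, the integers in (0, T) are 1, ..., n, whereas the unit
    cells meeting (0, T) start at 0, ..., n. In the cell formula the average thus sees one layer of
    points more than the energy. *)
Lemma nat_bracket (R : realType) (T : R) : 0 < T -> exists n : nat, n%:R < T <= n.+1%:R.
Proof.
move=> T0; have := truncn_itv (ltW T0); case: (Num.truncn T) => [|n] /andP[nT Tn].
  by exists 0%N; rewrite T0 ltW.
have [nT'|Tn'] := ltP n.+1%:R T; first by exists n.+1; rewrite nT' ltW.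
by exists n; rewrite Tn' andbT; apply: lt_le_trans nT; rewrite ltr_nat.
Qed.

(** * The limit in the cell formula is [phi] *)

Section homogenized_density.
Context {R : realType} {m N : nat} (hN : (2 <= N)%N) (rho : R).
Context (G : 'rV[R]_m.+1 -> 'rV[R]_m.+1 -> 'rV[R]_N -> 'rV[R]_N -> R).
Context (D : lattice_density R m.+1 N).
Context (Drange : ld_range D = lattice_range rho) (Dfun : ld_fun D = lattice_fun G).
Local Notation V := 'rV[int]_m.+1.
Local Notation d := m.+1.
Local Notation C := (pair_cost (ld_range D) (ld_bound D)).
Local Notation H X w := (pair_energy (ld_range D) (ld_fun D) X w).
Implicit Types (T : R) (u : 'rV[R]_m.+1 -> 'rV[R]_N) (k : V) (z : 'rV[R]_N).

Let d0 : (0 < d)%N := isT.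

Lemma cube_bounded T : bounded_set (@cube R d T).
Proof.
exists T; split; first exact: num_real.
move=> M TM x xT; apply: norm_leP => [|i].
  by have /andP[x0 x1] := xT ord0; exact/ltW/(lt_trans _ TM)/(lt_trans x0).
by have /andP[x0 x1] := xT i; rewrite gtr0_norm// ltW// (lt_trans x1).
Qed.

Lemma cubeP T (n : nat) k : n%:R < T <= n.+1%:R ->
  lattice_in 1 (cube T) k <-> k \in box (const_mx 1) n.
Proof.
move=> /andP[nT Tn]; split.
  move=> kT; apply/in_boxP => i; have := kT i; rewrite scale1r intv_coord mxE => /andP[k0 k1].
  move: k0; rewrite ltr0z => k0.
  have : (k ord0 i)%:~R < (n.+1%:Z)%:~R :> R by exact: lt_le_trans k1 Tn.
  by rewrite ltr_int; move: (k ord0 i) k0 => x; lia.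
move=> /in_boxP kn i; have := kn i; rewrite mxE scale1r intv_coord => kni.
rewrite ltr0z; apply/andP; split; first by move: kni; move: (k ord0 i) => x; lia.
apply: le_lt_trans nT; rewrite -[n%:R]/(n%:Z%:~R) ler_int.
by move: kni; move: (k ord0 i) => x; lia.
Qed.

Lemma Zlat_cube T (n : nat) : n%:R < T <= n.+1%:R ->
  Zlat 1 (cube T) = intv @` [set` box (0 : V) n.+1].
Proof.
move=> /andP[nT Tn]; have T0 : 0 < T by apply: le_lt_trans nT.
apply/seteqP; split => [a [[k ->] [x [xk xT]]]|a [k kn <-]].
  exists k; last by rewrite scale1r.
  apply/in_boxP => i; have /andP[x0 x1] := xT i; have := xk i.
  rewrite scale1r intv_coord mxE => /andP[k0 k1].
  have : 0 < (k ord0 i + 1)%:~R :> R by rewrite intrD; exact: lt_trans x0 k1.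
  have : (k ord0 i)%:~R < (n.+1%:Z)%:~R :> R.
    by apply: le_lt_trans k0 _; exact: lt_le_trans x1 Tn.
  by rewrite ltr_int ltr0z; move: (k ord0 i) => y; lia.
split; first by exists k; rewrite scale1r.
have kni i : 0 <= k ord0 i < n.+1%:Z by move/in_boxP : kn => /(_ i); rewrite mxE add0r.
have k0 i : 0 <= (k ord0 i)%:~R :> R by rewrite ler0z; case/andP: (kni i).
have kT i : (k ord0 i)%:~R < T.
  apply: le_lt_trans nT; rewrite -[n%:R]/(n%:Z%:~R) ler_int.
  by have := kni i; move: (k ord0 i) => y; lia.
(* In each coordinate, the midpoint between k and the smaller of k + 1 and T, a point of the cell
   and of the open cube even when k = 0. *)
exists (\row_i ((k ord0 i)%:~R + Num.min 1 (T - (k ord0 i)%:~R) / 2)); split => i;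
  rewrite !mxE; set x : R := (k ord0 i)%:~R; have := k0 i; have := kT i; rewrite -/x;
  by rewrite /Num.min; case: ifP => h; lra.
Qed.

Lemma daverage_cube T (n : nat) u : n%:R < T <= n.+1%:R ->
  daverage 1 (cube T) u =
  ((n.+1 ^ d)%:R : R)^-1 *: \sum_(k <- box (0 : V) n.+1) u (intv k).
Proof.
move=> nT; rewrite /daverage (Zlat_cube nT).
have fin : finite_set [set` box (0 : V) n.+1] by exact: finite_fset.
rewrite fset_set_image// set_fsetK card_imfset /=; last exact: intv_inj.
rewrite -/(#|` box (0 : V) n.+1|) card_box fsbig_image; last by move=> k p _ _; exact: intv_inj.
by rewrite fsbig_finite// set_fsetK.
Qed.

Lemma energy_cube T (n : nat) u : n%:R < T <= n.+1%:R ->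
  energy rho G 1 (cube T) u = H (box (const_mx 1) n) (fun k => u (intv k)).
Proof.
move=> nT; rewrite energy_lattice//; last exact: cube_bounded.
rewrite expr1n mul1r Drange Dfun.
have -> : fset_set (lattice_in 1 (cube T)) = box (const_mx 1 : V) n.
  apply/fsetP => k; rewrite in_fset_set; last first.
    by apply: finite_lattice_in => //; exact: cube_bounded.
  by apply/idP/idP; rewrite inE => /(cubeP _ nT).
by apply: eq_pair_energy => k _; rewrite scale1r.
Qed.

Definition admissible T z : set ('rV[R]_d -> 'rV[R]_N) := [set u | discrete_fun 1 (cube T) u /\ daverage 1 (cube T) u = z].

Lemma admissible_extend T (n : nat) z u : n%:R < T <= n.+1%:R -> admissible T z u ->
  exists2 w, averages (0 : V) n.+1 z w &
    energy rho G 1 (cube T) u = H (box (const_mx 1) n) w.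
Proof.
move=> nT [u1 uz]; have [v v1] := @exists_usphere R _ hN.
pose w k := if k \in box (0 : V) n.+1 then u (intv k) else v.
have wE : {in box (0 : V) n.+1, w =1 fun k => u (intv k)} by move=> k; rewrite /w => ->.
have inner : {subset box (const_mx 1 : V) n <= box (0 : V) n.+1}.
  by apply/fsubsetP/box_subset => i; rewrite !mxE; lia.
exists w.
  split.
    move=> k; rewrite /w; case: ifP => // kn; apply: u1; rewrite (Zlat_cube nT).
    by exists k.
  by rewrite (eq_big_seq _ wE) -uz (daverage_cube _ nT) scalerA mulfV ?scale1r.
rewrite (energy_cube _ nT); apply: eq_pair_energy => k kn.
by rewrite wE//; exact: inner.
Qed.

Lemma admissible_of_pattern T (n : nat) z w : n%:R < T <= n.+1%:R ->
  averages (0 : V) n.+1 z w ->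
  exists2 u, admissible T z u & energy rho G 1 (cube T) u = H (box (const_mx 1) n) w.
Proof.
move=> nT [w1 wz].
pose u (x : 'rV[R]_m.+1) := w (\row_i Num.floor (x ord0 i)).
have uE k : u (intv k) = w k.
  by congr w; apply/rowP => i; rewrite !mxE intrKfloor.
exists u.
  split; first by move=> a _; exact: w1.
  by rewrite (daverage_cube _ nT) (eq_bigr w) ?wz// scalerA mulVf ?scale1r.
by rewrite (energy_cube _ nT); apply: eq_pair_energy => k _.
Qed.

(** The points with some coordinate 0 enter the average but not the energy; they make up a fraction
    at most d/(n + 1) of the box. *)
Lemma inner_box (n : nat) w : sphere_valued w ->
  `|H (box (0 : V) n.+1) w - H (box (const_mx 1) n) w| <=
  (n.+1 ^ d)%:R * (C * d%:R / n.+1%:R).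
Proof.
move=> w1; have inner : (box (const_mx 1 : V) n `<=` box (0 : V) n.+1)%fset.
  by apply: box_subset => i; rewrite !mxE; lia.
apply: le_trans (pair_energy_sub (ld_range D) (@ld_funM _ _ _ D) w1 inner) _.
have -> : (n.+1 ^ d)%:R * (C * d%:R / n.+1%:R) = C * (d%:R * (n.+1 ^ d)%:R / n.+1%:R).
  by rewrite mulrC !mulrA mulrAC.
apply: ler_wpM2l; first exact: pair_cost_ge0 hN D.
rewrite !card_box; have n0 : 0 < n.+1%:R :> R by [].
have : 0 <= (n%:R : R) / n.+1%:R <= 1.
  by rewrite divr_ge0//= ler_pdivrMr// mul1r ler_nat.
move=> /(onemX_le d); rewrite !natrX expr_div_n.
have -> : 1 - n%:R / n.+1%:R = n.+1%:R^-1 :> R.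
  by rewrite -natr1; field; rewrite natr1.
have nd : 0 < n.+1%:R ^+ d :> R by rewrite exprn_gt0.
move=> /(ler_wpM2r (ltW nd)); rewrite [leRHS]mulrAC; apply: le_trans.
by rewrite mulrBl mul1r divfK// gt_eqF.
Qed.

Let c0 := phi_rate D + C * d%:R.

Let c0_ge0 : 0 <= c0.
Proof. by rewrite addr_ge0 ?phi_rate_ge0// mulr_ge0// (pair_cost_ge0 hN D). Qed.

Lemma admissible_energy_ge T (n : nat) z u : n%:R < T <= n.+1%:R -> admissible T z u ->
  (n.+1 ^ d)%:R * (phi D z - c0 / n.+1%:R) <= energy rho G 1 (cube T) u.
Proof.
move=> nT /(admissible_extend nT)[w wz ->].
have := phi_le hN D (isT : (0 < n.+1)%N) wz.
have nd : 0 < (n.+1 ^ d)%:R :> R by rewrite ltr0n expn_gt0.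
move=> H1; have := inner_box n (proj1 wz); rewrite ler_norml => /andP[_ H2].
have : (n.+1 ^ d)%:R * phi D z <=
    H (box (0 : V) n.+1) w + (n.+1 ^ d)%:R * (phi_rate D / n.+1%:R).
  by rewrite -ler_pdivlMl// mulrDr mulKf ?gt_eqF// mulrC.
rewrite /c0 mulrBr !mulrDl mulrDr; move: H2.
move: (H (box (0 : V) n.+1) w) (H (box _ n) w) (_ * phi D z) => a b x.
by move: (_ * (phi_rate D / _)) (_ * (C * d%:R / _)) => y v; lra.
Qed.

Lemma admissible_energy_le z e : uball z -> 0 < e -> exists n0 : nat, forall (n : nat) T,
  (n0 <= n)%N -> n%:R < T <= n.+1%:R -> exists2 u, admissible T z u &
    energy rho G 1 (cube T) u <= (n.+1 ^ d)%:R * (phi D z + e + c0 / n.+1%:R).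
Proof.
move=> z1 e0; have [n0 Hn0] := phi_approx d0 hN D z1 e0; exists n0 => n T nn0 nT.
have [w wz wE] := Hn0 n.+1 (leqW nn0) 0.
have [u uz uE] := admissible_of_pattern nT wz; exists u => //; rewrite uE.
have nd : 0 < (n.+1 ^ d)%:R :> R by rewrite ltr0n expn_gt0.
have := inner_box n (proj1 wz); rewrite ler_norml => /andP[H2 _].
have H1 : H (box (0 : V) n.+1) w <= (n.+1 ^ d)%:R * (phi D z + e).
  by rewrite -ler_pdivrMl// mulrC.
have H3 : 0 <= (n.+1 ^ d)%:R * (phi_rate D / n.+1%:R).
  by rewrite mulr_ge0// divr_ge0// phi_rate_ge0.
rewrite /c0 mulrDl !mulrDr; rewrite mulrDr in H1; move: H1 H2 H3.
move: (H (box (0 : V) n.+1) w) (H (box _ n) w) (_ * phi D z) => a b x.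
by move: (_ * (phi_rate D / _)) (_ * (C * d%:R / _)) => y v; lra.
Qed.

Lemma cell_energy_near z (e : R) : uball z -> 0 < e -> \forall T \near +oo,
  ((phi D z - e)%:E <= cell_energy rho G z T <= (phi D z + e)%:E)%E.
Proof.
move=> z1 e0; pose e1 := Num.min 1 (e / 3).
have e10 : 0 < e1 by rewrite lt_min ltr01 divr_gt0.
have e11 : e1 <= 1 by rewrite ge_min lexx.
have e1e : e1 <= e / 3 by rewrite ge_min lexx orbT.
have [n0 Hn0] := admissible_energy_le z1 e10.
(* Dividing by T^m rather than (n + 1)^m produces a factor s with 0 <= s - 1 <= 2h. The threshold K
   makes c0/(n + 1) and 2hB at most e1 and h at most 1/2; the summand 2 in B covers e1 + c0/(n +
   1). *)
pose B : R := `|phi D z| + 2.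
have B0 : 0 < B by rewrite ltr_wpDl.
pose K := c0 / e1 + (2 * d)%:R * B / e1 + (2 * d)%:R.
have K0 : 0 <= K.
  by rewrite !addr_ge0// divr_ge0 ?mulr_ge0// ltW.
near=> T.
have T0 : 0 < T by near: T; exact: nbhs_pinfty_gt.
have KT : K <= T by near: T; apply: nbhs_pinfty_ge; exact: num_real.
have n0T : n0%:R < T by near: T; exact: nbhs_pinfty_gt.
have [n nT] := nat_bracket T0.
have nn0 : (n0 <= n)%N.
  by rewrite -ltnS -(ltr_nat R); apply: lt_le_trans (proj2 (andP nT)).
have Kn : K <= n.+1%:R by exact: le_trans KT (proj2 (andP nT)).
have n1 : 0 < n.+1%:R :> R by [].
have c1 : c0 / n.+1%:R <= e1.
  rewrite ler_pdivrMr// mulrC -ler_pdivrMr//; apply: le_trans Kn.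
  rewrite /K -addrA lerDl addr_ge0// divr_ge0 ?mulr_ge0//; exact: ltW.
have T1 : 0 < T ^+ d by rewrite exprn_gt0.
pose s := (n.+1 ^ d)%:R / T ^+ d.
have sE : s * T ^+ d = (n.+1 ^ d)%:R by rewrite /s divfK// gt_eqF.
have hB : d%:R / n.+1%:R <= 2^-1 :> R.
  rewrite ler_pdivrMr// -ler_pdivrMl// invrK -natrM; apply: le_trans Kn.
  by rewrite /K lerDr addr_ge0// divr_ge0 ?mulr_ge0// ltW.
pose h : R := d%:R / n.+1%:R; rewrite -/h in hB.
have h0 : 0 <= h by rewrite divr_ge0.
have hB' : 2 * h * B <= e1.
  have : (2 * d)%:R * B / e1 <= n.+1%:R.
    apply: le_trans Kn; rewrite /K addrAC lerDr addr_ge0// divr_ge0//; exact: ltW.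
  rewrite ler_pdivrMr// natrM (mulrC n.+1%:R) -ler_pdivrMr// /h.
  by rewrite (mulrC 2) -!mulrA (mulrC _^-1) !mulrA (mulrC 2).
have s1 : 1 <= s.
  rewrite ler_pdivlMr// mul1r natrX; apply: lerXn2r; rewrite ?nnegrE ?(ltW T0)//.
  exact: proj2 (andP nT).
have sh : s - 1 <= 2 * h.
  have y01 : 0 <= T / n.+1%:R <= 1.
    apply/andP; split; first by rewrite divr_ge0// ltW.
    by rewrite ler_pdivrMr// mul1r (proj2 (andP nT)).
  have := onemX_le d y01; rewrite expr_div_n.
  have -> : T ^+ d / n.+1%:R ^+ d = s^-1 by rewrite /s natrX invf_div.
  have Tn1 : d%:R * (1 - T / n.+1%:R) <= h.
    rewrite /h; apply: ler_wpM2l => //.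
    have : n%:R / n.+1%:R <= T / n.+1%:R by rewrite ler_pM2r ?invr_gt0// ltW// (proj1 (andP nT)).
    have -> : n%:R / n.+1%:R = 1 - n.+1%:R^-1 :> R by rewrite -natr1; field; rewrite natr1.
    by rewrite !lerBlDr addrC.
  have s0 : 0 < s by apply: lt_le_trans s1.
  move=> /le_trans/(_ Tn1); rewrite -(ler_pM2r s0) mulrBl mul1r mulVf ?gt_eqF//; nra.
have ps : `|(s - 1) * phi D z| <= 2 * h * `|phi D z|.
  by rewrite normrM ler_wpM2r// ger0_norm// subr_ge0.
have Phi0 : 0 <= `|phi D z| by [].
move: ps; rewrite ler_norml => /andP[ps1 ps2].
rewrite /cell_energy; set X := ereal_inf _; apply/andP; split.
  have HX : (((n.+1 ^ d)%:R * (phi D z - c0 / n.+1%:R))%:E <= X)%E.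
    by apply: le_ereal_inf_tmp => _ [u uz <-]; rewrite lee_fin; exact: admissible_energy_ge.
  have := lee_wpmul2l _ HX; move=> /(_ (T ^- d)%:E); rewrite lee_fin invr_ge0 ltW// => /(_ isT).
  apply: le_trans; rewrite -EFinM lee_fin mulrA (mulrC _^-1) -/s mulrBr.
  have : s * (c0 / n.+1%:R) <= 2 * e1.
    have c1' : 0 <= c0 / n.+1%:R by rewrite divr_ge0.
    have s2 : s <= 2 by lra.
    by apply: ler_pM => //; exact: le_trans s1.
  have -> : s * phi D z = phi D z + (s - 1) * phi D z by ring.
  by move: hB' ps1; rewrite /B mulrDr; clear -h0 e1e; clearbody h s; move: (s * (c0 / _)) => q; lra.
have [u uz uE] := Hn0 n T nn0 nT.
have HX : (X <= ((n.+1 ^ d)%:R * (phi D z + e1 + c0 / n.+1%:R))%:E)%E.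
  by apply: (@le_trans _ _ (energy rho G 1 (cube T) u)%:E);
    [apply: ereal_inf_lbound; exists u|rewrite lee_fin].
have := lee_wpmul2l _ HX; move=> /(_ (T ^- d)%:E); rewrite lee_fin invr_ge0 ltW// => /(_ isT).
move=> /le_trans; apply; rewrite -EFinM lee_fin mulrA (mulrC _^-1) -/s -addrA mulrDr.
have : s * (e1 + c0 / n.+1%:R) <= e1 + c0 / n.+1%:R + 2 * h * 2.
  have c1' : 0 <= c0 / n.+1%:R by rewrite divr_ge0.
  rewrite -lerBlDl -[X in _ - X]mul1r -mulrBl; apply: ler_pM => //.
  - by rewrite subr_ge0.
  - by rewrite addr_ge0// ltW.
  - by move: c1 e11; move: (c0 / _) => cc; lra.
have -> : s * phi D z = phi D z + (s - 1) * phi D z by ring.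
move: c1; rewrite mulrDr; move: (s * e1) (s * _) (c0 / _) => q q' q''.
by move: hB' ps2; rewrite /B mulrDr; clear -h0 e1e; clearbody h s; lra.
Unshelve. all: by end_near. Qed.

Lemma cell_energy_cvg z : uball z -> cell_energy rho G z T @[T --> +oo] --> (phi D z)%:E.
Proof.
move=> z1; apply/fine_cvgP; split.
  have := cell_energy_near z1 ltr01; apply: filterS => T /andP[h1 h2].
  by rewrite fin_numElt (lt_le_trans _ h1) ?ltNyr//= (le_lt_trans h2) ?ltry.
apply/cvgrPdist_le => e e0; have := cell_energy_near z1 e0; apply: filterS => T /=.
case: (cell_energy rho G z T) => [y| |] /=; rewrite ?leye_eq ?leeNy_eq// ?andbF//.
by rewrite !lee_fin ler_norml; lra.
Qed.

Lemma GhomE z : uball z -> Ghom rho G z = (phi D z)%:E.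
Proof. by move=> /cell_energy_cvg/cvg_lim; exact. Qed.

(** An average of unit vectors has norm at most 1, so the infimum is over the empty set. The value
    matters for the measurability of [Ghom] on the whole space. *)
Lemma Ghom_outside z : ~ uball z -> Ghom rho G z = +oo%E.
Proof.
move=> z1; apply/cvg_lim => //; apply: (@cvg_trans _ (cst +oo%E @ +oo)); last exact: cvg_cst.
apply: near_eq_cvg; near=> T.
have T0 : 0 < T by near: T; exact: nbhs_pinfty_gt.
rewrite /cell_energy /cst.
rewrite (_ : [set u | _] = set0) ?image_set0 ?ereal_inf0 ?gt0_muley//.
  by rewrite lte_fin invr_gt0 exprn_gt0.
have [n nT] := nat_bracket T0.
apply/seteqP; split => // u /(admissible_extend nT)[w [w1 wz] _]; apply: z1.
have nd : 0 < (n.+1 ^ d)%:R :> R by rewrite ltr0n expn_gt0.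
rewrite /uball /= -(ler_pM2l nd) mulr1 -[X in X * _ <= _]gtr0_norm// -enormZ -wz.
apply: le_trans (enorm_sum _ _ _) _; rewrite (eq_bigr (fun=> 1)) => [|k _]; last exact: w1.
by rewrite big_const_seq count_predT iter_addr addr0 -/(#|` box (0 : V) n.+1|) card_box.
Unshelve. all: by end_near. Qed.

End homogenized_density.

(** * Lebesgue measure of grid cells *)

Section lebesgue_rV_theory.
Context {R : realType} {n : nat}.
Local Notation lam := (@lebesgue_rV R n).
Implicit Types (A : set 'rV[R]_n) (a c x : 'rV[R]_n) (e : R).

Lemma measurable_rect (I : 'I_n -> set R) : (forall i, measurable (I i)) ->
  measurable [set x : 'rV[R]_n | forall i, I i (x ord0 i)].
Proof.
move=> mI; rewrite (_ : mkset _ =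
    \bigcap_(i in [set: 'I_n]) ((fun x : 'rV[R]_n => x ord0 i) @^-1` I i)).
  apply: fin_bigcap_measurable => // i _.
  by rewrite -[X in measurable X]setTI; exact: measurable_coord.
by apply/seteqP; split=> x /= + i => /(_ i); [move=> + _|apply].
Qed.

Lemma cellE e a : cell e a = [set x | forall i, `[a ord0 i, (a ord0 i + e)[%classic (x ord0 i)].
Proof. by apply/seteqP; split => x /= H i; have := H i; rewrite /= in_itv. Qed.

Lemma measurable_cell e a : measurable (cell e a).
Proof.
rewrite cellE; apply: (@measurable_rect (fun i => `[a ord0 i, (a ord0 i + e)[%classic)).
by move=> i; exact: measurable_itv.
Qed.

Lemma lebesgue_cell e a : 0 < e -> lam (cell e a) = (e ^+ n)%:E.
Proof.
move=> e0; rewrite cellE (@lebesgue_rV_box R n (fun i => `[a ord0 i, (a ord0 i + e)[%classic))//.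
rewrite (eq_bigr (fun=> e%:E)) => [|i _].
  by rewrite prodEFin prodr_const card_ord.
by rewrite lebesgue_measure_itv /= lte_fin ltrDl e0 -EFinB addrAC subrr add0r.
Qed.

Lemma bounded_sub_cell A : bounded_set A -> exists e a, 0 < e /\ A `<=` cell e a.
Proof.
move=> /bounded_setP[b b0 Ab]; exists (2 * b + 1), (const_mx (- b)); split; first by lra.
move=> x /Ab xb i; rewrite mxE; have := le_trans (abs_coord_le_norm x i) xb.
by rewrite ler_norml; lra.
Qed.

Lemma bounded_lebesgue_lty A : measurable A -> bounded_set A -> (lam A < +oo)%E.
Proof.
move=> mA /bounded_sub_cell[e [a [e0 Aa]]].
apply: (@le_lt_trans _ _ (lam (cell e a))); last by rewrite lebesgue_cell// ltry.
by apply: le_measure => //; rewrite inE//; exact: measurable_cell.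
Qed.

Lemma measurable_coordD c i : measurable_fun [set: 'rV[R]_n] (fun x => (x + c) ord0 i).
Proof.
apply: (eq_measurable_fun (fun x : 'rV[R]_n => x ord0 i + c ord0 i)).
  by move=> x _; rewrite mxE.
by apply: measurable_funD => //; exact: measurable_coord.
Qed.

Lemma measurable_translate c : measurable_fun [set: 'rV[R]_n] (fun x => x + c).
Proof. by apply: measurable_fun_coord => i; exact: measurable_coordD. Qed.

End lebesgue_rV_theory.

Section translation.
Context {R : realType}.

Definition translateR (c : R) (x : measurableTypeR R) : measurableTypeR R := x + c.

Lemma measurable_translateR c : measurable_fun [set: measurableTypeR R] (translateR c).
Proof. exact: measurable_funD. Qed.

HB.instance Definition _ c := isMeasurableFun.Build _ _ _ _ (translateR c)
  (measurable_translateR c).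

Lemma lebesgue_translateR (c : R) (A : set R) : measurable A ->
  lebesgue_measure ((fun x => x + c) @^-1` A) = lebesgue_measure A.
Proof.
move=> mA; apply/esym.
apply: (@lebesgue_measure_unique R (pushforward lebesgue_measure (translateR c))) => // _ [[a b]] _ <-.
rewrite /= /pushforward (_ : _ @^-1` _ = `]a - c, b - c]%classic).
  by rewrite !lebesgue_measure_itv/= !lte_fin ltrD2r -!EFinB opprB addrA subrK.
by apply/seteqP; split => x /=; rewrite /translateR !in_itv/= ltrBlDr lerBrDr.
Qed.

Context {n : nat}.

Definition translate (c x : 'rV[R]_n) : 'rV[R]_n := x + c.

HB.instance Definition _ c := isMeasurableFun.Build _ _ _ _ (translate c)
  (measurable_translate c).

(** Both measures agree on measurable rectangles, which are stable under intersection and generate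
    the sigma-algebra; the cubes [big] exhaust the space with finite measure. *)
Lemma lebesgue_translate (c : 'rV[R]_n) (A : set 'rV[R]_n) : measurable A ->
  lebesgue_rV n (translate c @^-1` A) = lebesgue_rV n A.
Proof.
move=> mA.
pose rects := [set A : set 'rV[R]_n | exists2 I : 'I_n -> set R, (forall i, measurable (I i)) &
  A = [set x | forall i, I i (x ord0 i)]].
pose big (k : nat) := cell (2 * k%:R + 1) (const_mx (- k%:R) : 'rV[R]_n).
have mrects B : rects B -> measurable B by move=> [I mI ->]; exact: measurable_rect.
apply: (measure_unique rects big _ _ _ _ (pushforward (lebesgue_rV n) (translate c)) (lebesgue_rV n)) => //.
- apply/seteqP; split; last first.
    by apply: smallest_sub; [exact: sigma_algebra_measurable|exact: mrects].
  apply: smallest_sub; first exact: smallest_sigma_algebra.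
  move=> B; rewrite -bigcup_seq => -[i _ [Y mY <-]]; rewrite setTI.
  apply: sub_sigma_algebra; exists (fun j => if j == i then Y else setT).
    by move=> j; case: ifP.
  apply/seteqP; split => x /= H; last by have := H i; rewrite eqxx.
  by move=> j; case: eqP => // ->.
- move=> _ _ [I mI ->] [J mJ ->]; exists (fun i => I i `&` J i).
    by move=> i; exact: measurableI.
  apply/seteqP; split => x /=; first by move=> [HI HJ] i; split.
  by move=> H; split => i; have [] := H i.
- move=> k; exists (fun i => `[- k%:R, k%:R + 1[%classic) => //.
  rewrite /big cellE; apply/seteqP; split => x /= H i; have := H i; rewrite mxE !in_itv /=; lra.
- rewrite -subTset => x _; exists (Num.truncn `|x|).+1 => // i.
  rewrite mxE; have := le_lt_trans (abs_coord_le_norm x i) (truncnS_gt `|x|).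
  by rewrite ltr_norml; lra.
- move=> _ [I mI ->]; rewrite /= /pushforward.
  rewrite (_ : _ @^-1` _ = [set x : 'rV[R]_n | forall i, ((fun t => t + c ord0 i) @^-1` I i) (x ord0 i)]).
    rewrite (@lebesgue_rV_box R n (fun i => (fun t => t + c ord0 i) @^-1` I i)).
      by rewrite (@lebesgue_rV_box R n I)//; apply: eq_bigr => i _; exact: lebesgue_translateR.
    by move=> i; rewrite -[X in measurable X]setTI; exact: (measurable_translateR (c ord0 i) measurableT (mI i)).
  by apply/seteqP; split => x /= H i; have := H i; rewrite mxE.
- move=> k; rewrite /= /pushforward /big.
  rewrite (_ : _ @^-1` _ = cell (2 * k%:R + 1) (const_mx (- k%:R) - c)).
    by rewrite lebesgue_cell ?ltry// ltr_wpDl// mulr_ge0.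
  by apply/seteqP; split => x /= H i; have := H i; rewrite /translate !mxE; lra.
Qed.

End translation.

(** * Grids, thickenings and lattice point counts *)

Section grid.
Context {R : realType} {n : nat}.
Local Notation T := 'rV[R]_n.
Local Notation V := 'rV[int]_n.
Local Notation lam := (@lebesgue_rV R n).
Implicit Types (A B O : set T) (x y : T) (k : V) (s e : R).

Lemma closed_measurable_rV A : closed A -> measurable A.
Proof.
move=> cA; rewrite -(setCK A); apply: measurableC.
by apply: open_measurable_rV; exact: closed_openC.
Qed.

Definition corner s x : V := \row_i Num.floor (x ord0 i / s).

Definition gcell s k : set T := cell s (s *: intv k).

Lemma gcellP s k x : 0 < s -> gcell s k x <-> corner s x = k.
Proof.
move=> s0; split=> [xk|<- i].
  apply/rowP => i; rewrite mxE; apply/eqP; rewrite floor_eq; have := xk i.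
  rewrite !mxE intrD => /andP[h1 h2].
  by rewrite ler_pdivlMr// ltr_pdivrMr// mulrC h1/= mulrDl mul1r mulrC.
rewrite !mxE; have := floor_itv (x ord0 i / s); rewrite intrD => /andP[h1 h2].
rewrite mulrC -ler_pdivlMr// h1/=.
by move: h2; rewrite ltr_pdivrMr// mulrDl mul1r.
Qed.

Lemma gcell_corner s x : 0 < s -> gcell s (corner s x) x.
Proof. by move=> s0; apply/gcellP. Qed.

Lemma corner_intv s k : 0 < s -> corner s (s *: intv k) = k.
Proof. by move=> s0; apply/gcellP => //; exact: cell_self. Qed.

Lemma measurable_gcell s k : measurable (gcell s k).
Proof. exact: measurable_cell. Qed.

Lemma lebesgue_gcell s k : 0 < s -> lam (gcell s k) = (s ^+ n)%:E.
Proof. exact: lebesgue_cell. Qed.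

Lemma trivIset_gcell s (D : set V) : 0 < s -> trivIset D (gcell s).
Proof. by move=> s0 k k' _ _ [x [/(gcellP _ _ s0) <- /(gcellP _ _ s0)]]. Qed.

Definition cells s (I : {fset V}) : set T := \bigcup_(k in [set` I]) gcell s k.

Lemma measurable_cells s I : measurable (cells s I).
Proof.
apply: fin_bigcup_measurable; first exact: finite_fset.
by move=> k _; exact: measurable_gcell.
Qed.

Lemma lebesgue_cells s I : 0 < s -> lam (cells s I) = (#|` I|%:R * s ^+ n)%:E.
Proof.
move=> s0; rewrite /cells bigcup_fset measure_fbigsetU; last first.
- exact: trivIset_gcell.
- by move=> k _; exact: measurable_gcell.
rewrite (eq_bigr (fun=> (s ^+ n)%:E)) => [|k _]; last exact: lebesgue_gcell.
by rewrite sumEFin big_const_seq count_predT iter_addr addr0 mulr_natl.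
Qed.

Lemma gcell_ball s k x : 0 < s -> gcell s k x -> gcell s k `<=` ball x s.
Proof.
move=> s0 kx y ky; rewrite mx_norm_ball /ball_ /=.
have xy i : `|(x - y) ord0 i| < s.
  have := kx i; have := ky i; rewrite !mxE ltr_norml; lra.
have -> : `|x - y| = mx_norm (x - y) by [].
by rewrite mx_normrE; apply/bigmax_ltP; split => // -[i j] _ /=; rewrite ord1 xy.
Qed.

Definition thick A s : set T := \bigcup_(y in A) ball y s.

Lemma open_thick A s : open (thick A s).
Proof. by apply: bigcup_open => y _; exact: ball_open. Qed.

Lemma measurable_thick A s : measurable (thick A s).
Proof. apply: open_measurable_rV; exact: open_thick. Qed.

Lemma sub_thick A s : 0 < s -> A `<=` thick A s.
Proof. by move=> s0 x Ax; exists x => //; exact: ballxx. Qed.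

Lemma thick_mono A s e : s <= e -> thick A s `<=` thick A e.
Proof. by move=> se x [y Ay yx]; exists y => //; exact: le_ball yx. Qed.

Lemma thick_cap A : closed A -> \bigcap_k thick A k.+1%:R^-1 = A.
Proof.
move=> cA; apply/seteqP; split => [x Hx|x Ax k _]; last exact: sub_thick.
move/closure_id : cA => ->; move=> B /nbhs_ballP[e /= e0 eB].
have [y Ay yx] := Hx (Num.truncn e^-1) I; exists y; split => //; apply: eB.
apply/ball_sym; apply: le_ball yx; rewrite invf_ple ?posrE//.
exact: ltW (truncnS_gt _).
Qed.

(** The thickenings decrease to the closed set A; continuity from above applies within the set B of
    finite measure. *)
Lemma thick_small A B (eta : R) : closed A -> measurable B -> (lam B < +oo)%E -> 0 < eta ->
  exists2 s0, 0 < s0 & forall s, s <= s0 ->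
    (lam (thick A s `&` B) <= lam (A `&` B) + eta%:E)%E.
Proof.
move=> cA mB B1 eta0; pose F (k : nat) := thick A k.+1%:R^-1 `&` B.
have mA : measurable A.
  by rewrite -(thick_cap cA); apply: bigcapT_measurable => k; exact: measurable_thick.
have mF (k : nat) : measurable (F k) by apply: measurableI => //; exact: measurable_thick.
have F1 (k : nat) : (lam (F k) < +oo)%E.
  by apply: le_lt_trans B1; apply: le_measure; rewrite ?inE//; exact: subIsetr.
have AB1 : (lam (A `&` B) < +oo)%E.
  by apply: le_lt_trans B1; apply: le_measure; rewrite ?inE//; exact: measurableI.
have capF : \bigcap_k F k = A `&` B by rewrite /F bigcapIl ?thick_cap//; exists 0%N.
have : lam \o F @ \oo --> lam (\bigcap_k F k).
  apply: nonincreasing_cvg_mu; [exact: F1|exact: mF|by rewrite capF; exact: measurableI|].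
  move=> i j ij; apply/subsetPset => x [xi Bx]; split => //; apply: thick_mono xi.
  by rewrite lef_pV2 ?posrE// ler_nat ltnS.
rewrite capF.
have fin : lam (A `&` B) \is a fin_num by rewrite ge0_fin_numE.
rewrite -{1}(fineK fin) => /fine_cvgP[_ /cvgrPdist_le/(_ _ eta0)[k _ Hk]].
exists k.+1%:R^-1; first by rewrite invr_gt0.
move=> s sk; apply: (@le_trans _ _ (lam (F k))).
  apply: le_measure; rewrite ?inE//; first by apply: measurableI => //; exact: measurable_thick.
  by apply: setSI; exact: thick_mono.
have := Hk k (leqnn _); rewrite /= ler_norml => /andP[H _].
rewrite -(fineK fin) -[X in (X <= _)%E]fineK; last by rewrite ge0_fin_numE.
by rewrite -EFinD lee_fin; lra.
Qed.

Definition inner_grid s O : {fset V} := fset_set [set k | gcell s k `<=` O].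

Lemma inner_gridP s O k : 0 < s -> bounded_set O ->
  k \in inner_grid s O <-> gcell s k `<=` O.
Proof.
move=> s0 bO; rewrite in_fset_set ?inE//.
apply: sub_finite_set (finite_lattice_in s0 bO) => k' /= k'O.
by apply: k'O; exact: cell_self.
Qed.

Lemma inner_cells_sub s O : 0 < s -> bounded_set O -> cells s (inner_grid s O) `<=` O.
Proof. by move=> s0 bO x [k /= kO kx]; apply: (inner_gridP _ s0 bO).1 kx. Qed.

(** A point of O whose cell leaves O lies within s of the complement. That complement is closed and
    does not meet O, so its thickenings have vanishing measure in O. *)
Lemma inner_exhaustion O (eta : R) : open O -> bounded_set O -> 0 < eta ->
  exists2 s0, 0 < s0 & forall s, 0 < s -> s <= s0 ->
    (lam (O `\` cells s (inner_grid s O)) <= eta%:E)%E.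
Proof.
move=> oO bO eta0; have mO := open_measurable_rV oO.
have [s0 s00 H] := thick_small (open_closedC oO) mO (bounded_lebesgue_lty mO bO) eta0.
exists s0 => // s sp ss0; have := H s ss0; rewrite setICl measure0 add0e; apply: le_trans.
apply: le_measure; rewrite ?inE.
- by apply: measurableD => //; exact: measurable_cells.
- by apply: measurableI => //; exact: measurable_thick.
move=> x [Ox xU]; split => //; apply: contrapT => xt; apply: xU.
exists (corner s x); last exact: gcell_corner.
apply/inner_gridP => // y ky; apply: contrapT => Oy; apply: xt; exists y => //.
exact: (gcell_ball sp ky (gcell_corner x sp)).
Qed.

(** The cells at the lattice points of A are disjoint and lie within s of A. The thickenings shrink
    to the closure, which is where a null boundary becomes necessary. *)
Lemma lattice_count A (eta : R) : bounded_set A -> 0 < eta -> exists2 s0, 0 < s0 &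
  forall s, 0 < s -> s <= s0 ->
    ((#|` fset_set (lattice_in s A)|%:R * s ^+ n)%:E <= lam (closure A) + eta%:E)%E.
Proof.
move=> bA eta0; have [b b0 Ab] := bounded_setP bA.
have cAb x : closure A x -> `|x| <= b + 1.
  move=> /(_ (ball x 1) (nbhsx_ballx _ _ ltr01))[y [/Ab yb]].
  rewrite mx_norm_ball /ball_ /= => xy.
  by rewrite -(subrK y x); apply: le_trans (ler_normD _ _) _; rewrite addrC lerD// ltW.
(* A window of finite measure that contains all these cells, since s <= 1. *)
pose B := ball (0 : T) (b + 3).
have mB : measurable B by apply: open_measurable_rV; exact: ball_open.
have bB : bounded_set B.
  exists (b + 3); split; first exact: num_real.
  move=> M bM x; rewrite /B mx_norm_ball /ball_ /= sub0r normrN => xb.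
  exact/ltW/(lt_trans xb).
have [s1 s10 H] := thick_small (@closed_closure _ A) mB (bounded_lebesgue_lty mB bB) eta0.
exists (Num.min s1 1); first by rewrite lt_min s10 ltr01.
move=> s s0; rewrite le_min => /andP[ss1 s1'].
rewrite -lebesgue_cells//; apply: (@le_trans _ _ (lam (thick (closure A) s `&` B))).
  apply: le_measure; rewrite ?inE; first exact: measurable_cells.
    by apply: measurableI => //; exact: measurable_thick.
  move=> x [k /=]; rewrite in_fset_set; last exact: finite_lattice_in.
  rewrite inE => Ak kx; have kk : gcell s k (s *: intv k) by exact: cell_self.
  have xb := gcell_ball s0 kk kx; split; first by exists (s *: intv k) => //; exact: subset_closure.
  move: xb; rewrite /B !mx_norm_ball /ball_ /= sub0r normrN => xb.
  have := Ab _ Ak; rewrite -(subrKC (s *: intv k) x) => kb.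
  apply: le_lt_trans (ler_normD _ _) _; rewrite distrC in xb; lra.
apply: le_trans (H s ss1) _; rewrite leeD2r// le_measure ?inE//.
- by apply: measurableI => //; apply: closed_measurable_rV; exact: closed_closure.
- apply: closed_measurable_rV; exact: closed_closure.
Qed.

End grid.

(** * The boundary is null *)

Lemma lipschitzP (R : realType) (m : nat) (g : 'rV[R]_m -> R) :
  [lipschitz g y | y in setT] ->
  exists2 L, 0 < L & forall x y, `|g x - g y| <= L * `|x - y|.
Proof.
move=> [M [_ HM]]; exists (`|M| + 1); first by rewrite ltr_wpDl.
move=> x y; have : `|M| + 1 > M by apply: le_lt_trans (ler_norm M) _; rewrite ltrDl.
by move=> /HM/(_ (x, y)) /=; apply.
Qed.

Section null_boundary.
Context {R : realType} {m : nat}.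
Local Notation T := 'rV[R]_m.+1.
Local Notation lam := (@lebesgue_rV R m.+1).
Implicit Types (A B : set T) (x y v : T).

(* Infinitely many disjoint translates of B fit in a bounded set. *)
Lemma null_of_translates B v : measurable B -> bounded_set B ->
  (forall s t x, B (x - s *: v) -> B (x - t *: v) -> s = t) -> lam B = 0%E.
Proof.
move=> mB bB inj; pose F (i : nat) := translate (- (i.+1%:R^-1 *: v)) @^-1` B.
have mF i : measurable (F i).
  by rewrite -[X in measurable X]setTI; exact: (measurable_translate _ measurableT mB).
have lamF i : lam (F i) = lam B by exact: lebesgue_translate.
have trivF : trivIset setT F.
  move=> i j _ _ [x [Bi Bj]]; have /eqP := inj _ _ _ Bi Bj.
  by rewrite (inj_eq invr_inj) eqr_nat => /eqP[].
have [b b0 Bb] := bounded_setP bB; pose D := ball (0 : T) (b + `|v| + 1).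
have mD : measurable D by apply: open_measurable_rV; exact: ball_open.
have D1 : (lam D < +oo)%E.
  apply: bounded_lebesgue_lty => //; exists (b + `|v| + 1); split; first exact: num_real.
  move=> M bM x; rewrite /D mx_norm_ball /ball_ /= sub0r normrN => xb.
  exact/ltW/(lt_trans xb).
have FD : \bigcup_i F i `<=` D.
  move=> x [i _ /Bb]; rewrite /translate /D mx_norm_ball /ball_ /= sub0r normrN => xb.
  rewrite -(subrK (i.+1%:R^-1 *: v) x); apply: le_lt_trans (ler_normD _ _) _.
  have : `|i.+1%:R^-1 *: v| <= `|v|.
    by rewrite normrZ ger0_norm ?invr_ge0// ler_piMl// invf_le1// ler1n.
  by move: xb; lra.
have mU : measurable (\bigcup_i F i) by exact: bigcupT_measurable.
have BD n : (n%:R%:E * lam B <= lam D)%E.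
  apply: (@le_trans _ _ (lam (\bigcup_i F i))); last by apply: le_measure; rewrite ?inE.
  rewrite measure_bigcup//; apply: le_trans (nneseries_lim_ge (m := 0) n _) => //.
  rewrite big_mkord (eq_bigl xpredT) => [|i]; last by rewrite in_setT.
  rewrite (eq_bigr (fun=> lam B)) => [|i _]; last exact: lamF.
  by rewrite mule_natl sumr_const card_ord.
have B1 : lam B \is a fin_num.
  rewrite ge0_fin_numE//; apply: le_lt_trans D1; have := BD 1%N; by rewrite mul1e.
rewrite -(fineK B1); congr (_%:E); apply/eqP; rewrite eq_le fine_ge0// andbT leNgt.
apply/negP => B0; have := BD (Num.truncn (fine (lam D) / fine (lam B))).+1.
rewrite -(fineK B1) -[leRHS]fineK ?ge0_fin_numE// -EFinM lee_fin leNgt -ltr_pdivrMr//.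
by rewrite truncnS_gt.
Qed.

(** [F] is the height above the graph. At a boundary point it cannot be positive, which would put
    the point in A, nor negative, since by continuity A would then have no points nearby. A vertical
    translation by s shifts [F] by s, so distinct vertical translates of the zero set are
    disjoint. *)
Lemma local_null_boundary A x0 : open A -> bounded_set A -> lipschitz_boundary A ->
  (closure A `\` A) x0 -> exists2 s, 0 < s & lam ((closure A `\` A) `&` ball x0 s) = 0%E.
Proof.
move=> oA bA lA [cx Ax]; have [|Q [r [g [QQ r0 /lipschitzP[L L0 gL] AP]]]] := lA x0.
  by split => // /interior_subset.
have QtQ : Q^T *m Q = 1%:M by exact: mulmx1C.
pose yv x := (x - x0) *m Q; pose tl (y : T) : 'rV[R]_m := \row_i y ord0 (lift ord0 i).
pose F x := yv x ord0 ord0 - g (tl (yv x)).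
pose c := \sum_i \sum_j `|Q i j|.
have c0 : 0 <= c by apply: sumr_ge0 => i _; apply: sumr_ge0.
have yvB x z i : `|(yv x - yv z) ord0 i| <= c * `|x - z|.
  have -> : yv x - yv z = (x - z) *m Q by rewrite /yv -mulmxBl opprB addrA subrK.
  rewrite mxE; apply: le_trans (ler_norm_sum _ _ _) _; rewrite /c mulr_suml.
  apply: ler_sum => j _; rewrite normrM mulrC; apply: ler_pM => //; last exact: abs_coord_le_norm.
  by rewrite (bigD1 i)//= lerDl sumr_ge0.
have subE (a b : T) i : (a - b) ord0 i = a ord0 i - b ord0 i by rewrite !mxE.
have tlE a b i : (tl a - tl b) ord0 i = (a - b) ord0 (lift ord0 i) by rewrite !mxE.
have FL x z : `|F x - F z| <= (c + L * c) * `|x - z|.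
  rewrite /F; set p := yv x ord0 ord0; set q := yv z ord0 ord0.
  set gp := g _; set gq := g _.
  have -> : p - gp - (q - gq) = (p - q) - (gp - gq) by ring.
  apply: le_trans (ler_normB _ _) _; rewrite mulrDl; apply: lerD.
    by have := yvB x z ord0; rewrite subE.
  apply: le_trans (gL _ _) _; rewrite -mulrA; apply: ler_wpM2l; first exact: ltW.
  apply: norm_leP => [|i]; first by rewrite mulr_ge0.
  by rewrite tlE.
have r1 : 0 < r / m.+1%:R by rewrite divr_gt0.
have near_r x : `|x - x0| < r / m.+1%:R -> enorm (x - x0) < r.
  by move=> xr; apply: le_lt_trans (enorm_le_norm _) _; rewrite mulrC -ltr_pdivlMr.
exists (r / m.+1%:R) => //.
have onF x : ((closure A `\` A) `&` ball x0 (r / m.+1%:R)) x -> F x = 0.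
  rewrite mx_norm_ball /ball_ /= distrC => -[[clx nAx] xr]; apply/eqP; rewrite eq_le.
  apply/andP; split.
    rewrite leNgt; apply/negP => F0; apply: nAx; apply/(AP _ (near_r _ xr)) => /=.
    by rewrite -subr_gt0.
  rewrite leNgt; apply/negP => F0.
  (* A radius that keeps z in the chart and, by the Lipschitz bound, [F] negative at z. *)
  pose e := Num.min (r / m.+1%:R - `|x - x0|) (- F x / (c + L * c + 1)).
  have cL : 0 < c + L * c + 1 by rewrite ltr_wpDl// addr_ge0// mulr_ge0// ltW.
  have e0 : 0 < e by rewrite lt_min subr_gt0 xr divr_gt0// oppr_gt0.
  have [z [Az]] := clx _ (nbhsx_ballx x _ e0).
  rewrite mx_norm_ball /ball_ /= lt_min => /andP[z1 z2].
  have zr : `|z - x0| < r / m.+1%:R.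
    rewrite -(subrKA x); apply: le_lt_trans (ler_normD _ _) _.
    by rewrite -ltrBrDr distrC.
  have /(AP _ (near_r _ zr)) /= := Az; rewrite -subr_gt0 -/(F z) => Fz.
  have := FL x z; rewrite ler_norml => /andP[H1 _].
  move: z2; rewrite ltr_pdivlMr// => z2.
  have : `|x - z| * (c + L * c) <= `|x - z| * (c + L * c + 1).
    by apply: ler_wpM2l => //; rewrite lerDl.
  move: H1 z2; rewrite (mulrC (c + L * c)); lra.
(* The vertical direction of the chart in the original coordinates. *)
pose v : T := delta_mx ord0 ord0 *m Q^T.
have vQ : v *m Q = delta_mx ord0 ord0 by rewrite /v -mulmxA QtQ mulmx1.
have mK : measurable (closure A `\` A).
  by apply: measurableD; [apply: closed_measurable_rV; exact: closed_closure|exact: open_measurable_rV].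
apply: (@null_of_translates _ v).
- by apply: measurableI => //; apply: open_measurable_rV; exact: ball_open.
- exists (`|x0| + r / m.+1%:R); split; first exact: num_real.
  move=> M bM x [_]; rewrite mx_norm_ball /ball_ /= distrC => xr.
  rewrite -(subrK x0 x); apply: le_trans (ler_normD _ _) _.
  by apply/ltW/(lt_trans _ bM); rewrite addrC ltrD2l.
have deE0 s : (s *: delta_mx ord0 ord0 : T) ord0 ord0 = s by rewrite !mxE !eqxx mulr1.
have deEl s i : (s *: delta_mx ord0 ord0 : T) ord0 (lift ord0 i) = 0 by rewrite !mxE mulr0.
have Fs s x : F (x - s *: v) = F x - s.
  have -> : F (x - s *: v) = (yv x - s *: delta_mx ord0 ord0) ord0 ord0 -
      g (tl (yv x - s *: delta_mx ord0 ord0)).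
    by rewrite /F /yv addrAC mulmxBl -scalemxAl vQ.
  have -> : tl (yv x - s *: delta_mx ord0 ord0) = tl (yv x).
    by apply/rowP => i; rewrite [LHS]mxE [RHS]mxE subE deEl subr0.
  by rewrite /F subE deE0; ring.
move=> s t x /onF + /onF; rewrite !Fs => /eqP + /eqP.
by rewrite !subr_eq0 => /eqP <- /eqP.
Qed.

Lemma null_boundary A : open A -> bounded_set A -> lipschitz_boundary A ->
  lam (closure A) = lam A.
Proof.
move=> oA bA lA; pose K := closure A `\` A.
have mA := open_measurable_rV oA.
have mcA : measurable (closure A) by apply: closed_measurable_rV; exact: closed_closure.
have mK : measurable K by exact: measurableD.
suff K0 : lam K = 0%E.
  have -> : lam (closure A) = (lam K + lam (closure A `&` A))%E by exact: measureDI.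
  by rewrite K0 add0e; congr (lam _); apply/setIidPr; exact: subset_closure.
have cK : compact K.
  apply: bounded_closed_compact; last first.
    by rewrite /K setDE; apply: closedI; [exact: closed_closure|exact: open_closedC].
  have [b b0 Ab] := bounded_setP bA; exists (b + 1); split; first exact: num_real.
  move=> M bM x [/(_ (ball x 1) (nbhsx_ballx _ _ ltr01))[y [/Ab yb xy]] _].
  move: xy; rewrite mx_norm_ball /ball_ /= => xy.
  rewrite -(subrK y x); apply: le_trans (ler_normD _ _) _.
  by move: xy bM; lra.
have /choice[rad Hrad] : forall x, exists s : R, K x -> 0 < s /\ lam (K `&` ball x s) = 0%E.
  move=> x.
  have [Kx|nKx] := pselect (K x); last by exists 0.
  by have [s s0 sK] := local_null_boundary oA bA lA Kx; exists s.
have : cover_compact K by rewrite -compact_cover.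
move=> /(_ T K (fun x => ball x (rad x)))[||D' D'K KD'].
- by move=> x _; exact: ball_open.
- by move=> x Kx; exists x => //; apply: ballxx; have [] := Hrad x Kx.
have negl (s : seq T) : {subset s <= K} ->
    lam.-negligible (\big[setU/set0]_(x <- s) (K `&` ball x (rad x))).
  elim: s => [|x s IH] sK; first by rewrite big_nil; exact: negligible_set0.
  rewrite big_cons; apply: negligibleU.
    apply/negligibleP; first by apply: measurableI => //; apply: open_measurable_rV; exact: ball_open.
    by have [] := Hrad x; first by apply/set_mem/sK; rewrite mem_head.
  by apply: IH => y ys; apply: sK; rewrite inE ys orbT.
apply/negligibleP => //; apply: negligibleS (negl D' _) => [x Kx|x xD']; last exact: D'K.
have [y /= yD' xy] := KD' x Kx; rewrite -bigcup_fset; by exists y.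
Qed.

End null_boundary.

(** * Approximation in L^1 *)

Section open_approximation.
Context {R : realType} {n : nat}.
Local Notation T := 'rV[R]_n.
Local Notation lam := (@lebesgue_rV R n).
Context (Omega : set T) (mOmega : measurable Omega) (Omega1 : (lam Omega < +oo)%E).
Implicit Types (A B U : set T).

Definition symdiff A B := (A `\` B) `|` (B `\` A).

Lemma measurable_symdiff A B : measurable A -> measurable B -> measurable (symdiff A B).
Proof. by move=> mA mB; apply: measurableU; exact: measurableD. Qed.

(** Closeness in symmetric difference, unlike covering by an open set, passes to complements; this
    makes induction over the sigma-algebra possible. *)
Definition open_approximable A := measurable A /\ forall eta : R, 0 < eta ->
  exists2 U, open U & (lam (symdiff A U `&` Omega) <= eta%:E)%E.

(** The complement of the approximating open set U is closed, and a thin open thickening of it adds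
    only a small part of U within [Omega]. *)
Lemma open_approximableC A : open_approximable A -> open_approximable (~` A).
Proof.
move=> [mA appA]; split; first exact: measurableC.
move=> eta eta0; have eta20 : 0 < eta / 2 by rewrite divr_gt0.
have [U oU AO] := appA _ eta20; have mO := open_measurable_rV oU.
have mUO : measurable (U `&` Omega) by exact: measurableI.
have UO1 : (lam (U `&` Omega) < +oo)%E.
  by apply: le_lt_trans Omega1; apply: le_measure; rewrite ?inE//; exact: subIsetr.
have [s s0 Hs] := thick_small (open_closedC oU) mUO UO1 eta20.
have := Hs s (lexx _).
rewrite (_ : ~` U `&` (U `&` Omega) = set0) ?measure0 ?add0e => [{}Hs|]; last first.
  by rewrite setIA setICl set0I.
exists (thick (~` U) s); first exact: open_thick.
have mth := @measurable_thick R n (~` U) s.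
apply: (@le_trans _ _ (lam ((symdiff A U `&` Omega) `|` (thick (~` U) s `&` (U `&` Omega))))).
  apply: le_measure; rewrite ?inE.
  - by apply: measurableI => //; apply: measurable_symdiff => //; exact: measurableC.
  - by apply: measurableU; apply: measurableI => //; exact: measurable_symdiff.
  move=> x [[[nA nth]|[xth /contrapT Ax]] Ox].
    left; split => //; right; split; last exact: nA.
    by apply: contrapT => nO; apply: nth; exact: sub_thick.
  by have [xO|nO] := pselect (U x); [right|left; split => //; left].
apply: le_trans (measureU2 _ _ _) _.
- by apply: measurableI => //; exact: measurable_symdiff.
- exact: measurableI.
by rewrite (splitr eta) EFinD; exact: leeD.
Qed.

Lemma open_approximable_bigcup (A : (set T)^nat) :
  (forall i, open_approximable (A i)) -> open_approximable (\bigcup_i A i).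
Proof.
move=> appA; have mA i : measurable (A i) by have [] := appA i.
split; first exact: bigcupT_measurable.
move=> eta eta0.
have /choice[U HO] : forall i, exists U, open U /\
    (lam (symdiff (A i) U `&` Omega) <= (eta / (2 ^ i.+1)%:R)%:E)%E.
  move=> i; have [|U oU AO] := (appA i).2 (eta / (2 ^ i.+1)%:R); last by exists U.
  by rewrite divr_gt0// ltr0n expn_gt0.
have mO i : measurable (U i) by apply: open_measurable_rV; have [] := HO i.
have mS i : measurable (symdiff (A i) (U i) `&` Omega).
  by apply: measurableI => //; exact: measurable_symdiff.
exists (\bigcup_i U i); first by apply: bigcup_open => i _; have [] := HO i.
apply: (@le_trans _ _ (\sum_(i <oo) lam (symdiff (A i) (U i) `&` Omega))%E).
  apply: measure_sigma_subadditive => //.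
    by apply: measurableI => //; apply: measurable_symdiff; exact: bigcupT_measurable.
  move=> x [[[[i _ Ai] nO]|[[i _ Oi] nA]] xO]; exists i => //; split => //.
    by left; split => // Oi; apply: nO; exists i.
  by right; split => // Ai; apply: nA; exists i.
apply: le_trans (epsilon_trick0 xpredT (ltW eta0)).
by apply: lee_nneseries => [i _ _|i _]; [exact: measure_ge0|have [] := HO i].
Qed.

Lemma measurable_open_approximable A : measurable A -> open_approximable A.
Proof.
rewrite measurable_rVE; move: A; apply: smallest_sub.
  split.
  - split; first exact: measurable0.
    move=> eta eta0; exists set0; first exact: open0.
    by rewrite /symdiff setD0 setU0 set0I measure0 lee_fin ltW.
  - by move=> A appA; rewrite setTD; exact: open_approximableC.
  - exact: open_approximable_bigcup.
move=> U oU; split; first exact: open_measurable_rV.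
move=> eta eta0; exists U => //.
by rewrite /symdiff setDv setU0 set0I measure0 lee_fin ltW.
Qed.

End open_approximation.

Section integrable_induction.
Import HBSimple.
Context {R : realType} {n : nat}.
Local Notation T := 'rV[R]_n.
Local Notation lam := (@lebesgue_rV R n).
Context (Omega : set T) (mOmega : measurable Omega) (Omega1 : (lam Omega < +oo)%E).
Implicit Types (f g : T -> R).

Definition integrableR f := lam.-integrable Omega (EFin \o f).

Lemma integrableR_bounded f M : measurable_fun Omega f ->
  (forall x, Omega x -> `|f x| <= M) -> integrableR f.
Proof.
move=> mf fM; apply: measurable_bounded_integrable => //.
by exists M; split; [exact: num_real|move=> M' MM' x Ox; exact/ltW/(le_lt_trans (fM x Ox))].
Qed.

Lemma integrableR_measurable f : integrableR f -> measurable_fun Omega f.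
Proof. by move=> /measurable_int/measurable_EFinP. Qed.

Lemma integrableR_indic A : measurable A -> integrableR \1_A.
Proof.
move=> mA; apply: (@integrableR_bounded _ 1) => [|x _]; first exact: measurable_indic.
by rewrite indicE; case: (_ \in _); rewrite ?normr1 ?normr0.
Qed.

Lemma integrableRD f g : integrableR f -> integrableR g -> integrableR (fun x => f x + g x).
Proof. by move=> If Ig; have := integrableD mOmega If Ig. Qed.

Lemma integrableRZ c f : integrableR f -> integrableR (fun x => c * f x).
Proof. by move=> If; have := integrableZl mOmega c If. Qed.

Lemma integrableRB f g : integrableR f -> integrableR g -> integrableR (fun x => f x - g x).
Proof. by move=> If Ig; have := integrableB mOmega If Ig. Qed.

Lemma integrableR_norm f : integrableR f -> integrableR (fun x => `|f x|).
Proof. by move=> If; have := integrable_abse If. Qed.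

Context (P : (T -> R) -> Prop).
Context (P_open : forall U, open U -> P \1_U).
Context (PD : forall f g, integrableR f -> integrableR g -> P f -> P g ->
  P (fun x => f x + g x)).
Context (PZ : forall c f, integrableR f -> P f -> P (fun x => c * f x)).
Context (P_closed : forall f, integrableR f -> (forall eta : R, 0 < eta -> exists g,
  [/\ integrableR g, P g & \int[lam]_(x in Omega) `|f x - g x| <= eta]) -> P f).

Let P_indic A : measurable A -> P \1_A.
Proof.
move=> mA; apply: P_closed => [|eta eta0]; first exact: integrableR_indic.
have [U oU AU] := (measurable_open_approximable mOmega Omega1 mA).2 eta eta0.
have mU := open_measurable_rV oU.
exists \1_U; split; [exact: integrableR_indic|exact: P_open|].
have -> : (fun x => `|\1_A x - \1_U x|) = (\1_(symdiff A U) : T -> R).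
  apply/funext => x; rewrite !indicE in_setU !in_setD.
  by case: (x \in A); case: (x \in U); rewrite /= ?subrr ?subr0 ?sub0r ?normrN ?normr0 ?normr1.
rewrite /Rintegral integral_indic//; last exact: measurable_symdiff.
by rewrite -lee_fin fineK// ge0_fin_numE// (le_lt_trans AU)// ltry.
Qed.

Let P_sum (s : seq R) (A : R -> set T) : (forall y, measurable (A y)) ->
  P (fun x => \sum_(y <- s) y * \1_(A y) x) /\
  integrableR (fun x => \sum_(y <- s) y * \1_(A y) x).
Proof.
move=> mA; elim: s => [|y s [Ps Is]].
  have I0 := @integrableR_indic _ (measurable0 : measurable (set0 : set T)).
  rewrite (_ : (fun x => _) = (fun x => 0 * (\1_(set0 : set T) x : R))).
    by split; [apply: PZ => //; exact: P_indic|exact: integrableRZ].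
  by apply/funext => x; rewrite big_nil mul0r.
have Iy : integrableR (fun x => y * \1_(A y) x) by apply/integrableRZ/integrableR_indic.
rewrite (_ : (fun x => _) = (fun x => y * \1_(A y) x + \sum_(y <- s) y * \1_(A y) x)).
  by split; [apply: PD => //; apply: PZ; [exact: integrableR_indic|exact: P_indic]|exact: integrableRD].
by apply/funext => x; rewrite big_cons.
Qed.

(** From indicators of open sets to those of measurable sets by [open_approximable], then to simple
    functions by linearity, then to integrable functions by density in L^1. It serves both the
    oscillation and the weak convergence criterion. *)
Lemma integrable_induction f : integrableR f -> P f.
Proof.
move=> If; apply: P_closed => // eta eta0.
have [g [Ig _]] := approximation_sfun_integrable mOmega If.
move=> /fine_cvgP[Hfin /cvgrPdist_le/(_ _ eta0) Hdist].
have [k [/= kfin kdist]] : exists k, (\int[lam]_(x in Omega) `|(EFin \o f) x - (g k x)%:E|)%E \is a fin_num /\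
    `|0 - (fine \o (fun k => \int[lam]_(x in Omega) `|(EFin \o f) x - (g k x)%:E|)%E) k| <= eta.
  have [k _ Hk] : \forall k \near \oo, (\int[lam]_(x in Omega) `|(EFin \o f) x - (g k x)%:E|)%E \is a fin_num /\
    `|0 - (fine \o (fun k => \int[lam]_(x in Omega) `|(EFin \o f) x - (g k x)%:E|)%E) k| <= eta.
    by near=> k; split; near: k.
  by exists k; apply: Hk => /=.
exists (g k); split; [exact: Ig| |].
  have -> : (g k : T -> R) = (fun x => \sum_(y <- fset_set (range (g k))) y * \1_(g k @^-1` [set y]) x).
    apply/funext => x; rewrite [LHS]fimfunE fsbig_finite//.
  by have [] := @P_sum (fset_set (range (g k))) (fun y => g k @^-1` [set y]).
move: kdist; rewrite sub0r normrN; apply: le_trans; apply: le_trans (ler_norm _).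
by [].
Unshelve. all: by end_near. Qed.

End integrable_induction.

(** * Oscillation on grids *)

Lemma sub_bounded_set (R : numFieldType) (V : normedModType R) (A B : set V) :
  A `<=` B -> bounded_set B -> bounded_set A.
Proof. by move=> AB [b [br Hb]]; exists b; split=> // M bM x /AB; exact: Hb. Qed.

Section real_integrals.
Context {R : realType} {n : nat}.
Local Notation T := 'rV[R]_n.
Local Notation lam := (@lebesgue_rV R n).
Implicit Types (A B D q : set T) (f g h : T -> R).

Lemma integrableR_sub A B f : measurable A -> measurable B -> A `<=` B ->
  integrableR B f -> integrableR A f.
Proof. by move=> mA mB AB If; exact: (integrableS mB mA AB If). Qed.

Lemma Rintegral_diff A B f : measurable A -> measurable B -> A `<=` B -> integrableR B f ->
  \int[lam]_(x in B) f x = \int[lam]_(x in A) f x + \int[lam]_(x in B `\` A) f x.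
Proof.
move=> mA mB AB If; rewrite -{1}(setDUK AB) Rintegral_setU//.
- exact: measurableD.
- by rewrite setDUK.
- by apply/disj_setPS => x [Ax []].
Qed.

Lemma le_Rintegral_set A B f : measurable A -> measurable B -> A `<=` B -> integrableR B f ->
  (forall x, B x -> 0 <= f x) -> \int[lam]_(x in A) f x <= \int[lam]_(x in B) f x.
Proof.
move=> mA mB AB If f0; rewrite (Rintegral_diff mA mB AB If) lerDl.
by apply: Rintegral_ge0 => x [Bx _]; exact: f0.
Qed.

Lemma le_norm_Rintegral_bound D f (M : R) : measurable D -> (lam D < +oo)%E ->
  integrableR D f -> (forall x, D x -> `|f x| <= M) ->
  `|\int[lam]_(x in D) f x| <= M * fine (lam D).
Proof.
move=> mD D1 If fM; apply: le_trans (le_normr_Rintegral mD If) _.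
rewrite -(Rintegral_cst lam mD); apply: le_Rintegral => //; first exact: integrableR_norm.
by apply: (@integrableR_bounded _ _ _ mD D1 _ `|M|) => // x Dx.
Qed.

Lemma integrableR_mul D f h (M : R) : measurable D -> integrableR D f ->
  measurable_fun D h -> (forall x, D x -> `|h x| <= M) -> integrableR D (fun x => f x * h x).
Proof.
move=> mD If mh hM.
apply: (@le_integrable _ _ _ lam _ mD _ (fun x => (`|M| * f x)%:E)).
- by apply/measurable_EFinP; apply: measurable_funM => //; exact: integrableR_measurable If.
- move=> x Dx /=; rewrite lee_fin !normrM normr_id mulrC; apply: ler_wpM2r => //.
  exact: le_trans (hM x Dx) (ler_norm M).
- exact: integrableRZ.
Qed.

Definition mean q f : R := (fine (lam q))^-1 * \int[lam]_(x in q) f x.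

Definition dev q f : R := \int[lam]_(x in q) `|f x - mean q f|.

Context (q : set T) (mq : measurable q) (q1 : (lam q < +oo)%E).

Lemma integrableR_cst (c : R) : integrableR q (fun=> c).
Proof. by apply: (@integrableR_bounded _ _ _ mq q1 _ `|c|). Qed.

Lemma integrable_dev f : integrableR q f -> integrableR q (fun x => `|f x - mean q f|).
Proof.
by move=> If; apply/integrableR_norm/integrableRB => //; exact: integrableR_cst.
Qed.

Lemma meanD f g : integrableR q f -> integrableR q g ->
  mean q (fun x => f x + g x) = mean q f + mean q g.
Proof. by move=> If Ig; rewrite /mean RintegralD// mulrDr. Qed.

Lemma meanZ c f : integrableR q f -> mean q (fun x => c * f x) = c * mean q f.
Proof. by move=> If; rewrite /mean RintegralZl// mulrCA. Qed.

Lemma devD f g : integrableR q f -> integrableR q g ->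
  dev q (fun x => f x + g x) <= dev q f + dev q g.
Proof.
move=> If Ig; rewrite /dev -RintegralD//; [|exact: integrable_dev|exact: integrable_dev].
apply: le_Rintegral => //.
- by apply: integrable_dev; exact: integrableRD.
- by apply: integrableRD => //; exact: integrable_dev.
- by move=> x _; rewrite meanD// opprD addrACA ler_normD.
Qed.

Lemma devZ c f : integrableR q f -> dev q (fun x => c * f x) = `|c| * dev q f.
Proof.
move=> If; rewrite /dev -RintegralZl//; last exact: integrable_dev.
by apply: eq_Rintegral => x _; rewrite meanZ// -mulrBr normrM.
Qed.

Lemma dev_ge0 f : 0 <= dev q f.
Proof. exact: Rintegral_ge0. Qed.

Lemma dev_le f : integrableR q f -> dev q f <= 2 * \int[lam]_(x in q) `|f x|.
Proof.
move=> If; have Inf : integrableR q (fun x => `|f x|) by exact: integrableR_norm.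
apply: (@le_trans _ _ (\int[lam]_(x in q) (`|f x| + `|mean q f|))).
  apply: le_Rintegral => //; [exact: integrable_dev|apply: integrableRD => //; exact: integrableR_cst|].
  by move=> x _; exact: ler_normB.
rewrite RintegralD//; last exact: integrableR_cst.
rewrite mulr_natl mulr2n lerD2l Rintegral_cst// /mean normrM.
have [->|v0] := eqVneq (fine (lam q)) 0; first by rewrite mulr0 Rintegral_ge0.
have v1 : 0 < fine (lam q) by rewrite lt_def v0 fine_ge0.
apply: le_trans (le_normr_Rintegral mq If); move: v1; move: (fine _) => v v1.
by rewrite normfV (gtr0_norm v1) mulrAC mulVf ?mul1r// gt_eqF.
Qed.

Lemma dev_cst f c : 0 < fine (lam q) -> (forall x, q x -> f x = c) -> dev q f = 0.
Proof.
move=> v0 fc; have mc : mean q f = c.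
  rewrite /mean (@eq_Rintegral _ _ _ _ _ (cst c)) => [|x /set_mem /fc//].
  by rewrite Rintegral_cst// mulrCA mulVf ?mulr1// gt_eqF.
rewrite /dev (@eq_Rintegral _ _ _ _ _ (cst 0)) => [|x /set_mem /fc ->]; last first.
  by rewrite mc subrr normr0.
by rewrite Rintegral_cst// mul0r.
Qed.

Lemma Rintegral_mean f : 0 < fine (lam q) -> \int[lam]_(x in q) f x = fine (lam q) * mean q f.
Proof. by move=> v0; rewrite /mean mulrA mulfV ?mul1r// gt_eqF. Qed.

End real_integrals.

Section grid_integrals.
Context {R : realType} {n : nat}.
Local Notation T := 'rV[R]_n.
Local Notation V := 'rV[int]_n.
Local Notation lam := (@lebesgue_rV R n).
Implicit Types (s : R) (f g : T -> R) (k : V).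

Lemma sum_cells s (I : {fset V}) (D : set T) f : 0 < s -> measurable D -> integrableR D f ->
  (forall k, k \in I -> gcell s k `<=` D) ->
  \sum_(k <- I) \int[lam]_(x in gcell s k) f x = \int[lam]_(x in cells s I) f x.
Proof.
move=> s0 mD If ID; have mg k : measurable (gcell s k) by exact: measurable_gcell.
rewrite /cells bigcup_fset.
suff H (J : seq V) : {subset J <= I} -> uniq J ->
    \sum_(k <- J) \int[lam]_(x in gcell s k) f x =
    \int[lam]_(x in \big[setU/set0]_(i <- J) gcell s i) f x.
  by apply: H => //; exact: fset_uniq.
elim: J => [|k J IH] JI /=.
  by rewrite !big_nil Rintegral_set0.
move=> /andP[kJ uJ]; rewrite !big_cons IH//; last by move=> x xJ; apply: JI; rewrite inE xJ orbT.
have mJ : measurable (\big[setU/set0]_(i <- J) gcell s i) by exact: bigsetU_measurable.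
rewrite Rintegral_setU//.
  apply: integrableR_sub If => //; first exact: measurableU.
  rewrite subUset; split; first by apply: ID; apply: JI; rewrite mem_head.
  rewrite -bigcup_seq => x [i /= iJ ix]; apply: ID ix; apply: JI.
  by rewrite inE iJ orbT.
apply/disj_setPS => x [kx]; rewrite -bigcup_seq => -[i /= iJ ix].
move: kx ix => /(gcellP _ _ s0) kx /(gcellP _ _ s0) ik.
by move: kJ; rewrite -kx ik iJ.
Qed.

Context (Omega : set T) (oO : open Omega) (bO : bounded_set Omega).

Let mO : measurable Omega. Proof. exact: open_measurable_rV. Qed.
Let O1 : (lam Omega < +oo)%E. Proof. exact: bounded_lebesgue_lty. Qed.

Lemma fine_lebesgue_gcell s k : 0 < s -> fine (lam (gcell s k)) = s ^+ n.
Proof. by move=> s0; rewrite lebesgue_gcell. Qed.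

Lemma gcell_lty s k : 0 < s -> (lam (gcell s k) < +oo)%E.
Proof. by move=> s0; rewrite lebesgue_gcell// ltry. Qed.

Lemma integrableR_gcell s k f : 0 < s -> integrableR Omega f -> k \in inner_grid s Omega ->
  integrableR (gcell s k) f.
Proof.
move=> s0 If /(inner_gridP _ s0 bO) kO.
by apply: integrableR_sub If => //; exact: measurable_gcell.
Qed.

Definition osc s f : R := \sum_(k <- inner_grid s Omega) dev (gcell s k) f.

Lemma osc_ge0 s f : 0 <= osc s f.
Proof. by apply: sumr_ge0 => k _; exact: dev_ge0. Qed.

Lemma oscD s f g : 0 < s -> integrableR Omega f -> integrableR Omega g ->
  osc s (fun x => f x + g x) <= osc s f + osc s g.
Proof.
move=> s0 If Ig; rewrite /osc -big_split /= big_seq [leRHS]big_seq; apply: ler_sum => k kI.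
by apply: devD; [exact: measurable_gcell|exact: gcell_lty|exact: integrableR_gcell..].
Qed.

Lemma oscZ s c f : 0 < s -> integrableR Omega f -> osc s (fun x => c * f x) = `|c| * osc s f.
Proof.
move=> s0 If; rewrite /osc mulr_sumr; apply: eq_big_seq => k kI.
by apply: devZ; [exact: measurable_gcell|exact: gcell_lty|exact: integrableR_gcell].
Qed.

Lemma osc_le s f : 0 < s -> integrableR Omega f -> osc s f <= 2 * \int[lam]_(x in Omega) `|f x|.
Proof.
move=> s0 If; apply: (@le_trans _ _ (2 * \sum_(k <- inner_grid s Omega) \int[lam]_(x in gcell s k) `|f x|)).
  rewrite mulr_sumr /osc big_seq [leRHS]big_seq; apply: ler_sum => k kI.
  by apply: dev_le; [exact: measurable_gcell|exact: gcell_lty|exact: integrableR_gcell].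
apply: ler_wpM2l => //; rewrite (sum_cells s0 mO (integrableR_norm If)); last first.
  by move=> k /(inner_gridP _ s0 bO).
apply: le_Rintegral_set => //; [exact: measurable_cells|exact: inner_cells_sub|exact: integrableR_norm].
Qed.

(** The indicator is constant on the cells inside U, which do not contribute. The other cells meet U
    only outside the inner cells of U within [Omega]. *)
Lemma osc_indic s (U : set T) : 0 < s -> open U ->
  osc s \1_U <= 2 * fine (lam ((U `&` Omega) `\` cells s (inner_grid s (U `&` Omega)))).
Proof.
move=> s0 oU; have mU := open_measurable_rV oU.
have bUO : bounded_set (U `&` Omega) by exact: sub_bounded_set bO.
have I1 : integrableR Omega \1_U by exact: integrableR_indic.
have mUO : measurable (U `&` Omega) by exact: measurableI.
pose J := [fset k in inner_grid s Omega | k \notin inner_grid s (U `&` Omega)]%fset.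
apply: (@le_trans _ _ (2 * \sum_(k <- J) \int[lam]_(x in gcell s k) `|\1_U x|)).
  rewrite mulr_sumr /osc (big_fsetID _ (fun k => k \in inner_grid s (U `&` Omega))) /=.
  rewrite big_seq big1 ?add0r => [|k].
    rewrite big_seq [leRHS]big_seq; apply: ler_sum => k; rewrite !inE /= => /andP[kI _].
    apply: dev_le; [exact: measurable_gcell|exact: gcell_lty|exact: integrableR_gcell].
  rewrite !inE /= => /andP[_ /(inner_gridP _ s0 bUO) kU].
  have H1 x : gcell s k x -> \1_U x = 1 :> R by move=> /kU[Ux _]; rewrite indicE mem_set.
  apply: dev_cst H1; first exact: measurable_gcell.
  by rewrite fine_lebesgue_gcell// exprn_gt0.
apply: ler_wpM2l => //.
have JO k : k \in J -> gcell s k `<=` Omega.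
  by rewrite !inE /= => /andP[/(inner_gridP _ s0 bO)].
rewrite (sum_cells s0 mO (integrableR_norm I1))//.
rewrite (@eq_Rintegral _ _ _ _ _ \1_U) => [|x _]; last first.
  by rewrite indicE; case: (_ \in _); rewrite ?normr1 ?normr0.
have mcJ := @measurable_cells R n s J.
rewrite /Rintegral integral_indic//; apply: fine_le.
- rewrite ge0_fin_numE//; apply: le_lt_trans O1; apply: le_measure; rewrite ?inE//.
    exact: measurableI.
  by move=> x [_ [k kJ kx]]; exact: (JO k kJ).
- rewrite ge0_fin_numE//; apply: le_lt_trans O1; apply: le_measure; rewrite ?inE//.
    by apply: measurableD => //; exact: measurable_cells.
  by move=> x [[]].
apply: le_measure; rewrite ?inE.
- exact: measurableI.
- by apply: measurableD => //; exact: measurable_cells.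
move=> x [Ux [k /= kJ kx]]; split; first by split => //; exact: (JO k kJ).
move=> [k' /= k'I]; have := kJ; rewrite !inE /= => /andP[_ kI].
move=> /(gcellP _ _ s0) k'x; move/(gcellP _ _ s0) : kx => kx.
by move: kI; rewrite -kx k'x k'I.
Qed.

(** By [osc_le] the oscillation is bounded by the L^1 norm uniformly in the mesh, so it is enough to
    treat indicators of open sets, where [inner_exhaustion] applies. *)
Lemma osc_cvg f (eta : R) : integrableR Omega f -> 0 < eta -> exists2 s0, 0 < s0 &
  forall s, 0 < s -> s <= s0 -> osc s f <= eta.
Proof.
move=> If; move: eta.
apply: (@integrable_induction _ _ Omega mO O1 (fun f => forall eta : R, 0 < eta ->
  exists2 s0, 0 < s0 & forall s, 0 < s -> s <= s0 -> osc s f <= eta)) If.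
- move=> U oU eta eta0; have eta20 : 0 < eta / 2 by rewrite divr_gt0.
  have bUO : bounded_set (U `&` Omega) by exact: sub_bounded_set bO.
  have [s0 s00 H] := inner_exhaustion (openI oU oO) bUO eta20.
  exists s0 => // s sp ss0; apply: le_trans (osc_indic sp oU) _.
  rewrite mulrC -ler_pdivlMr//; have := H s sp ss0.
  rewrite -{1}[lam _]fineK ?lee_fin//.
  by rewrite ge0_fin_numE// (le_lt_trans (H s sp ss0))// ltry.
- move=> g h Ig Ih Pg Ph eta eta0; have eta20 : 0 < eta / 2 by rewrite divr_gt0.
  have [s1 s10 H1] := Pg _ eta20; have [s2 s20 H2] := Ph _ eta20.
  exists (Num.min s1 s2); first by rewrite lt_min s10.
  move=> s s0; rewrite le_min => /andP[ss1 ss2].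
  by apply: le_trans (oscD s0 Ig Ih) _; rewrite (splitr eta) lerD// ?H1// H2.
- move=> c g Ig Pg eta eta0; have c0 : 0 < `|c| + 1 by rewrite ltr_wpDl.
  have [|s1 s10 H1] := Pg (eta / (`|c| + 1)); first by rewrite divr_gt0.
  exists s1 => // s s0 ss1; rewrite oscZ//.
  apply: (@le_trans _ _ ((`|c| + 1) * osc s g)).
    by apply: ler_wpM2r; [exact: osc_ge0|rewrite lerDl].
  by rewrite mulrC -ler_pdivlMr//; exact: H1.
- move=> g Ig Hg eta eta0; have eta40 : 0 < eta / 4 by rewrite divr_gt0.
  have eta20 : 0 < eta / 2 by rewrite divr_gt0.
  have [h [Ih Ph gh]] := Hg _ eta40; have [s0 s00 Hs] := Ph _ eta20.
  exists s0 => // s sp ss0.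
  have -> : g = (fun x => h x + (g x - h x)) by apply/funext => x; rewrite subrKC.
  have Igh := integrableRB mO Ig Ih.
  apply: le_trans (oscD sp Ih Igh) _; have := osc_le sp Igh; have := Hs s sp ss0.
  lra.
Qed.

End grid_integrals.

(** * A criterion for weak convergence *)

Section weak_star_criterion.
Context {R : realType} {n : nat}.
Local Notation T := 'rV[R]_n.
Local Notation lam := (@lebesgue_rV R n).
Context (Omega : set T) (oO : open Omega) (bO : bounded_set Omega).

Let mO : measurable Omega. Proof. exact: open_measurable_rV. Qed.
Let O1 : (lam Omega < +oo)%E. Proof. exact: bounded_lebesgue_lty. Qed.

Lemma le_sum_subset (K : choiceType) (A B : {fset K}) (F : K -> R) :
  {subset A <= B} -> (forall k, 0 <= F k) -> \sum_(k <- A) F k <= \sum_(k <- B) F k.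
Proof.
move=> AB F0; rewrite (big_fsetID _ (fun k => k \in A) B) /=.
have -> : [fset x in B | x \in A]%fset = A.
  by apply/fsetP => k; rewrite !inE /=; apply/andP/idP => [[]//|kA]; split => //; exact: AB.
by rewrite lerDl; apply: sumr_ge0.
Qed.

Lemma open_Rintegral_le (U : set T) s (d : T -> R) (M : R) : 0 < s -> open U -> U `<=` Omega ->
  measurable_fun Omega d -> (forall x, Omega x -> `|d x| <= M) ->
  `|\int[lam]_(x in U) d x| <=
    \sum_(k <- inner_grid s Omega) `|\int[lam]_(x in gcell s k) d x| +
    M * fine (lam (U `\` cells s (inner_grid s U))).
Proof.
move=> s0 oU UO md dM; have mU := open_measurable_rV oU.
have bU : bounded_set U by exact: sub_bounded_set bO.
have Id : integrableR Omega d by exact: integrableR_bounded md dM.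
have IU : integrableR U d by exact: integrableR_sub Id.
have mc := @measurable_cells R n s (inner_grid s U).
have cU := inner_cells_sub s0 bU.
have mD : measurable (U `\` cells s (inner_grid s U)) by exact: measurableD.
rewrite (Rintegral_diff mc mU cU IU).
apply: le_trans (ler_normD _ _) _; apply: lerD; last first.
  apply: le_norm_Rintegral_bound => //.
  - by apply: le_lt_trans O1; apply: le_measure; rewrite ?inE// => x [/UO].
  - by apply: integrableR_sub Id => // x [/UO].
  - by move=> x [/UO + _]; exact: dM.
rewrite -(sum_cells s0 mU IU); last by move=> k /(inner_gridP _ s0 bU).
apply: le_trans (ler_norm_sum _ _ _) _; apply: le_sum_subset => // k.
by move=> /(inner_gridP _ s0 bU) kU; apply/(inner_gridP _ s0 bO); exact: subset_trans UO.
Qed.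

(** An open set is a union of inner cells up to small measure, so small cell integrals suffice
    against its indicator; the uniform bound M extends this to L^1. The mesh is allowed to vary with
    j, as it does in the recovery sequence. *)
Lemma cvg_Rintegral_mul (d : nat -> T -> R) (s : nat -> R) (M : R) :
  (forall j, measurable_fun Omega (d j)) ->
  (forall j x, Omega x -> `|d j x| <= M) ->
  (forall j, 0 < s j) -> s @ \oo --> 0 ->
  \sum_(k <- inner_grid (s j) Omega) `|\int[lam]_(x in gcell (s j) k) d j x| @[j --> \oo] --> 0 ->
  forall f, integrableR Omega f -> \int[lam]_(x in Omega) (f x * d j x) @[j --> \oo] --> 0.
Proof.
move=> md dM s0 s_cvg sum_cvg f If.
have Ifd g j : integrableR Omega g -> integrableR Omega (fun x => g x * d j x).
  by move=> Ig; exact: (integrableR_mul mO Ig (md j) (dM j)).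
have M0 : 0 <= `|M| by [].
have dM' j x : Omega x -> `|d j x| <= `|M| by move=> Ox; exact: le_trans (dM j x Ox) (ler_norm M).
apply: (@integrable_induction _ _ Omega mO O1 (fun f =>
  \int[lam]_(x in Omega) (f x * d j x) @[j --> \oo] --> 0)) If.
- move=> U oU; apply/cvgr0Pnorm_le => eps eps0.
  pose UO := U `&` Omega; have oUO : open UO by exact: openI.
  have mUO := open_measurable_rV oUO.
  have bUO : bounded_set UO by exact: (sub_bounded_set (@subIsetr _ U Omega) bO).
  have e1 : 0 < eps / 2 / (`|M| + 1) by rewrite !divr_gt0// ltr_wpDl.
  have [r0 r00 Hr] := inner_exhaustion oUO bUO e1.
  have /cvgr0Pnorm_le/(_ (eps / 2)) H1 := sum_cvg.
  have /cvgr0Pnorm_le/(_ r0 r00) H2 := s_cvg.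
  near=> j.
  have -> : \int[lam]_(x in Omega) (\1_U x * d j x) = \int[lam]_(x in UO) d j x.
    rewrite /UO setIC Rintegral_mkcondr patch_indic.
    by apply: eq_Rintegral => x _ /=; rewrite mulrC.
  apply: le_trans (open_Rintegral_le (s0 j) oUO (@subIsetr _ _ _) (md j) (dM' j)) _.
  rewrite (splitr eps); apply: lerD.
    apply: le_trans (ler_norm _) _; near: j; apply: H1; by rewrite divr_gt0.
  apply: (@le_trans _ _ ((`|M| + 1) * fine (lam (UO `\` cells (s j) (inner_grid (s j) UO))))).
    by apply: ler_wpM2r; [exact: fine_ge0|rewrite lerDl].
  rewrite mulrC -ler_pdivlMr ?ltr_wpDl//.
  have Hj : (lam (UO `\` cells (s j) (inner_grid (s j) UO)) <= (eps / 2 / (`|M| + 1))%:E)%E.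
    apply: Hr => //; apply: le_trans (ler_norm _) _; near: j; exact: H2.
  by rewrite -lee_fin fineK// ge0_fin_numE// (le_lt_trans Hj)// ltry.
- move=> g h Ig Ih Pg Ph; rewrite (_ : (fun j => _) = (fun j =>
    \int[lam]_(x in Omega) (g x * d j x) + \int[lam]_(x in Omega) (h x * d j x))).
    by rewrite -[0]addr0; exact: cvgD.
  apply/funext => j; rewrite -RintegralD//; [|exact: Ifd|exact: Ifd].
  by apply: eq_Rintegral => x _; rewrite mulrDl.
- move=> c g Ig Pg; rewrite (_ : (fun j => _) = (fun j => c * \int[lam]_(x in Omega) (g x * d j x))).
    by rewrite -[0](mulr0 c); exact: cvgMr.
  apply/funext => j; rewrite -RintegralZl//; last exact: Ifd.
  by apply: eq_Rintegral => x _; rewrite mulrA.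
- move=> g Ig Hg; apply/cvgr0Pnorm_le => eps eps0.
  have e1 : 0 < eps / 2 / (`|M| + 1) by rewrite !divr_gt0// ltr_wpDl.
  have [h [Ih Ph gh]] := Hg _ e1.
  have /cvgr0Pnorm_le/(_ (eps / 2)) H1 := Ph.
  near=> j.
  have Igh := integrableRB mO Ig Ih.
  have -> : \int[lam]_(x in Omega) (g x * d j x) =
      \int[lam]_(x in Omega) (h x * d j x) + \int[lam]_(x in Omega) ((g x - h x) * d j x).
    rewrite -RintegralD//; [|exact: Ifd|exact: Ifd].
    by apply: eq_Rintegral => x _; rewrite -mulrDl subrKC.
  apply: le_trans (ler_normD _ _) _; rewrite (splitr eps); apply: lerD.
    by near: j; apply: H1; rewrite divr_gt0.
  apply: le_trans (le_normr_Rintegral mO (Ifd _ j Igh)) _.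
  apply: (@le_trans _ _ (\int[lam]_(x in Omega) ((`|M| + 1) * `|g x - h x|))).
    apply: le_Rintegral => //; [exact/integrableR_norm/Ifd|exact/integrableRZ/integrableR_norm|].
    move=> x Ox; rewrite normrM mulrC; apply: ler_wpM2r => //.
    by apply: le_trans (dM' j x Ox) _; rewrite lerDl.
  rewrite RintegralZl//; last exact: integrableR_norm.
  by rewrite mulrC -ler_pdivlMr ?ltr_wpDl// ltW.
Unshelve. all: by end_near. Qed.

End weak_star_criterion.

(** * Integrals of piecewise constant fields *)

Section lattice_fields.
Context {R : realType} {d : nat}.
Local Notation T := 'rV[R]_d.
Local Notation V := 'rV[int]_d.
Local Notation lam := (@lebesgue_rV R d).
Implicit Types (e s : R) (k p : V) (I : {fset V}) (h : V -> R) (Q : set T).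

Lemma pc_extE N e (u : T -> 'rV[R]_N) x : pc_ext e u x = u (e *: intv (corner e x)).
Proof. by rewrite /pc_ext; congr u; apply/rowP => i; rewrite !mxE. Qed.

Lemma measurable_corner e h : 0 < e -> measurable_fun setT (fun x : T => h (corner e x)).
Proof.
move=> e0 _ Y mY; rewrite setTI.
have -> : (fun x : T => h (corner e x)) @^-1` Y =
    \bigcup_(k in [set: V]) (if pselect (Y (h k)) then gcell e k else set0).
  apply/seteqP; split=> [x Yx|x [k _]].
    by exists (corner e x) => //; case: pselect => //= _; exact: gcell_corner.
  by case: pselect => //= Yk /(gcellP _ _ e0) xk; rewrite /= xk.
apply: countable_bigcupT_measurable; first exact: countableP.
by move=> k; case: pselect => /= _; [exact: measurable_gcell|exact: measurable0].
Qed.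

Lemma fine_lebesgue_diff A Q : measurable A -> measurable Q -> A `<=` Q -> (lam Q < +oo)%E ->
  fine (lam Q) = fine (lam A) + fine (lam (Q `\` A)).
Proof.
move=> mA mQ AQ Q1; have mD : measurable (Q `\` A) by exact: measurableD.
rewrite -[LHS]mul1r -[fine (lam A)]mul1r -[fine (lam (Q `\` A))]mul1r -!(Rintegral_cst lam)//.
by apply: Rintegral_diff => //; exact: integrableR_cst.
Qed.

Lemma integrable_corner e h (M : R) Q : 0 < e -> measurable Q -> (lam Q < +oo)%E ->
  (forall x, Q x -> `|h (corner e x)| <= M) -> integrableR Q (fun x => h (corner e x)).
Proof.
move=> e0 mQ Q1 hM; apply: integrableR_bounded hM => //.
exact: measurable_funTS (measurable_corner _ e0).
Qed.

Lemma cells_lty e I : 0 < e -> (lam (cells e I) < +oo)%E.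
Proof. by move=> e0; rewrite lebesgue_cells// ltry. Qed.

Lemma Rintegral_cells_corner e I h : 0 < e ->
  \int[lam]_(x in cells e I) h (corner e x) = e ^+ d * \sum_(k <- I) h k.
Proof.
move=> e0; have mc : measurable (cells e I) by exact: measurable_cells.
rewrite -(sum_cells (I := I) e0 mc); last by move=> k kI x kx; exists k.
  rewrite mulr_sumr; apply: eq_big_seq => k kI.
  rewrite (@eq_Rintegral _ _ _ _ _ (cst (h k))) => [|x /set_mem/(gcellP _ _ e0) ->//].
  have mk : measurable (gcell e k) by exact: measurable_gcell.
  by rewrite Rintegral_cst// fine_lebesgue_gcell// mulrC.
apply: (@integrable_corner _ _ (\sum_(k <- I) `|h k|)) => //; first exact: cells_lty.
move=> x [k /= kI /(gcellP _ _ e0) ->].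
by rewrite (big_fsetD1 k)//= lerDl; exact: sumr_ge0.
Qed.

Lemma box_sub_gcell e s p n k : 0 < e ->
  (forall i, s * (k ord0 i)%:~R <= e * (p ord0 i)%:~R) ->
  (forall i, e * (p ord0 i + n%:Z)%:~R <= s * (k ord0 i + 1)%:~R) ->
  cells e (box p n) `<=` gcell s k.
Proof.
move=> e0 sp pn x [q /= /in_boxP qp qx] i.
have /andP[p1 p2] := qp i; have /andP[q1 q2] := qx i; have := sp i; have := pn i.
move: q1 q2; rewrite !mxE => q1 q2 pn1 sp1.
have p1' : e * (p ord0 i)%:~R <= e * (q ord0 i)%:~R by rewrite ler_pM2l// ler_int.
have p2' : e * (q ord0 i + 1)%:~R <= e * (p ord0 i + n%:Z)%:~R.
  by rewrite ler_pM2l// ler_int lezD1.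
move: p2' pn1; rewrite !intrD !mulrDr !mulr1 => p2' pn1.
move: p1' p2' pn1 sp1 q1 q2.
move: (e * (p ord0 i)%:~R) (e * (q ord0 i)%:~R) (s * (k ord0 i)%:~R) (e * n%:Z%:~R) => a b c f.
move: (x ord0 i) => y; clear; move=> *; apply/andP; split; lra.
Qed.

Lemma lebesgue_block e p n : 0 < e -> fine (lam (cells e (box p n))) = (e * n%:R) ^+ d.
Proof. by move=> e0; rewrite lebesgue_cells//= card_box natrX exprMn mulrC. Qed.

Lemma block_integral e p n h Q : 0 < e -> measurable Q -> (lam Q < +oo)%E ->
  (forall x, Q x -> `|h (corner e x)| <= 1) -> cells e (box p n) `<=` Q ->
  `|\int[lam]_(x in Q) h (corner e x) - e ^+ d * \sum_(k <- box p n) h k| <=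
  fine (lam Q) - (e * n%:R) ^+ d.
Proof.
move=> e0 mQ Q1 h1 bQ; have mb : measurable (cells e (box p n)) by exact: measurable_cells.
have Ih : integrableR Q (fun x => h (corner e x)) by exact: integrable_corner h1.
rewrite (Rintegral_diff mb mQ bQ Ih) Rintegral_cells_corner// addrC addKr.
rewrite (fine_lebesgue_diff mb mQ bQ Q1) lebesgue_block// addrC addKr.
have mD : measurable (Q `\` cells e (box p n)) by exact: measurableD.
rewrite -[leRHS]mul1r; apply: le_norm_Rintegral_bound => //.
- by apply: le_lt_trans Q1; apply: le_measure; rewrite ?inE// => x [].
- by apply: integrableR_sub Ih => // x [].
- by move=> x [Qx _]; exact: h1.
Qed.

End lattice_fields.

(** * Lipschitz minorants *)

Section minorant.
Context {R : realType} {N : nat}.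
Local Notation E := 'rV[R]_N.
Context (f : E -> R) (M : R) (fM : forall z, uball z -> `|f z| <= M).
Context (f_lsc : forall z e, uball z -> 0 < e -> exists2 del, 0 < del &
  forall y, uball y -> `|y - z| < del -> f z <= f y + e).
Implicit Types (z y w : E) (L : R).

(* The Pasch-Hausdorff (Lipschitz) regularisation of [f] on the unit ball. *)
Definition minorant L z : R := inf [set f w + L * `|z - w| | w in uball].

Let uball0 : @uball R N 0. Proof. by rewrite /uball /= enorm0. Qed.

Let ne L z : [set f w + L * `|z - w| | w in uball] !=set0.
Proof. by exists (f 0 + L * `|z - 0|), 0. Qed.

Let M0 : 0 <= M. Proof. exact: le_trans (fM uball0). Qed.

Let lb L z : 0 <= L -> lbound [set f w + L * `|z - w| | w in uball] (- M).
Proof.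
move=> L0 _ [w wB <-]; apply: (@le_trans _ _ (f w)); last by rewrite lerDl mulr_ge0.
by have := fM wB; rewrite ler_norml => /andP[].
Qed.

Lemma minorant_ge L z : 0 <= L -> - M <= minorant L z.
Proof. by move=> L0; apply: lb_le_inf; [exact: ne|exact: lb]. Qed.

Lemma minorant_le L z : 0 <= L -> uball z -> minorant L z <= f z.
Proof.
move=> L0 zB; apply: ge_inf; first by exists (- M); exact: lb.
by exists z => //; rewrite subrr normr0 mulr0 addr0.
Qed.

Lemma minorant_lipschitz L z y : 0 <= L -> minorant L z <= minorant L y + L * `|z - y|.
Proof.
move=> L0; rewrite -lerBlDr; apply: lb_le_inf; first exact: ne.
move=> _ [w wB <-]; rewrite lerBlDr.
apply: (@le_trans _ _ (f w + L * `|z - w|)).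
  by apply: ge_inf; [exists (- M); exact: lb|exists w].
rewrite -addrA lerD2l -mulrDr; apply: ler_wpM2l => //.
rewrite (_ : z - w = (y - w) + (z - y)); first exact: ler_normD.
by rewrite [RHS]addrC subrKA.
Qed.

(** Points w within [del] of z are controlled by semicontinuity; for the others the penalty is at
    least 2M once j >= 2M/[del], which outweighs any gain in f. *)
Lemma minorant_cvg z : uball z -> minorant j%:R z @[j --> \oo] --> f z.
Proof.
move=> zB; apply/cvgrPdist_le => e e0; have [del del0 Hd] := f_lsc zB e0.
near=> j; have jd : 2 * M / del <= j%:R by near: j; exact: nbhs_infty_ger.
have L0 : 0 <= j%:R :> R by [].
rewrite ger0_norm ?subr_ge0 ?minorant_le// lerBlDr -lerBlDl.
apply: lb_le_inf; first exact: ne.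
move=> _ [w wB <-]; rewrite lerBlDl.
have [wz|wz] := ltP `|w - z| del.
  apply: le_trans (Hd w wB wz) _; rewrite addrC lerD2l lerDl mulr_ge0//.
have := fM zB; have := fM wB; rewrite !ler_norml => /andP[a1 a2] /andP[b1 b2].
have : 2 * M <= j%:R * `|z - w|.
  rewrite distrC; apply: (@le_trans _ _ (j%:R * del)); last exact: ler_wpM2l.
  by rewrite -ler_pdivrMr.
move: (j%:R * _) => c; clear -a1 b2 e0; lra.
Unshelve. all: by end_near. Qed.

Lemma measurable_lipschitz (g : E -> R) L : (forall z y, g z <= g y + L * `|z - y|) ->
  measurable_fun setT g.
Proof.
move=> gL; apply: (measurability (@RGenOInfty.G R)).
  exact: RGenOInfty.measurableE.
move=> _ [_ [a ->] <-]; rewrite setTI; apply: open_measurable_rV.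
rewrite openE => z /=; rewrite in_itv /= andbT => az.
have L1 : 0 < `|L| + 1 by rewrite ltr_wpDl.
apply/nbhs_ballP; exists ((g z - a) / (`|L| + 1)); first by rewrite /= divr_gt0 ?subr_gt0.
move=> y; rewrite -ball_normE /ball_ /= (ltr_pdivlMr _ _ L1) => zy.
rewrite in_itv /= andbT; have := gL z y.
have : L * `|z - y| <= `|z - y| * (`|L| + 1).
  by rewrite mulrC ler_wpM2l// (le_trans (ler_norm L))// lerDl.
move: zy; move: (_ * _) (L * _) => b c b1 b2 b3; clear -b1 b2 b3; lra.
Qed.

Lemma measurable_minorant L : 0 <= L -> measurable_fun setT (minorant L).
Proof. by move=> L0; apply: (@measurable_lipschitz _ L) => z y; exact: minorant_lipschitz. Qed.

Context {d : nat} (Omega : set 'rV[R]_d) (mO : measurable Omega).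
Local Notation lam := (@lebesgue_rV R d).
Context (O1 : (lam Omega < +oo)%E) (u : 'rV[R]_d -> E).
Context (mu : measurable_fun Omega u) (uB : forall x, Omega x -> uball (u x)).

(** A pointwise limit of Lipschitz functions of u. *)
Lemma measurable_lsc_comp : measurable_fun Omega (fun x => f (u x)).
Proof.
apply: (@measurable_fun_cvg _ _ _ _ (fun j x => minorant j%:R (u x))).
  by move=> j; apply: measurableT_comp mu; exact: measurable_minorant.
by move=> x Ox; exact/minorant_cvg/uB.
Qed.

Lemma integrable_lsc_comp : integrableR Omega (fun x => f (u x)).
Proof.
by apply: (integrableR_bounded mO O1 measurable_lsc_comp (M := M)) => x Ox; exact/fM/uB.
Qed.

Lemma minorant_bounded L z : 0 <= L -> uball z -> `|minorant L z| <= M.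
Proof.
move=> L0 zB; rewrite ler_norml minorant_ge//= (le_trans (minorant_le L0 zB))//.
by rewrite (le_trans (ler_norm _))// fM.
Qed.

Lemma integrable_minorant_comp L : 0 <= L -> integrableR Omega (fun x => minorant L (u x)).
Proof.
move=> L0; apply: (integrableR_bounded mO O1 _ (M := M)) => [|x Ox].
  by apply: measurableT_comp mu; exact: measurable_minorant.
by apply: minorant_bounded => //; exact: uB.
Qed.

Lemma integral_minorant_ge e : 0 < e -> exists2 L, 0 <= L &
  \int[lam]_(x in Omega) f (u x) - e <= \int[lam]_(x in Omega) minorant L (u x).
Proof.
move=> e0.
have H : \int[lam]_(x in Omega) minorant j%:R (u x) @[j --> \oo] -->
    \int[lam]_(x in Omega) f (u x).
  apply: fine_cvg; rewrite fineK; last exact: integrable_fin_num integrable_lsc_comp.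
  apply: (@dominated_cvg _ _ _ lam Omega mO (fun j x => (minorant j%:R (u x))%:E)
    (fun x => (f (u x))%:E) (fun=> M%:E)).
  - by move=> j; have /integrableP[] := integrable_minorant_comp (ler0n R j).
  - by move=> x Ox; apply: cvg_EFin; [exact: nearW|exact/minorant_cvg/uB].
  - by [].
  - exact: integrableR_cst.
  - by move=> j x Ox; rewrite lee_fin; apply: minorant_bounded => //; exact: uB.
have /cvgrPdist_le/(_ e e0)[j _ /(_ j (leqnn j))] := H.
rewrite ler_distl => /andP[_ ?]; exists j%:R => //; by rewrite lerBlDr.
Qed.

Lemma integrable_coord_comp i : integrableR Omega (fun x => u x ord0 i).
Proof.
apply: (integrableR_bounded mO O1 _ (M := 1)) => [|x Ox].
  exact: (measurableT_comp (measurable_coord i) mu).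
by apply: le_trans (abs_coord_le_enorm _ _) _; exact: uB.
Qed.

End minorant.

(** * The lower bound *)

Section small_scales.
Context {R : realType}.

Lemma near_small (P : R -> Prop) :
  (exists2 s0, 0 < s0 & forall s, 0 < s -> s <= s0 -> P s) -> \forall s \near 0^'+, P s.
Proof.
move=> [s0 s00 H]; near=> s; apply: H; first by near: s; exact: nbhs_right_gt.
by near: s; exact: nbhs_right_le.
Unshelve. all: by end_near. Qed.

Lemma near_small_seq (e : nat -> R) (P : R -> Prop) : (forall j, 0 < e j) -> e @ \oo --> 0 ->
  (exists2 s0, 0 < s0 & forall s, 0 < s -> s <= s0 -> P s) -> \forall j \near \oo, P (e j).
Proof.
move=> e0 e_cvg [s0 s00 H]; have /cvgr0Pnorm_le/(_ s0 s00) H1 := e_cvg.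
near=> j; apply: H => //; apply: le_trans (ler_norm _) _.
by near: j.
Unshelve. all: by end_near. Qed.

End small_scales.

Section ball_means.
Context {R : realType} {d N : nat}.
Local Notation E := 'rV[R]_N.
Local Notation lam := (@lebesgue_rV R d).

Lemma integrableR_sum (I : Type) (r : seq I) (f : I -> 'rV[R]_d -> R) (q : set 'rV[R]_d) :
  measurable q -> (lam q < +oo)%E -> (forall i, integrableR q (f i)) ->
  integrableR q (fun x => \sum_(i <- r) f i x).
Proof.
move=> mq q1 If; elim: r => [|i r IH].
  rewrite (_ : (fun x => _) = cst 0); first exact: integrableR_cst.
  by apply/funext => x; rewrite big_nil.
rewrite (_ : (fun x => _) = (fun x => f i x + \sum_(i <- r) f i x)).
  exact: integrableRD.
by apply/funext => x; rewrite big_cons.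
Qed.

Lemma Rintegral_sum (I : Type) (r : seq I) (f : I -> 'rV[R]_d -> R) (q : set 'rV[R]_d) :
  measurable q -> (lam q < +oo)%E -> (forall i, integrableR q (f i)) ->
  \int[lam]_(x in q) (\sum_(i <- r) f i x) = \sum_(i <- r) \int[lam]_(x in q) f i x.
Proof.
move=> mq q1 If; elim: r => [|i r IH].
  rewrite big_nil (@eq_Rintegral _ _ _ _ _ (cst 0)) => [|x _]; last by rewrite big_nil.
  by rewrite Rintegral_cst// mul0r.
rewrite big_cons -IH -RintegralD//; [|exact: If|exact: integrableR_sum].
by apply: eq_Rintegral => x _; rewrite big_cons.
Qed.

Lemma enorm_le1 (z : E) : dotv z z <= enorm z -> enorm z <= 1.
Proof.
move=> zz; have [//|z1] := leP (enorm z) 1.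
have : enorm z * 1 < enorm z * enorm z by rewrite ltr_pM2l// (lt_trans _ z1).
by rewrite mulr1 -expr2 sqr_enorm ltNge zz.
Qed.

Definition vmean (q : set 'rV[R]_d) (u : 'rV[R]_d -> E) : E := \row_i mean q (fun x => u x ord0 i).

(** For the mean z, |z|^2 is the mean of z . u, which is at most |z| as |u| <= 1. *)
Lemma uball_vmean q u : measurable q -> (lam q < +oo)%E -> 0 < fine (lam q) ->
  measurable_fun q u -> (forall x, q x -> uball (u x)) -> uball (vmean q u).
Proof.
move=> mq q1 q0 mu uB; rewrite /uball /=; set z := vmean q u.
have Iu i : integrableR q (fun x => u x ord0 i) by exact: integrable_coord_comp.
have Izu i : integrableR q (fun x => z ord0 i * u x ord0 i) by exact: integrableRZ.
apply: enorm_le1 => //.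
have -> : dotv z z = (fine (lam q))^-1 * \int[lam]_(x in q) \sum_(i < N) z ord0 i * u x ord0 i.
  rewrite Rintegral_sum// mulr_sumr; apply: eq_bigr => i _.
  rewrite RintegralZl//; last exact: Iu.
  by rewrite mulrCA; congr (_ * _); rewrite /z mxE.
rewrite ler_pdivrMl// mulrC -(Rintegral_cst lam mq).
apply: le_Rintegral => //; [exact: integrableR_sum|exact: integrableR_cst|].
move=> x qx; apply: le_trans (dotv_le_enorm z (u x)) _.
by rewrite -[leRHS]mulr1; apply: ler_wpM2l; [exact: enorm_ge0|exact: uB].
Qed.

End ball_means.

(** * Boxes in the cells of a fixed grid *)

Section slots.
Context {R : realType} {d : nat}.
Local Notation V := 'rV[int]_d.
Implicit Types (e s : R) (k : V) (r : nat).

(** The mesh s need not be a multiple of e. Of the r + 1 lattice units given up, one pays for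
    rounding the corner up and r for the gap to the next box. *)
Definition slot_size r e s : nat := Num.truncn (s / e) - r.+1.

Definition slot_corner e s k : V := \row_i Num.ceil (s * (k ord0 i)%:~R / e).

Lemma slot_size_ge r e s : 0 < e -> 0 < s -> s - e * r.+2%:R <= e * (slot_size r e s)%:R.
Proof.
move=> e0 s0; have se : 0 <= s / e by rewrite divr_ge0// ltW.
have /andP[_ t2] := truncn_itv se.
have : s / e <= (slot_size r e s)%:R + r.+2%:R.
  by apply/ltW/(lt_le_trans t2); rewrite -natrD ler_nat /slot_size; lia.
rewrite ler_pdivrMr// lerBlDr; move/le_trans; apply.
by rewrite mulrC mulrDr.
Qed.

Lemma slot_size_le r e s : 0 < e -> 0 < s -> e * r.+1%:R <= s ->
  e * (slot_size r e s + r.+1)%:R <= s.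
Proof.
move=> e0 s0 ers; have se : 0 <= s / e by rewrite divr_ge0// ltW.
have /andP[t1 _] := truncn_itv se.
have r1 : (r.+1 <= Num.truncn (s / e))%N by rewrite -ltnS -(ltr_nat R) (le_lt_trans _ (truncnS_gt _))// ler_pdivlMr// mulrC.
by rewrite subnK// mulrC -ler_pdivlMr.
Qed.

Lemma slot_sub_gcell r e s k : 0 < e -> 0 < s -> e * r.+1%:R <= s ->
  cells e (box (slot_corner e s k) (slot_size r e s)) `<=` gcell s k.
Proof.
move=> e0 s0 ers; apply: box_sub_gcell => // i; rewrite mxE.
  by rewrite -ler_pdivrMl// mulrC ceil_ge.
have := slot_size_le e0 s0 ers; move: (slot_size _ _ _) => n.
have := ceilB1_lt (s * (k ord0 i)%:~R / e); rewrite ltr_pdivlMr// [_ * e]mulrC.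
move: (Num.ceil _) => c; move: (k ord0 i) => b; rewrite !intrD !natrD -natr1 intrN !mulrDr !mulr1 mulrN1.
have : 0 <= e * r%:R by rewrite mulr_ge0// ltW.
rewrite -[n%:Z%:~R]/(n%:R : R).
move: (e * r%:R) (e * c%:~R) (e * n%:R) (s * b%:~R) => a1 a2 a3 a4; clear.
lra.
Qed.

Lemma slot_gap r e s k k' i : 0 < e -> 0 < s -> e * r.+1%:R <= s -> k ord0 i < k' ord0 i ->
  slot_corner e s k ord0 i + (slot_size r e s + r)%N%:Z <= slot_corner e s k' ord0 i.
Proof.
move=> e0 s0 ers kk; rewrite !mxE; have := slot_size_le e0 s0 ers.
move: (slot_size _ _ _) => n nr.
have := ceilB1_lt (s * (k ord0 i)%:~R / e); have := ceil_ge (s * (k' ord0 i)%:~R / e).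
rewrite ltr_pdivlMr// ler_pdivrMr// -![_ * e]mulrC => c1 c2.
have kk1 : s * (k ord0 i + 1)%:~R <= s * (k' ord0 i)%:~R by rewrite ler_pM2l// ler_int lezD1.
rewrite ltW// -(ltr_int R) -(ltr_pM2l e0).
move: c1 c2 kk1 nr; move: (Num.ceil (s * (k' ord0 i)%:~R / e)) (Num.ceil (s * (k ord0 i)%:~R / e)) => c' c.
move: (k ord0 i) (k' ord0 i) => b b'.
rewrite addnS -natr1 !intrD intrN !mulrDr !mulr1 mulrN1 -[(n + r)%N%:Z%:~R]/((n + r)%:R : R).
rewrite !natrD mulrDr; move: (e * c%:~R) (e * c'%:~R) (e * n%:R) (e * r%:R) => a1 a2 a3 a4.
move: (s * b%:~R) (s * b'%:~R) => a5 a6; clear -e0 s0.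
lra.
Qed.

Lemma slot_spaced r e s (I : seq V) : 0 < e -> 0 < s -> e * r.+1%:R <= s ->
  spaced (slot_corner e s) (slot_size r e s) r I.
Proof.
by move=> e0 s0 ers; apply: spaced_of_gap => k k' i; exact: slot_gap.
Qed.

Lemma slot_size_cvg r s (e : nat -> R) : (forall j, 0 < e j) -> e @ \oo --> 0 -> 0 < s ->
  e j * (slot_size r (e j) s)%:R @[j --> \oo] --> s.
Proof.
move=> e0 e_cvg s0.
have H : \forall j \near \oo, e j * r.+1%:R <= s.
  apply: near_small_seq (fun x => x * r.+1%:R <= s) e0 e_cvg _.
  by exists (s / r.+1%:R) => [|x x0]; [exact: divr_gt0|rewrite ler_pdivlMr].
apply: (@squeeze_cvgr _ _ _ _ (fun j => s - e j * r.+2%:R) (cst s)).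
- near=> j; rewrite slot_size_ge//=.
  apply: le_trans (slot_size_le (e0 j) s0 _); last by near: j; exact: H.
  by rewrite ler_pM2l// ler_nat leq_addr.
- rewrite -[X in _ --> X]subr0; apply: cvgB; first exact: cvg_cst.
  by rewrite -(mul0r r.+2%:R); apply: cvgMl.
- exact: cvg_cst.
Unshelve. all: by end_near. Qed.

End slots.

Section cvg_helpers.
Context {R : realType}.

Lemma cvg_close (a b c : nat -> R) (l : R) : a @ \oo --> l -> c @ \oo --> 0 ->
  (\forall j \near \oo, `|a j - b j| <= c j) -> b @ \oo --> l.
Proof.
move=> al c0 H; apply: (@squeeze_cvgr _ _ _ _ (fun j => a j - c j) (fun j => a j + c j)).
- near=> j; have : `|a j - b j| <= c j by near: j.
  by rewrite ler_norml; move=> /andP[? ?]; apply/andP; split; lra.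
- by rewrite -[l]subr0; exact: cvgB.
- by rewrite -[l]addr0; exact: cvgD.
Unshelve. all: by end_near. Qed.

Lemma cvg_natpow (a : nat -> R) (l : R) n : a @ \oo --> l -> a j ^+ n @[j --> \oo] --> l ^+ n.
Proof.
move=> al; elim: n => [|n IH].
  rewrite expr0 (_ : (fun j => _) = cst 1); first exact: cvg_cst.
  by apply/funext => j; rewrite expr0.
rewrite exprS (_ : (fun j => _) = (fun j => a j * a j ^+ n)); first exact: cvgM.
by apply/funext => j; rewrite exprS.
Qed.

Lemma sumr_const_size (K : Type) (J : seq K) (c : R) : \sum_(k <- J) c = (size J)%:R * c.
Proof. by rewrite big_const_seq count_predT iter_addr_0 mulr_natl. Qed.

Lemma near_seq (K : eqType) (P : K -> nat -> Prop) (J : seq K) :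
  (forall k, k \in J -> \forall j \near \oo, P k j) ->
  \forall j \near \oo, forall k, k \in J -> P k j.
Proof.
elim: J => [|k J IH] H; first by near=> j.
have H1 : \forall j \near \oo, forall k, k \in J -> P k j.
  by apply: IH => k' kJ; apply: H; rewrite inE kJ orbT.
have H2 := H k (mem_head _ _).
near=> j => k'; rewrite inE => /orP[/eqP->|]; first by near: j; exact: H2.
by move: k'; near: j; exact: H1.
Unshelve. all: by end_near. Qed.

End cvg_helpers.

Section lower_bound.
Context {R : realType} {d N : nat} (d0 : (0 < d)%N) (hN : (2 <= N)%N).
Context (D : lattice_density R d N).
Local Notation V := 'rV[int]_d.
Local Notation E := 'rV[R]_N.
Local Notation lam := (@lebesgue_rV R d).
Local Notation H X w := (pair_energy (ld_range D) (ld_fun D) X w).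
Local Notation C := (pair_cost (ld_range D) (ld_bound D)).
Local Notation r := (ld_radius D).
Context (Omega : set 'rV[R]_d) (oO : open Omega) (bO : bounded_set Omega).
Context (nullO : lam (closure Omega) = lam Omega).
Context (u : 'rV[R]_d -> E) (mu : measurable_fun Omega u).
Context (uB : forall x, Omega x -> uball (u x)).
Context (e : nat -> R) (e0 : forall j, 0 < e j) (e_cvg : e @ \oo --> 0).
Context (w : nat -> V -> E) (wS : forall j, sphere_valued (w j)).

Lemma uball_average (p : V) n (v : V -> E) : sphere_valued v ->
  uball ((n ^ d)%:R^-1 *: \sum_(k <- box p n) v k).
Proof.
move=> vS; rewrite /uball /= enormZ ger0_norm ?invr_ge0//.
have : enorm (\sum_(k <- box p n) v k) <= (n ^ d)%:R.
  apply: le_trans (enorm_sum _ _ _) _; under eq_bigr do rewrite vS.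
  by rewrite big_const_seq count_predT iter_addr_0 -(card_box p n).
move: (enorm _) => a; case: (n ^ d)%N => [|q aq]; first by rewrite invr0 mul0r.
by rewrite ler_pdivrMl ?mulr1.
Qed.

Let mO : measurable Omega. Proof. exact: open_measurable_rV. Qed.
Let O1 : (lam Omega < +oo)%E. Proof. exact: bounded_lebesgue_lty. Qed.

Lemma field_coord_le1 j i (x : 'rV[R]_d) : `|w j (corner (e j) x) ord0 i| <= 1.
Proof. by apply: le_trans (abs_coord_le_enorm _ _) _; rewrite (wS j). Qed.

Context (w_cvg : forall i Q, measurable Q -> Q `<=` Omega ->
  \int[lam]_(x in Q) w j (corner (e j) x) ord0 i @[j --> \oo] --> \int[lam]_(x in Q) u x ord0 i).

(** The box fills the fixed cell up to a volume that tends to 0, so the averages of the field over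
    it converge to the mean of u by weak convergence. Then [phi_le] at these averages and the
    semicontinuity of [phi] at the mean conclude. *)
Lemma cell_lower s k eta : 0 < s -> gcell s k `<=` Omega -> 0 < eta ->
  \forall j \near \oo, s ^+ d * (phi D (vmean (gcell s k) u) - eta) <=
    e j ^+ d * H (box (slot_corner (e j) s k) (slot_size r (e j) s)) (w j).
Proof.
move=> s0 QO eta0; set Q := gcell s k; set z := vmean Q u.
have mQ : measurable Q by exact: measurable_gcell.
have Q1 : (lam Q < +oo)%E by exact: gcell_lty.
have lQ : fine (lam Q) = s ^+ d by exact: fine_lebesgue_gcell.
have sd : 0 < s ^+ d by rewrite exprn_gt0.
have zB : uball z.
  apply: uball_vmean => //; first by rewrite lQ.
  - exact: measurable_funS mu.
  - by move=> x /QO; exact: uB.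
have eta2 : 0 < eta / 2 by rewrite divr_gt0.
have [del del0 Hd] := phi_lsc d0 hN D zB eta2.
pose n j := slot_size r (e j) s; pose p j := slot_corner (e j) s k.
pose av j : E := (n j ^ d)%:R^-1 *: \sum_(q <- box (p j) (n j)) w j q.
have n_cvg : e j * (n j)%:R @[j --> \oo] --> s by exact: slot_size_cvg.
have nd_cvg : (e j * (n j)%:R) ^+ d @[j --> \oo] --> s ^+ d by exact: cvg_natpow.
have H0 : \forall j \near \oo, e j * r.+1%:R <= s.
  apply: (near_small_seq (P := fun x => x * r.+1%:R <= s) e0 e_cvg).
  by exists (s / r.+1%:R) => [|x x0]; [exact: divr_gt0|rewrite ler_pdivlMr].
have sum_cvg i : e j ^+ d * \sum_(q <- box (p j) (n j)) w j q ord0 i @[j --> \oo]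
    --> s ^+ d * z ord0 i.
  have -> : s ^+ d * z ord0 i = \int[lam]_(x in Q) u x ord0 i.
    by rewrite (Rintegral_mean (q := Q)) ?lQ// /z mxE.
  pose b j := e j ^+ d * \sum_(q <- box (p j) (n j)) w j q ord0 i.
  suff : b @ \oo --> \int[lam]_(x in Q) u x ord0 i by [].
  apply: (@cvg_close _ _ _ (fun j => s ^+ d - (e j * (n j)%:R) ^+ d) _ (@w_cvg i Q mQ QO)).
    by rewrite -(subrr (s ^+ d)); apply: cvgB => //; exact: cvg_cst.
  near=> j; rewrite -lQ; apply: (block_integral (h := fun q => w j q ord0 i)) => //.
    by move=> x _; exact: field_coord_le1.
  apply: slot_sub_gcell => //; near: j; exact: H0.
have av_cvg i : av j ord0 i @[j --> \oo] --> z ord0 i.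
  have -> : z ord0 i = (s ^+ d)^-1 * (s ^+ d * z ord0 i) by rewrite mulrA mulVf ?mul1r// gt_eqF.
  rewrite (_ : (fun j => _) = (fun j => ((e j * (n j)%:R) ^+ d)^-1 *
    (e j ^+ d * \sum_(q <- box (p j) (n j)) w j q ord0 i))).
    by apply: cvgM (sum_cvg i); apply: cvgV nd_cvg; rewrite gt_eqF.
  apply/funext => j; rewrite /av mxE summxE exprMn natrX invfM.
  have ej : e j ^+ d != 0 by rewrite gt_eqF// exprn_gt0.
  by rewrite mulrACA mulVf// mul1r.
have H1 : \forall j \near \oo, `|av j - z| < del.
  have H2 : \forall j \near \oo, forall i, `|z ord0 i - av j ord0 i| <= del / 2.
    by apply: filter_forall => i; apply: cvgr_dist_le => //; rewrite divr_gt0.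
  near=> j; apply: (@le_lt_trans _ _ (del / 2)); last by rewrite gtr_pMr// invf_lt1// ltr1n.
  apply: norm_leP => [|i]; first by rewrite ltW// divr_gt0.
  have -> : (av j - z) ord0 i = av j ord0 i - z ord0 i by rewrite [LHS]mxE [X in _ + X]mxE.
  by rewrite distrC; move: i; near: j; exact: H2.
pose c := phi D z - eta / 2.
have a_cvg : (e j * (n j)%:R) ^+ d * (c - phi_rate D * (e j * (e j * (n j)%:R)^-1)) @[j --> \oo]
    --> s ^+ d * c.
  apply: cvgM => //; rewrite -[X in _ --> X]subr0; apply: cvgB; first exact: cvg_cst.
  rewrite -(mulr0 (phi_rate D)); apply: cvgMr; rewrite -(mul0r s^-1).
  by apply: cvgM => //; apply: cvgV n_cvg; rewrite gt_eqF.
have H3 : s ^+ d * (phi D z - eta) < s ^+ d * c.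
  by rewrite ltr_pM2l// /c ltrD2l ltrN2 gtr_pMr// invf_lt1// ltr1n.
have H4 := cvgr_ge _ a_cvg _ H3.
have H5 := cvgr_gt _ n_cvg _ s0.
near=> j.
have n0 : 0 < e j * (n j)%:R by near: j; exact: H5.
have n1 : (0 < n j)%N by move: n0; rewrite pmulr_rgt0// ltr0n.
apply: (@le_trans _ _ ((e j * (n j)%:R) ^+ d * (c - phi_rate D * (e j * (e j * (n j)%:R)^-1)))).
  by near: j; exact: H4.
have -> : e j ^+ d * H (box (p j) (n j)) (w j) =
    (e j * (n j)%:R) ^+ d * (H (box (p j) (n j)) (w j) / (n j ^ d)%:R).
  rewrite exprMn natrX mulrCA -[in RHS]mulrA mulrCA; congr (_ * _).
  by rewrite mulfV ?mulr1// expf_neq0// pnatr_eq0 -lt0n.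
have -> : e j / (e j * (n j)%:R) = (n j)%:R^-1.
  by rewrite invfM mulrA mulfV ?mul1r// gt_eqF.
rewrite ler_pM2l ?exprn_gt0// /c.
have avB : averages (p j) (n j) (av j) (w j).
  split; first exact: wS.
  by rewrite /av scalerA mulfV ?scale1r// pnatr_eq0 expn_eq0 negb_and -lt0n n1.
have := phi_le hN D n1 avB.
have : phi D z <= phi D (av j) + eta / 2.
  apply: Hd; first exact/uball_average/wS.
  by near: j; exact: H1.
move: (phi D z) (phi D (av j)) (_ / (n j ^ d)%:R) (_ / (n j)%:R) => f1 f2 f3 f4 h1 h2; lra.
Unshelve. all: by end_near. Qed.

Lemma in_lattice (ep : R) (k : V) : 0 < ep ->
  (k \in fset_set (lattice_in ep Omega)) = (ep *: intv k \in Omega).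
Proof. by move=> ep0; rewrite in_fset_set; last exact: finite_lattice_in; apply/idP/idP; rewrite !inE. Qed.

Lemma boxes_lattice (ep s : R) (P : V -> V) n : 0 < ep -> 0 < s ->
  (forall k, k \in inner_grid s Omega -> cells ep (box (P k) n) `<=` gcell s k) ->
  (boxes P n (inner_grid s Omega) `<=` fset_set (lattice_in ep Omega))%fset.
Proof.
move=> ep0 s0 PO; apply/fsubsetP => q /in_boxesP[k kI qk].
rewrite in_lattice// inE; have /(inner_gridP _ s0 bO) kO := kI.
apply: kO; apply: PO => //; exists q => //=.
by apply/(gcellP _ _ ep0); rewrite corner_intv.
Qed.

Lemma lattice_count_near eta : 0 < eta -> \forall j \near \oo,
  e j ^+ d * #|` fset_set (lattice_in (e j) Omega)|%:R <= fine (lam Omega) + eta.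
Proof.
move=> eta0; have [s0 s00 H] := lattice_count bO eta0.
apply: (near_small_seq (P := fun x => x ^+ d * #|` fset_set (lattice_in x Omega)|%:R <=
  fine (lam Omega) + eta) e0 e_cvg).
exists s0 => // s sp ss0; have := H s sp ss0; rewrite nullO mulrC.
by rewrite -[lam Omega]fineK ?ge0_fin_numE// -EFinD lee_fin.
Qed.

Lemma card_inner_grid s : 0 < s ->
  #|` inner_grid s Omega|%:R * s ^+ d = fine (lam Omega) - fine (lam (Omega `\` cells s (inner_grid s Omega))).
Proof.
move=> s0; rewrite (fine_lebesgue_diff _ mO (inner_cells_sub s0 bO) O1); last exact: measurable_cells.
by rewrite addrK lebesgue_cells.
Qed.

(** The lattice points outside the boxes have scaled number at most |Omega minus the cells| + 2 eta:
    one eta from the count of all lattice points, one because the boxes do not quite fill their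
    cells. *)
Lemma grid_lower s eta : 0 < s -> 0 < eta -> \forall j \near \oo,
  \sum_(k <- inner_grid s Omega) s ^+ d * (phi D (vmean (gcell s k) u) - eta) -
    C * (fine (lam (Omega `\` cells s (inner_grid s Omega))) + 2 * eta) <=
  e j ^+ d * H (fset_set (lattice_in (e j) Omega)) (w j).
Proof.
move=> s0 eta0; set I := inner_grid s Omega.
pose n j := slot_size r (e j) s; pose P j (k : V) := slot_corner (e j) s k.
have n_cvg : e j * (n j)%:R @[j --> \oo] --> s by exact: slot_size_cvg.
have nd_cvg : #|` I|%:R * (e j * (n j)%:R) ^+ d @[j --> \oo] --> #|` I|%:R * s ^+ d.
  by apply: cvgMr; exact: cvg_natpow.
have H0 : \forall j \near \oo, e j * r.+1%:R <= s.
  apply: (near_small_seq (P := fun x => x * r.+1%:R <= s) e0 e_cvg).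
  by exists (s / r.+1%:R) => [|x x0]; [exact: divr_gt0|rewrite ler_pdivlMr].
have H1 : \forall j \near \oo, forall k, k \in I ->
    s ^+ d * (phi D (vmean (gcell s k) u) - eta) <= e j ^+ d * H (box (P j k) (n j)) (w j).
  by apply: near_seq => k /(inner_gridP _ s0 bO) kO; exact: cell_lower.
have H2 := lattice_count_near eta0.
have H3 : \forall j \near \oo, #|` I|%:R * s ^+ d - eta <= #|` I|%:R * (e j * (n j)%:R) ^+ d.
  by apply: (cvgr_ge _ nd_cvg); rewrite ltrBlDr ltrDl.
near=> j.
have ers : e j * r.+1%:R <= s by near: j; exact: H0.
have sp : spaced (P j) (n j) r I by exact: slot_spaced.
have sub : (boxes (P j) (n j) I `<=` fset_set (lattice_in (e j) Omega))%fset.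
  by apply: boxes_lattice => // k _; exact: slot_sub_gcell.
have := pair_energy_sub (ld_range D) (@ld_funM _ _ _ D) (wS j) sub.
rewrite (pair_energy_boxes (ld_fun D) (w j) (@ld_rangeP _ _ _ D) (fset_uniq I) sp).
rewrite (card_boxes (fset_uniq I) sp) natrM natrX -/(#|` I|).
move=> /ler_normlP[+ _]; rewrite opprB lerBlDr => HX.
have ed : 0 <= e j ^+ d by rewrite exprn_ge0// ltW.
have := ler_wpM2l ed HX; rewrite mulrDr mulr_sumr [X in _ <= X + _]mulrCA mulrBr.
have -> : e j ^+ d * (#|` I|%:R * (n j)%:R ^+ d) = #|` I|%:R * (e j * (n j)%:R) ^+ d.
  by rewrite exprMn mulrCA.
move=> {}HX; rewrite lerBlDr.
have S1 : \sum_(k <- I) s ^+ d * (phi D (vmean (gcell s k) u) - eta) <=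
    \sum_(k <- I) e j ^+ d * H (box (P j k) (n j)) (w j).
  rewrite big_seq [leRHS]big_seq; apply: ler_sum => k kI.
  by move: k kI; near: j; exact: H1.
apply: le_trans S1 _; apply: le_trans HX _; rewrite addrC lerD2l.
apply: ler_wpM2l; first exact: pair_cost_ge0.
have C1 : e j ^+ d * #|` fset_set (lattice_in (e j) Omega)|%:R <= fine (lam Omega) + eta.
  by near: j; exact: H2.
have C2 : #|` I|%:R * s ^+ d - eta <= #|` I|%:R * (e j * (n j)%:R) ^+ d by near: j; exact: H3.
have := card_inner_grid s0; rewrite -/I.
move: C1 C2; move: (fine _) (fine _) (_ * _) (_ * _) (_ * _) => a1 a2 a3 a4 a5.
by move=> *; lra.
Unshelve. all: by end_near. Qed.

Lemma cell_mean_ge (g : E -> R) (L M : R) (A : set 'rV[R]_d) : 0 <= L -> measurable A ->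
  (lam A < +oo)%E -> 0 < fine (lam A) -> A `<=` Omega ->
  (forall z y, g z <= g y + L * `|z - y|) -> integrableR A (fun x => g (u x)) ->
  \int[lam]_(x in A) g (u x) - L * \sum_(i < N) dev A (fun x => u x ord0 i) <=
  fine (lam A) * g (vmean A u).
Proof.
move=> L0 mA A1 lA AO gL Ig.
have muA : measurable_fun A u by exact: measurable_funS mu.
have Iu i : integrableR A (fun x => u x ord0 i).
  by apply: integrable_coord_comp => // x /AO; exact: uB.
have Id i : integrableR A (fun x => `|u x ord0 i - mean A (fun x => u x ord0 i)|).
  by apply: integrable_dev.
have Is := integrableR_sum (index_enum 'I_N) mA A1 Id.
rewrite /dev -Rintegral_sum// -RintegralZl// lerBlDr mulrC -(Rintegral_cst lam mA).
have Ic := integrableR_cst mA A1 (g (vmean A u)).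
rewrite -RintegralD//; last exact: integrableRZ.
apply: le_Rintegral => //; first by apply: integrableRD => //; exact: integrableRZ.
move=> x Ax; apply: le_trans (gL _ (vmean A u)) _; rewrite lerD2l; apply: ler_wpM2l => //.
apply: norm_leP => [|i]; first exact: sumr_ge0.
have -> : (u x - vmean A u) ord0 i = u x ord0 i - mean A (fun x => u x ord0 i).
  by rewrite [LHS]mxE [X in _ + X]mxE mxE.
by rewrite (bigD1 i)//= lerDl; exact: sumr_ge0.
Qed.

Let Mphi := C + phi_rate D.

Let phiM z : uball z -> `|phi D z| <= Mphi.
Proof. by move=> zB; exact: phi_bounded. Qed.

(** One third of eta each for replacing [phi] by its Lipschitz minorant, for the oscillation of u
    about its means, and for the part of [Omega] outside the inner cells. *)
Lemma grid_sum_ge eta : 0 < eta -> \forall s \near 0^'+,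
  \int[lam]_(x in Omega) phi D (u x) - eta <=
  \sum_(k <- inner_grid s Omega) s ^+ d * phi D (vmean (gcell s k) u).
Proof.
move=> eta0; have eta3 : 0 < eta / 3 by rewrite divr_gt0.
have [L L0 HL] := integral_minorant_ge phiM (phi_lsc d0 hN D) mO O1 mu uB eta3.
pose g := minorant (phi D) L.
have Ig : integrableR Omega (fun x => g (u x)).
  exact: (integrable_minorant_comp phiM mO O1 mu uB L0).
have gM z : uball z -> `|g z| <= Mphi by exact: (minorant_bounded phiM L0).
have Iu i : integrableR Omega (fun x => u x ord0 i) by exact: integrable_coord_comp.
pose K := L * N%:R + 1; have K0 : 0 < K by rewrite ltr_wpDl// mulr_ge0.
have eK : 0 < eta / 3 / K by rewrite divr_gt0.
have M1 : 0 < `|Mphi| + 1 by rewrite ltr_wpDl.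
have eM : 0 < eta / 3 / (`|Mphi| + 1) by rewrite divr_gt0.
have H1 : \forall s \near 0^'+, forall i, osc Omega s (fun x => u x ord0 i) <= eta / 3 / K.
  by apply: filter_forall => i; apply: near_small; exact: osc_cvg.
have H2 := near_small (inner_exhaustion oO bO eM).
near=> s; have s0 : 0 < s by near: s; exact: nbhs_right_gt.
have H2s : (lam (Omega `\` cells s (inner_grid s Omega)) <= (eta / 3 / (`|Mphi| + 1))%:E)%E.
  by near: s; exact: H2.
set I := inner_grid s Omega.
have IO k : k \in I -> gcell s k `<=` Omega by move=> /(inner_gridP _ s0 bO).
have mc : measurable (cells s I) by exact: measurable_cells.
have cO : cells s I `<=` Omega by exact: inner_cells_sub.
have B1 : \sum_(k <- I) (\int[lam]_(x in gcell s k) g (u x) -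
    L * \sum_(i < N) dev (gcell s k) (fun x => u x ord0 i)) <=
    \sum_(k <- I) s ^+ d * phi D (vmean (gcell s k) u).
  rewrite big_seq [leRHS]big_seq; apply: ler_sum => k kI.
  have mQ : measurable (gcell s k) by exact: measurable_gcell.
  have Q1 : (lam (gcell s k) < +oo)%E by exact: gcell_lty.
  have lQ : fine (lam (gcell s k)) = s ^+ d by exact: fine_lebesgue_gcell.
  have sd : 0 < s ^+ d by rewrite exprn_gt0.
  apply: (@le_trans _ _ (s ^+ d * g (vmean (gcell s k) u))).
    rewrite -lQ; apply: cell_mean_ge => //; [by rewrite lQ|exact: IO| |].
      by move=> z y; exact: (minorant_lipschitz phiM).
    by apply: integrableR_sub Ig => //; exact: IO.
  apply: ler_wpM2l; first exact: ltW.
  apply: (minorant_le phiM) => //; apply: uball_vmean => //; first by rewrite lQ.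
    by apply: measurable_funS mu => //; exact: IO.
  by move=> x /(IO _ kI); exact: uB.
apply: le_trans B1; rewrite sumrB (sum_cells s0 mO Ig IO) -mulr_sumr exchange_big /=.
have H1s : forall i, osc Omega s (fun x => u x ord0 i) <= eta / 3 / K by near: s; exact: H1.
have B2 : L * \sum_(i < N) \sum_(k <- I) dev (gcell s k) (fun x => u x ord0 i) <= eta / 3.
  apply: (@le_trans _ _ (L * \sum_(i < N) (eta / 3 / K))).
    apply: ler_wpM2l => //; apply: ler_sum => i _.
    exact: H1s.
  have -> : L * \sum_(i < N) (eta / 3 / K) = L * N%:R * (eta / 3 / K).
    by move: (eta / 3 / K) => q; rewrite sumr_const card_ord -[q *+ N]mulr_natl mulrA.
  apply: (@le_trans _ _ (K * (eta / 3 / K))); last by rewrite mulrC divfK// gt_eqF.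
  by apply: ler_wpM2r; [exact: ltW|rewrite /K lerDl].
have B3 : `|\int[lam]_(x in Omega `\` cells s I) g (u x)| <= eta / 3.
  have mD : measurable (Omega `\` cells s I) by exact: measurableD.
  have D1 : (lam (Omega `\` cells s I) < +oo)%E.
    by apply: le_lt_trans O1; apply: le_measure; rewrite ?inE// => x [].
  apply: le_trans (le_norm_Rintegral_bound mD D1 _ (M := `|Mphi| + 1) _) _.
  - by apply: integrableR_sub Ig => // x [].
  - move=> x [Ox _]; apply: le_trans (gM _ (uB Ox)) _.
    by apply: le_trans (ler_norm _) _; rewrite lerDl.
  rewrite mulrC -ler_pdivlMr//.
  by rewrite -lee_fin fineK// ge0_fin_numE// (le_lt_trans H2s)// ltry.
have := Rintegral_diff mc mO cO Ig; move: HL B2 B3; rewrite -/g ler_norml.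
move: (\int[lam]_(x in Omega) g (u x)) (\int[lam]_(x in Omega) phi D (u x)) => a1 a2.
move: (\int[lam]_(x in cells s I) g (u x)) (\int[lam]_(x in _ `\` _) g (u x)) => a3 a4.
move: (L * _) => a5 h1 h2 /andP[h3 h4] h5; lra.
Unshelve. all: by end_near. Qed.

Lemma energy_lower eta : 0 < eta -> \forall j \near \oo,
  \int[lam]_(x in Omega) phi D (u x) - eta <=
  e j ^+ d * H (fset_set (lattice_in (e j) Omega)) (w j).
Proof.
move=> eta0; have C0 : 0 <= C by exact: pair_cost_ge0.
(* A tolerance t costs 3Ct for the lattice points outside the boxes and |Omega| t inside the cells.
   The mesh s is fixed with t before j tends to infinity. *)
pose K := 3 * C + fine (lam Omega) + 1.
have K0 : 0 < K.
  have : 0 <= fine (lam Omega) by exact: fine_ge0.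
  by rewrite /K; move: (fine _) => a a0; lra.
pose t := eta / 2 / K; have t0 : 0 < t by rewrite !divr_gt0.
have tK : t * K = eta / 2 by rewrite /t divfK// gt_eqF.
have eta2 : 0 < eta / 2 by rewrite divr_gt0.
have H1 := grid_sum_ge eta2.
have H2 := near_small (inner_exhaustion oO bO t0).
have [s [s0 [Hs1 Hs2]]] : exists s, 0 < s /\
    (\int[lam]_(x in Omega) phi D (u x) - eta / 2 <=
     \sum_(k <- inner_grid s Omega) s ^+ d * phi D (vmean (gcell s k) u) /\
    (lam (Omega `\` cells s (inner_grid s Omega)) <= t%:E)%E).
  apply: (@filter_ex _ (0 : R)^'+); near=> s; split; first by near: s; exact: nbhs_right_gt.
  by split; near: s; [exact: H1|exact: H2].
have H3 := grid_lower s0 t0.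
near=> j; have H3j : \sum_(k <- inner_grid s Omega) s ^+ d * (phi D (vmean (gcell s k) u) - t) -
    C * (fine (lam (Omega `\` cells s (inner_grid s Omega))) + 2 * t) <=
  e j ^+ d * H (fset_set (lattice_in (e j) Omega)) (w j) by near: j; exact: H3.
apply: le_trans H3j; apply: (@le_trans _ _ (\int[lam]_(x in Omega) phi D (u x) - eta / 2 - t * K)).
  by rewrite tK; lra.
have h1 : fine (lam (Omega `\` cells s (inner_grid s Omega))) <= t.
  by rewrite -lee_fin fineK// ge0_fin_numE// (le_lt_trans Hs2)// ltry.
have -> : \sum_(k <- inner_grid s Omega) s ^+ d * (phi D (vmean (gcell s k) u) - t) =
    \sum_(k <- inner_grid s Omega) s ^+ d * phi D (vmean (gcell s k) u) -
    #|` inner_grid s Omega|%:R * s ^+ d * t.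
  under eq_bigr do rewrite mulrBr; rewrite sumrB; congr (_ - _).
  by rewrite sumr_const_size mulrA.
have h2 : #|` inner_grid s Omega|%:R * s ^+ d * t <= fine (lam Omega) * t.
  apply: ler_wpM2r; first exact: ltW.
  by rewrite card_inner_grid// gerBl fine_ge0.
have h3 : C * (fine (lam (Omega `\` cells s (inner_grid s Omega))) + 2 * t) <= C * (3 * t).
  by apply: ler_wpM2l => //; lra.
have -> : t * K = C * (3 * t) + fine (lam Omega) * t + t.
  by rewrite /K; move: (fine _) => a; rewrite !mulrDr mulr1 [t * a]mulrC mulrCA mulrA mulrAC [3 * C]mulrC -mulrA.
move: Hs1 h2 h3; move: (C * (3 * t)) (C * _) (fine _ * t) (_ * t) (\sum_(k <- _) _) => a1 a2 a3 a4 a5.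
move: (\int[lam]_(x in Omega) _) => a6; lra.
Unshelve. all: by end_near. Qed.

End lower_bound.

(** * The upper bound *)

(** For a cell of volume g containing a block of volume f: t is the integral of a coordinate of the
    field over the cell, a its average on the block and b the target value. *)
Lemma block_estimate (R : realType) (t a b f g tau : R) : 0 <= tau -> `|t - f * a| <= g - f ->
  `|a - b| <= tau -> `|b| <= 1 -> f <= g -> 0 <= f -> `|t - g * b| <= 2 * (g - f) + g * tau.
Proof.
move=> tau0 B av1 z1 fg f0.
have X1 : `|f * (a - b)| <= f * tau by rewrite normrM ger0_norm// ler_wpM2l.
have X2 : `|(g - f) * b| <= g - f.
  by rewrite normrM ger0_norm ?subr_ge0// -[leRHS]mulr1 ler_wpM2l// subr_ge0.
have X3 : f * tau <= g * tau by rewrite ler_wpM2r.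
have -> : t - g * b = (t - f * a) + (f * (a - b) - (g - f) * b) by ring.
apply: le_trans (ler_normD _ _) _; have := ler_normB (f * (a - b)) ((g - f) * b).
lra.
Qed.

(** * Boxes in the cells of a grid adapted to the scale *)

Section mesh.
Context {R : realType} {d : nat} (ep : R) (ep0 : 0 < ep) (n r : nat) (n0 : (0 < n)%N).
Local Notation V := 'rV[int]_d.
Implicit Types k : V.

(** Here the grid may depend on the scale; a multiple of [ep] lets each cell hold a box of side n
    and a gap of width r without rounding. *)
Definition mesh : R := ep * (n + r)%:R.

Lemma mesh_gt0 : 0 < mesh. Proof. by rewrite mulr_gt0// ltr0n addn_gt0 n0. Qed.

Definition mesh_corner (k : V) : V := (n + r)%N%:Z *: k.

Lemma mesh_sub_gcell k : cells ep (box (mesh_corner k) n) `<=` gcell mesh k.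
Proof.
apply: box_sub_gcell => // i; rewrite coordZ /mesh -mulrA.
  by rewrite intrM.
rewrite !intrD intrM -[(n + r)%N%:Z%:~R]/((n + r)%:R : R) -[n%:Z%:~R]/(n%:R : R).
rewrite ler_pM2l// mulrDr mulr1 lerD2l natrD lerDl//.
Qed.

Lemma mesh_gap k k' i : k ord0 i < k' ord0 i ->
  mesh_corner k ord0 i + (n + r)%N%:Z <= mesh_corner k' ord0 i.
Proof.
rewrite !coordZ -lezD1 => kk; rewrite -[X in _ + X]mulr1 -mulrDr.
by apply: ler_wpM2l.
Qed.

Lemma mesh_spaced (I : seq V) : spaced mesh_corner n r I.
Proof. by apply: spaced_of_gap => k k' i; exact: mesh_gap. Qed.

Lemma mesh_slot k q : q \in box (mesh_corner k) n ->
  \row_i (q ord0 i %/ (n + r)%N%:Z)%Z = k.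
Proof.
move=> /in_boxP qk; apply/rowP => i; rewrite mxE.
have := qk i; rewrite coordZ => qi; rewrite -[X in (X %/ _)%Z]subr0.
by apply: (divz_slot (n := n)); rewrite ?add0r ?leq_addr.
Qed.

End mesh.

Section one_scale.
Context {R : realType} {d N : nat} (d0 : (0 < d)%N) (hN : (2 <= N)%N).
Context (D : lattice_density R d N).
Local Notation V := 'rV[int]_d.
Local Notation E := 'rV[R]_N.
Local Notation lam := (@lebesgue_rV R d).
Local Notation H X w := (pair_energy (ld_range D) (ld_fun D) X w).
Local Notation C := (pair_cost (ld_range D) (ld_bound D)).
Local Notation r := (ld_radius D).
Context (Omega : set 'rV[R]_d) (oO : open Omega) (bO : bounded_set Omega).
Context (u : 'rV[R]_d -> E) (mu : measurable_fun Omega u).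
Context (uB : forall x, Omega x -> uball (u x)).

Let mO : measurable Omega. Proof. exact: open_measurable_rV. Qed.
Let O1 : (lam Omega < +oo)%E. Proof. exact: bounded_lebesgue_lty. Qed.

Let phiM z : uball z -> `|phi D z| <= C + phi_rate D.
Proof. by move=> zB; exact: phi_bounded. Qed.

Lemma integrable_phi : integrableR Omega (fun x => phi D (u x)).
Proof. exact: (integrable_lsc_comp phiM (phi_lsc d0 hN D) mO O1 mu uB). Qed.

(** If F exceeded its mean by [slack] everywhere, so would its integral. The slack keeps the
    contradiction at the level of non-strict comparison of integrals. *)
Lemma exists_le_average (q : set 'rV[R]_d) (F : 'rV[R]_d -> R) (slack : R) : measurable q ->
  (lam q < +oo)%E -> 0 < fine (lam q) -> integrableR q F -> 0 < slack ->
  exists2 x, q x & fine (lam q) * F x <= \int[lam]_(x in q) F x + fine (lam q) * slack.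
Proof.
move=> mq q1 q0 IF slack0; apply: contrapT => nex.
have FM x : q x -> mean q F + slack <= F x.
  move=> qx; rewrite leNgt; apply/negP => Fx; apply: nex; exists x => //.
  by rewrite (Rintegral_mean (q := q))// -mulrDr ler_pM2l// ltW.
have : \int[lam]_(x in q) (mean q F + slack) <= \int[lam]_(x in q) F x.
  by apply: le_Rintegral => //; exact: integrableR_cst.
rewrite Rintegral_cst// (Rintegral_mean (q := q))// mulrC ler_pM2l// gerDl.
by rewrite leNgt slack0.
Qed.

Context (ep : R) (ep0 : 0 < ep) (n : nat) (n0 : (0 < n)%N) (tau Lam slack : R).
Context (tau0 : 0 <= tau) (Lam0 : 0 <= Lam) (slack0 : 0 < slack).
Context (patterns : forall (z : E) (p : V), uball z -> exists w : V -> E, [/\ sphere_valued w,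
  `|(n ^ d)%:R^-1 *: \sum_(k <- box p n) w k - z| <= tau &
  H (box p n) w / (n ^ d)%:R <= phi D z + tau]).

Local Notation s := (mesh ep n r).
Local Notation mesh_corner := (mesh_corner n r).
Local Notation I := (inner_grid s Omega).
Local Notation m k i := (mean (gcell s k) (fun x => u x ord0 i)).

(** The target z of a cell is a value u(x) for which phi(u(x)) + [Lam] |u(x) - mean| is at most its
    average over the cell plus [slack]. The penalty keeps z near the mean, which governs weak
    convergence. *)
Lemma mesh_fields : exists (w : V -> E) (z : V -> E), [/\ sphere_valued w,
  forall k, k \in I -> uball (z k),
  forall k, k \in I -> s ^+ d * (phi D (z k) + Lam * \sum_(i < N) `|z k ord0 i - m k i|) <=
    \int[lam]_(x in gcell s k) phi D (u x) +
    Lam * \sum_(i < N) dev (gcell s k) (fun x => u x ord0 i) + s ^+ d * slack,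
  forall k, k \in I -> H (box (mesh_corner k) n) w / (n ^ d)%:R <= phi D (z k) + tau &
  forall k i, k \in I -> `|\int[lam]_(x in gcell s k) w (corner ep x) ord0 i - s ^+ d * z k ord0 i| <=
    2 * (s ^+ d - (ep * n%:R) ^+ d) + s ^+ d * tau].
Proof.
have s0 : 0 < s by exact: mesh_gt0.
have [c cS] := exists_usphere hN (R := R).
have /choice[zw zwP] : forall k : V, exists zw : E * (V -> E), sphere_valued zw.2 /\
    (k \in I -> [/\ uball zw.1,
      s ^+ d * (phi D zw.1 + Lam * \sum_(i < N) `|zw.1 ord0 i - m k i|) <=
        \int[lam]_(x in gcell s k) phi D (u x) +
        Lam * \sum_(i < N) dev (gcell s k) (fun x => u x ord0 i) + s ^+ d * slack,
      `|(n ^ d)%:R^-1 *: \sum_(q <- box (mesh_corner k) n) zw.2 q - zw.1| <= tau &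
      H (box (mesh_corner k) n) zw.2 / (n ^ d)%:R <= phi D zw.1 + tau]).
  move=> k; have [kI|kI] := boolP (k \in I); last first.
    by exists (0, fun=> c); split=> //; move: kI => /negP.
  have /(inner_gridP _ s0 bO) kO := kI.
  have mQ : measurable (gcell s k) by exact: measurable_gcell.
  have Q1 : (lam (gcell s k) < +oo)%E by exact: gcell_lty.
  have lQ : fine (lam (gcell s k)) = s ^+ d by exact: fine_lebesgue_gcell.
  have sd : 0 < s ^+ d by rewrite exprn_gt0.
  have muQ : measurable_fun (gcell s k) u by exact: measurable_funS mu.
  have Iu i : integrableR (gcell s k) (fun x => u x ord0 i).
    by apply: integrable_coord_comp => // x /kO; exact: uB.
  have Id i : integrableR (gcell s k) (fun x => `|u x ord0 i - m k i|) by exact: integrable_dev.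
  have Is := integrableR_sum (index_enum 'I_N) mQ Q1 Id.
  have Iphi : integrableR (gcell s k) (fun x => phi D (u x)).
    exact: integrableR_sub integrable_phi.
  have IF := integrableRD mQ Iphi (integrableRZ mQ Lam Is).
  have [|x Qx Fx] := exists_le_average mQ Q1 _ IF slack0; first by rewrite lQ.
  have uxB : uball (u x) by exact/uB/kO.
  have [v [vS v1 v2]] := patterns (mesh_corner k) uxB.
  exists (u x, v); split => // _; split => //=.
  move: Fx; rewrite lQ RintegralD//; last exact: integrableRZ.
  by rewrite RintegralZl// Rintegral_sum.
pose slot (q : V) : V := \row_i (q ord0 i %/ (n + r)%N%:Z)%Z.
(* All cells are glued into one field: a lattice point uses the pattern chosen for its slot, and in
   the gaps any unit values will do. *)
pose w q := (zw (slot q)).2 q.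
have wE k q : q \in box (mesh_corner k) n -> w q = (zw k).2 q.
  by move=> qk; rewrite /w /slot (mesh_slot qk).
have wS : sphere_valued w by move=> q; exact: (zwP (slot q)).1.
exists w, (fun k => (zw k).1); split => //.
- by move=> k kI; have [] := (zwP k).2 kI.
- by move=> k kI; have [] := (zwP k).2 kI.
- move=> k kI; rewrite (eq_pair_energy _ _ (wE k)).
  by have [] := (zwP k).2 kI.
move=> k i kI; have [zB _ zt _] := (zwP k).2 kI; set z := (zw k).1.
have mQ : measurable (gcell s k) by exact: measurable_gcell.
have Q1 : (lam (gcell s k) < +oo)%E by exact: gcell_lty.
have lQ : fine (lam (gcell s k)) = s ^+ d by exact: fine_lebesgue_gcell.
have h1 x : gcell s k x -> `|w (corner ep x) ord0 i| <= 1.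
  by move=> _; apply: le_trans (abs_coord_le_enorm _ _) _; rewrite wS.
have := block_integral (h := fun q => w q ord0 i) ep0 mQ Q1 h1 (mesh_sub_gcell ep0 (k := k)).
rewrite lQ => B.
pose av := (n ^ d)%:R^-1 *: \sum_(q <- box (mesh_corner k) n) (zw k).2 q.
have S1 : ep ^+ d * \sum_(q <- box (mesh_corner k) n) w q ord0 i = (ep * n%:R) ^+ d * av ord0 i.
  have -> : \sum_(q <- box (mesh_corner k) n) w q ord0 i =
      (\sum_(q <- box (mesh_corner k) n) (zw k).2 q) ord0 i.
    by rewrite summxE; apply: eq_big_seq => q /wE ->.
  rewrite exprMn -mulrA; congr (_ * _); rewrite /av mxE natrX mulrA mulfV ?mul1r//.
  by rewrite expf_neq0// pnatr_eq0 -lt0n.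
have av1 : `|av ord0 i - z ord0 i| <= tau.
  apply: le_trans zt; have -> : av ord0 i - z ord0 i = (av - z) ord0 i.
    by rewrite [RHS]mxE [X in _ = _ + X]mxE.
  exact: abs_coord_le_norm.
have z1 : `|z ord0 i| <= 1 by apply: le_trans (abs_coord_le_enorm _ _) zB.
have en : (ep * n%:R) ^+ d <= s ^+ d.
  rewrite lerXn2r ?nnegrE ?mulr_ge0 ?(ltW ep0) ?(ltW s0)//.
  by rewrite /mesh ler_pM2l// ler_nat leq_addr.
have en0 : 0 <= (ep * n%:R) ^+ d by rewrite exprn_ge0// mulr_ge0// ltW.
rewrite S1 in B; move: B av1 z1 en en0.
move: (\int[lam]_(x in _) _) (av ord0 i) (z ord0 i) ((ep * n%:R) ^+ d) (s ^+ d) => t a b f g.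
exact: (block_estimate tau0).
Qed.

Local Notation L := (fine (lam Omega)).
Local Notation A := (fine (lam (Omega `\` cells s I))).
Local Notation osc1 := (\sum_(i < N) osc Omega s (fun x => u x ord0 i)).
Local Notation f := ((ep * n%:R) ^+ d).
Local Notation gap := (#|` I|%:R * (s ^+ d - f)).
Local Notation Mphi := (C + phi_rate D).
Local Notation X := (fset_set (lattice_in ep Omega)).

(** [dist] is the total distance of the targets from the means. Since |phi| <= [Mphi], the selection
    inequality also bounds [Lam] times [dist]: the factor 3 counts the integral over [Omega], its
    part outside the cells and the sum over the targets. *)
Lemma mesh_estimate : exists w : V -> E, [/\ sphere_valued w,
  ep ^+ d * H X w <= \int[lam]_(x in Omega) phi D (u x) + Mphi * A + Lam * osc1 + L * slack +
    L * tau + Mphi * gap + C * (ep ^+ d * #|` X|%:R - #|` I|%:R * f) &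
  exists2 dist, Lam * dist <= 3 * (Mphi * L) + Lam * osc1 + L * slack &
  forall i, \sum_(k <- I)
      `|\int[lam]_(x in gcell s k) (w (corner ep x) ord0 i - u x ord0 i)| <=
    2 * gap + L * tau + dist].
Proof.
have s0 : 0 < s by exact: mesh_gt0.
have [w [z [wS zB zphi zH zint]]] := mesh_fields.
have Iphi := integrable_phi.
have IO k : k \in I -> gcell s k `<=` Omega by move=> /(inner_gridP _ s0 bO).
have mc : measurable (cells s I) by exact: measurable_cells.
have cO : cells s I `<=` Omega by exact: inner_cells_sub.
have cardI : #|` I|%:R * s ^+ d = L - A by exact: card_inner_grid.
have A0 : 0 <= A by exact: fine_ge0.
have cardIL : #|` I|%:R * s ^+ d <= L by rewrite cardI gerBl.
have f0 : 0 <= f by rewrite exprn_ge0// mulr_ge0// ltW.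
have fs : f <= s ^+ d.
  rewrite lerXn2r ?nnegrE ?mulr_ge0 ?(ltW ep0) ?(ltW s0)//.
  by rewrite /mesh ler_pM2l// ler_nat leq_addr.
have Mphi0 : 0 <= Mphi by apply: le_trans (phiM (uball_average 0 1 wS)).
have sd : 0 <= s ^+ d by exact: le_trans fs.
pose S := \sum_(k <- I) s ^+ d * phi D (z k).
pose dist := \sum_(k <- I) s ^+ d * \sum_(i < N) `|z k ord0 i - m k i|.
have ball_lb y : uball y -> - Mphi <= phi D y <= Mphi by move=> /phiM; rewrite ler_norml.
have S_lb : - (Mphi * L) <= S.
  apply: (@le_trans _ _ (\sum_(k <- I) s ^+ d * - Mphi)).
    by rewrite sumr_const_size mulrA mulrN lerN2 mulrC ler_wpM2l.
  rewrite big_seq [leRHS]big_seq; apply: ler_sum => k kI; apply: ler_wpM2l => //.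
  by have /andP[] := ball_lb _ (zB k kI).
have diff := Rintegral_diff mc mO cO Iphi.
have rest : `|\int[lam]_(x in Omega `\` cells s I) phi D (u x)| <= Mphi * A.
  have mD : measurable (Omega `\` cells s I) by exact: measurableD.
  apply: le_norm_Rintegral_bound => //.
  - by apply: le_lt_trans O1; apply: le_measure; rewrite ?inE// => x [].
  - by apply: integrableR_sub Iphi => // x [].
  - by move=> x [Ox _]; exact/phiM/uB.
have total : `|\int[lam]_(x in Omega) phi D (u x)| <= Mphi * L.
  by apply: le_norm_Rintegral_bound => // x Ox; exact/phiM/uB.
have cell_sum : S + Lam * dist <= \int[lam]_(x in cells s I) phi D (u x) + Lam * osc1 + L * slack.
  have -> : S + Lam * dist =
      \sum_(k <- I) s ^+ d * (phi D (z k) + Lam * \sum_(i < N) `|z k ord0 i - m k i|).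
    rewrite /dist mulr_sumr -big_split /=; apply: eq_bigr => k _.
    by rewrite mulrDr; congr (_ + _); rewrite mulrCA.
  apply: (@le_trans _ _ (\sum_(k <- I) (\int[lam]_(x in gcell s k) phi D (u x) +
    Lam * \sum_(i < N) dev (gcell s k) (fun x => u x ord0 i) + s ^+ d * slack))).
    by rewrite big_seq [leRHS]big_seq; apply: ler_sum => k; exact: zphi.
  rewrite !big_split /= (sum_cells s0 mO Iphi IO) -mulr_sumr exchange_big /=.
  by rewrite lerD2l sumr_const_size mulrA ler_wpM2r// ltW.
exists w; split => //; last first.
  exists dist.
    move: S_lb cell_sum diff rest total; rewrite !ler_norml.
    have : Mphi * A <= Mphi * L by apply: ler_wpM2l => //; rewrite -subr_ge0 -cardI mulr_ge0.
    move: (\int[lam]_(x in Omega) _) (\int[lam]_(x in cells s I) _) (\int[lam]_(x in _ `\` _) _).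
    move: (Mphi * A) (Mphi * L) (Lam * dist) (Lam * osc1) (L * slack) S.
    by move=> x1 x2 x3 x4 x5 x6 a b c h0 h1 h2 h3 /andP[h4 h5] /andP[h6 h7]; lra.
  move=> i; apply: (@le_trans _ _ (\sum_(k <- I) (2 * (s ^+ d - f) + s ^+ d * tau +
      s ^+ d * \sum_(i < N) `|z k ord0 i - m k i|))).
    rewrite big_seq [leRHS]big_seq; apply: ler_sum => k kI.
    have mQ : measurable (gcell s k) by exact: measurable_gcell.
    have Q1 : (lam (gcell s k) < +oo)%E by exact: gcell_lty.
    have lQ : fine (lam (gcell s k)) = s ^+ d by exact: fine_lebesgue_gcell.
    have sd1 : 0 < s ^+ d by rewrite exprn_gt0.
    have muQ : measurable_fun (gcell s k) u by apply: measurable_funS mu => //; exact: IO.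
    have Iu : integrableR (gcell s k) (fun x => u x ord0 i).
      by apply: integrable_coord_comp => // x /(IO k kI); exact: uB.
    have Iw : integrableR (gcell s k) (fun x => w (corner ep x) ord0 i).
      apply: (integrable_corner (h := fun q => w q ord0 i) (M := 1)) => // x _.
      by apply: le_trans (abs_coord_le_enorm _ _) _; rewrite wS.
    have um : \int[lam]_(x in gcell s k) u x ord0 i = s ^+ d * m k i.
      by rewrite (Rintegral_mean (q := gcell s k)) ?lQ.
    rewrite RintegralB// um.
    have := zint k i kI; move: (\int[lam]_(x in gcell s k) _) => a za.
    have -> : a - s ^+ d * m k i = (a - s ^+ d * z k ord0 i) + s ^+ d * (z k ord0 i - m k i).
      by rewrite mulrBr addrA subrK.
    apply: le_trans (ler_normD _ _) _; apply: lerD => //.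
    rewrite normrM (ger0_norm sd); apply: ler_wpM2l => //.
    by rewrite (bigD1 i)//= lerDl; exact: sumr_ge0.
  rewrite !big_split /= -/dist lerD2r; apply: lerD.
    by rewrite sumr_const_size mulrCA.
  by rewrite sumr_const_size mulrA ler_wpM2r.
have sp := @mesh_spaced d n r I.
have sub : (boxes mesh_corner n I `<=` X)%fset.
  by apply: (boxes_lattice bO ep0 s0) => k _; exact: mesh_sub_gcell.
have := pair_energy_sub (ld_range D) (@ld_funM _ _ _ D) wS sub.
rewrite (pair_energy_boxes (ld_fun D) w (@ld_rangeP _ _ _ D) (fset_uniq I) sp).
rewrite (card_boxes (fset_uniq I) sp) natrM natrX -/(#|` I|).
move=> /ler_normlP[_]; rewrite lerBlDl => HX.
have ed : 0 <= ep ^+ d by rewrite exprn_ge0// ltW.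
have := ler_wpM2l ed HX; rewrite mulrDr mulr_sumr [X in _ <= _ + X]mulrCA mulrBr.
have -> : ep ^+ d * (#|` I|%:R * n%:R ^+ d) = #|` I|%:R * f by rewrite exprMn mulrCA.
move=> {}HX; apply: le_trans HX _; rewrite lerD2r.
have S1 : \sum_(k <- I) ep ^+ d * H (box (mesh_corner k) n) w <= S + L * tau + Mphi * gap.
  apply: (@le_trans _ _ (\sum_(k <- I) (s ^+ d * phi D (z k) + s ^+ d * tau + Mphi * (s ^+ d - f)))).
    rewrite big_seq [leRHS]big_seq; apply: ler_sum => k kI.
    have -> : ep ^+ d * H (box (mesh_corner k) n) w = f * (H (box (mesh_corner k) n) w / (n ^ d)%:R).
      rewrite exprMn natrX mulrCA -[in RHS]mulrA mulrCA; congr (_ * _).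
      by rewrite mulfV ?mulr1// expf_neq0// pnatr_eq0 -lt0n.
    apply: (@le_trans _ _ (f * (phi D (z k) + tau))); first by apply: ler_wpM2l => //; exact: zH.
    have /andP[b1 b2] := ball_lb _ (zB k kI).
    (* phi may be negative, so passing from the volume f of the box to that of the cell costs up to
       [Mphi] times the difference. *)
    have : 0 <= (s ^+ d - f) * (phi D (z k) + Mphi).
      by apply: mulr_ge0; rewrite ?subr_ge0// -lerBlDr sub0r.
    have : f * tau <= s ^+ d * tau by apply: ler_wpM2r.
    by move: (phi D (z k)) (s ^+ d) f Mphi => a b x y *; lra.
  by rewrite !big_split /= -/S !sumr_const_size [_ * (Mphi * _)]mulrCA lerD2r lerD2l mulrA ler_wpM2r.
rewrite mulr_sumr; apply: le_trans S1 _; rewrite lerD2r lerD2r.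
have : 0 <= Lam * dist.
  by apply: mulr_ge0 => //; apply: sumr_ge0 => k _; rewrite mulr_ge0// sumr_ge0.
move: cell_sum diff rest; rewrite ler_norml.
move: (\int[lam]_(x in Omega) _) (\int[lam]_(x in cells s I) _) (\int[lam]_(x in _ `\` _) _).
move: (Mphi * A) (Lam * dist) (Lam * osc1) (L * slack).
by move=> x1 x3 x4 x5 a b c h1 h2 /andP[h3 h4] h5; lra.
Qed.

End one_scale.

Section mesh_scale.
Context {R : realType} (r : nat) (e : nat -> R) (e0 : forall j, 0 < e j) (e_cvg : e @ \oo --> 0).

(* Of order e^(-1/2), so that both [mesh_size] tends to infinity and the mesh
   e * mesh_size tends to 0. *)
Definition mesh_size (j : nat) : nat := (Num.truncn (Num.sqrt (e j))^-1).+1.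

Let q j := Num.sqrt (e j).

Let q0 j : 0 < q j. Proof. by rewrite sqrtr_gt0. Qed.

Let qe j : q j ^+ 2 = e j. Proof. by rewrite sqr_sqrtr// ltW. Qed.

Let q_cvg : q @ \oo --> 0.
Proof. by rewrite -[0]sqrtr0; apply: (cvg_comp _ _ e_cvg); exact: sqrt_continuous. Qed.

Let n_itv j : (q j)^-1 <= (mesh_size j)%:R <= (q j)^-1 + 1.
Proof.
have qi0 : 0 <= (q j)^-1 by rewrite invr_ge0 ltW.
have /andP[a b] := truncn_itv qi0.
by rewrite /mesh_size (ltW b) -natr1 lerD2r.
Qed.

Lemma mesh_size_large K : \forall j \near \oo, (K <= mesh_size j)%N.
Proof.
have K1 : 0 < (K.+1%:R : R)^-1 by rewrite invr_gt0.
have /cvgr0Pnorm_le/(_ _ K1) H := q_cvg.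
near=> j; have : `|q j| <= K.+1%:R^-1 by near: j; exact: H.
rewrite ger0_norm ?(ltW (q0 j))// => qK.
rewrite -(ler_nat R); have /andP[+ _] := n_itv j; apply: le_trans.
apply: (@le_trans _ _ K.+1%:R); first by rewrite ler_nat.
by rewrite -[X in X <= _]invrK lef_pV2 ?posrE.
Unshelve. all: by end_near. Qed.

Lemma mesh_cvg : mesh (e j) (mesh_size j) r @[j --> \oo] --> (0 : R).
Proof.
apply: (@squeeze_cvgr _ _ _ _ (fun j => 0) (fun j => q j + (r.+1%:R) * e j)).
- apply: nearW => j; rewrite mulr_ge0 ?(ltW (e0 j))//= /mesh natrD mulrDr.
  have /andP[_ b] := n_itv j; have := ler_wpM2l (ltW (e0 j)) b.
  rewrite mulrDr mulr1 -{2}(qe j) expr2 mulfK ?gt_eqF// -[r.+1%:R]natr1 mulrDl mul1r [r%:R * _]mulrC.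
  by move: (e j * _) (e j * _) => a b'; lra.
- exact: cvg_cst.
- rewrite -[0]addr0; apply: cvgD => //; rewrite -(mulr0 r.+1%:R); exact: cvgMr.
Qed.

Lemma mesh_ratio_cvg d : ((mesh_size j)%:R / (mesh_size j + r)%:R) ^+ d @[j --> \oo] --> (1 : R).
Proof.
suff H : (mesh_size j)%:R / (mesh_size j + r)%:R @[j --> \oo] --> (1 : R).
  have := @cvg_natpow R _ _ d H.
  by rewrite expr1n.
apply: (@squeeze_cvgr _ _ _ _ (fun j => 1 - r%:R * q j) (fun j => 1)).
- apply: nearW => j; have /andP[a _] := n_itv j.
  have n0 : 0 < (mesh_size j)%:R :> R by rewrite ltr0n.
  have nr : 0 < (mesh_size j + r)%:R :> R by rewrite ltr0n addn_gt0.
  rewrite ler_pdivlMr// ler_pdivrMr// mul1r ler_nat leq_addr andbT.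
  rewrite mulrBl mul1r natrD lerBlDr lerD2l -[X in X <= _]mulr1 -mulrA; apply: ler_wpM2l => //.
  have : 1 <= q j * (mesh_size j)%:R by rewrite -ler_pdivrMl// mulr1.
  by move=> h; apply: le_trans h _; rewrite ler_pM2l// lerDl.
- rewrite -[X in _ --> X]subr0; apply: cvgB; first exact: cvg_cst.
  by rewrite -(mulr0 r%:R); exact: cvgMr.
- exact: cvg_cst.
Qed.

End mesh_scale.

Section upper_bound.
Context {R : realType} {d N : nat} (d0 : (0 < d)%N) (hN : (2 <= N)%N).
Context (D : lattice_density R d N).
Local Notation V := 'rV[int]_d.
Local Notation E := 'rV[R]_N.
Local Notation lam := (@lebesgue_rV R d).
Local Notation H X w := (pair_energy (ld_range D) (ld_fun D) X w).
Local Notation C := (pair_cost (ld_range D) (ld_bound D)).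
Local Notation r := (ld_radius D).
Context (Omega : set 'rV[R]_d) (oO : open Omega) (bO : bounded_set Omega).
Context (nullO : lam (closure Omega) = lam Omega).
Context (u : 'rV[R]_d -> E) (mu : measurable_fun Omega u).
Context (uB : forall x, Omega x -> uball (u x)).
Context (e : nat -> R) (e0 : forall j, 0 < e j) (e_cvg : e @ \oo --> 0).

Let mO : measurable Omega. Proof. exact: open_measurable_rV. Qed.
Let O1 : (lam Omega < +oo)%E. Proof. exact: bounded_lebesgue_lty. Qed.

Let s j := mesh (e j) (mesh_size e j) r.
Let s0 j : 0 < s j. Proof. exact: mesh_gt0. Qed.
Let s_cvg : s @ \oo --> 0. Proof. exact: mesh_cvg. Qed.
Let I j := inner_grid (s j) Omega.
Let L := fine (lam Omega).
Let A j := fine (lam (Omega `\` cells (s j) (I j))).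
Let f j := (e j * (mesh_size e j)%:R) ^+ d.
Let gap j := #|` I j|%:R * (s j ^+ d - f j).
Let osc1 j := \sum_(i < N) osc Omega (s j) (fun x => u x ord0 i).
Let Mphi := C + phi_rate D.

Let L0 : 0 <= L. Proof. exact: fine_ge0. Qed.
Let C0 : 0 <= C. Proof. exact: pair_cost_ge0. Qed.
Let Mphi0 : 0 <= Mphi. Proof. by rewrite addr_ge0// phi_rate_ge0. Qed.

Let A_cvg : A @ \oo --> 0.
Proof.
apply/cvgr0Pnorm_le => t t0.
have [s1 s10 H1] := inner_exhaustion oO bO t0.
have H2 : \forall j \near \oo, (lam (Omega `\` cells (s j) (I j)) <= t%:E)%E.
  apply: (near_small_seq (P := fun x => (lam (Omega `\` cells x (inner_grid x Omega)) <= t%:E)%E) s0 s_cvg).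
  by exists s1.
near=> j; rewrite ger0_norm ?fine_ge0//.
have H2j : (lam (Omega `\` cells (s j) (I j)) <= t%:E)%E by near: j; exact: H2.
by rewrite -lee_fin fineK// ge0_fin_numE// (le_lt_trans H2j)// ltry.
Unshelve. all: by end_near. Qed.

Let cardI j : #|` I j|%:R * s j ^+ d = L - A j.
Proof. exact: card_inner_grid. Qed.

(** The fraction of the volume of a cell that its box covers. *)
Let theta j := ((mesh_size e j)%:R / (mesh_size e j + r)%:R) ^+ d : R.

Let theta_cvg : theta @ \oo --> (1 : R). Proof. exact: mesh_ratio_cvg. Qed.

Let gap_le j : gap j <= L * (1 - theta j).
Proof.
have fE : f j = theta j * s j ^+ d.
  rewrite /f /theta /s /mesh -exprMn; congr (_ ^+ d).
  by rewrite mulrCA divfK// pnatr_eq0 -lt0n addn_gt0.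
have th1 : theta j <= 1.
  rewrite /theta exprn_ile1// ?divr_ge0//.
  by rewrite ler_pdivrMr ?ltr0n ?addn_gt0// mul1r ler_nat leq_addr.
rewrite /gap fE -{1}[s j ^+ d]mul1r -mulrBl [(1 - _) * _]mulrC mulrA cardI.
by apply: ler_wpM2r; [rewrite subr_ge0|rewrite gerBl fine_ge0].
Qed.

(** The square leaves room for a penalty 1/t: the oscillation multiplied by it is still at most
    t. *)
Let osc_small t : 0 < t -> exists n0, forall j, (n0 <= j)%N -> osc1 j <= t ^+ 2.
Proof.
move=> t0; have N0 : 0 < N%:R :> R by rewrite ltr0n (leq_trans _ hN).
have t2 : 0 < t ^+ 2 / N%:R by rewrite divr_gt0 ?exprn_gt0.
have H1 : \forall j \near \oo, forall i, osc Omega (s j) (fun x => u x ord0 i) <= t ^+ 2 / N%:R.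
  apply: filter_forall => i.
  apply: (near_small_seq (P := fun x => osc Omega x (fun x => u x ord0 i) <= t ^+ 2 / N%:R) s0 s_cvg).
  by apply: osc_cvg => //; exact: integrable_coord_comp.
have [n0 _ Hn] : \forall j \near \oo, osc1 j <= t ^+ 2.
  near=> j; apply: (@le_trans _ _ (\sum_(i < N) (t ^+ 2 / N%:R))).
    have H1j : forall i, osc Omega (s j) (fun x => u x ord0 i) <= t ^+ 2 / N%:R.
      by near: j; exact: H1.
    by apply: ler_sum => i _; exact: H1j.
  by rewrite sumr_const card_ord -[_ *+ N]mulr_natr divfK// gt_eqF.
by exists n0 => j nj; exact: Hn.
Unshelve. all: by end_near. Qed.

Let mesh_size_cvg : mesh_size e @ \oo --> \oo.
Proof. by apply/cvgnyPge => K; exact: mesh_size_large. Qed.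

Lemma upper_sequence : exists w : nat -> V -> E, [/\ forall j, sphere_valued (w j),
  forall i g, integrableR Omega g ->
    \int[lam]_(x in Omega) (g x * (w j (corner (e j) x) ord0 i - u x ord0 i)) @[j --> \oo] --> 0 &
  forall eta, 0 < eta -> \forall j \near \oo,
    e j ^+ d * H (fset_set (lattice_in (e j) Omega)) (w j) <=
    \int[lam]_(x in Omega) phi D (u x) + eta].
Proof.
have [eta [eta0 eta_cvg eta_osc]] := slow_tolerance osc_small.
(* The tolerance is indexed by the side of the box, and is composed with [mesh_size] below. *)
have [tau1 [tau10 tau1_cvg tau1_pat]] := slow_tolerance (@uniform_patterns R d N d0 hN D).
pose tau j := tau1 (mesh_size e j).
have tau_cvg : tau @ \oo --> 0 by exact: (cvg_comp _ _ mesh_size_cvg tau1_cvg).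
pose pat n t := forall (z : E) (p : V), uball z -> exists w : V -> E, [/\ sphere_valued w,
  `|(n ^ d)%:R^-1 *: \sum_(k <- box p n) w k - z| <= t & H (box p n) w / (n ^ d)%:R <= phi D z + t].
have pat_near : \forall j \near \oo, pat (mesh_size e j) (tau j).
  have [n1 _ Hn1] := tau1_pat; have Hn := mesh_size_large e0 e_cvg n1.
  near=> j; apply: Hn1 => /=; near: j; exact: Hn.
pose X j := fset_set (lattice_in (e j) Omega).
pose err j := 3 * (Mphi * L) + eta j + L * e j.
have /choice[w wP] : forall j, exists w : V -> E, sphere_valued w /\
    (pat (mesh_size e j) (tau j) -> osc1 j <= eta j ^+ 2 ->
     e j ^+ d * H (X j) w <= \int[lam]_(x in Omega) phi D (u x) + Mphi * A j + eta j + L * e j +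
       L * tau j + Mphi * gap j + C * (e j ^+ d * #|` X j|%:R - #|` I j|%:R * f j) /\
     forall i, \sum_(k <- I j)
       `|\int[lam]_(x in gcell (s j) k) (w (corner (e j) x) ord0 i - u x ord0 i)| <=
       2 * gap j + L * tau j + eta j * err j).
  move=> j; have [[pj oj]|nj] := pselect (pat (mesh_size e j) (tau j) /\ osc1 j <= eta j ^+ 2).
    (* The penalty is the inverse of [eta j] and the slack is [e j]. The bound on penalty times
       distance then makes the distance at most [eta j] times the bounded quantity [err j]. *)
    have Lam0 : 0 <= (eta j)^-1 by rewrite invr_ge0 ltW.
    have [w [wS w1 [dist dist1 w2]]] := mesh_estimate d0 hN oO bO mu uB (e0 j) (ltn0Sn _)
      (ltW (tau10 _)) Lam0 (e0 j) pj.
    have Lo : (eta j)^-1 * osc1 j <= eta j.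
      by rewrite ler_pdivrMl// -expr2.
    exists w; split => // _ _; split.
      apply: le_trans w1 _; rewrite !lerD2r -!addrA !lerD2l.
      exact: Lo.
    move=> i; apply: le_trans (w2 i) _; rewrite lerD2l.
    rewrite -ler_pdivrMl//; apply: le_trans dist1 _; rewrite /err lerD2r lerD2l.
    exact: Lo.
  (* Only finitely many j are concerned, so any unit field serves. *)
  have [c cS] := exists_usphere hN (R := R).
  by exists (fun=> c); split=> // p1 p2; case: nj.
have wS j := (wP j).1.
have th_cvg : L * (1 - theta j) @[j --> \oo] --> 0.
  rewrite -(mulr0 L); apply: cvgMr; rewrite -(subrr (1 : R)).
  apply: cvgB; [exact: cvg_cst|exact: theta_cvg].
have Lt_cvg : L * tau j @[j --> \oo] --> 0 by rewrite -(mulr0 L); exact: cvgMr.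
have Le_cvg : L * e j @[j --> \oo] --> 0 by rewrite -(mulr0 L); exact: cvgMr.
exists w; split => //.
- move=> i g Ig.
  apply: (cvg_Rintegral_mul oO bO (d := fun j x => w j (corner (e j) x) ord0 i - u x ord0 i)
    (s := s) (M := 2)) => //.
  + move=> j; apply: measurable_funB; last exact: (measurableT_comp (measurable_coord i) mu).
    by apply: measurable_funTS; exact: (@measurable_corner _ _ _ (fun q => w j q ord0 i)).
  + move=> j x Ox; apply: le_trans (ler_normB _ _) _; rewrite -[2]/(1 + 1 : R); apply: lerD.
      by apply: le_trans (abs_coord_le_enorm _ _) _; rewrite (wS j).
    by apply: le_trans (abs_coord_le_enorm _ _) _; exact: uB.
  + have b_cvg : 2 * (L * (1 - theta j)) + L * tau j + eta j * err j @[j --> \oo] --> 0.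
      rewrite -[0]addr0; apply: cvgD.
        rewrite -[0]addr0; apply: cvgD => //.
        by rewrite -(mulr0 2); exact: cvgMr.
      rewrite -(mul0r (3 * (Mphi * L) + 0 + 0)); apply: cvgM => //.
      apply: cvgD => //; apply: cvgD => //; exact: cvg_cst.
    apply: (@squeeze_cvgr _ _ _ _ (fun j => 0) _) b_cvg; last exact: cvg_cst.
    near=> j; rewrite sumr_ge0//=.
    have pj : pat (mesh_size e j) (tau j) by near: j; exact: pat_near.
    have oj : osc1 j <= eta j ^+ 2 by near: j; exact: eta_osc.
    have [_ Hj] := (wP j).2 pj oj; apply: le_trans (Hj i) _; rewrite lerD2r lerD2r.
    by apply: ler_wpM2l => //; exact: gap_le.
- move=> t t0; have C1 : 0 < C + 1 by rewrite ltr_wpDl.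
  have t2 : 0 < t / 2 by rewrite divr_gt0.
  have t3 : 0 < t / 2 / (C + 1) by rewrite divr_gt0.
  have H1 := lattice_count_near oO bO nullO e0 e_cvg t3.
  have b_cvg : (Mphi + C) * A j + eta j + L * e j + L * tau j + (Mphi + C) * (L * (1 - theta j))
      @[j --> \oo] --> 0.
    have cvg0 (a b : nat -> R) : a @ \oo --> 0 -> b @ \oo --> 0 -> (fun j => a j + b j) @ \oo --> 0.
      by move=> a0 b0; rewrite -[0]addr0; exact: cvgD.
    have cvgc c (a : nat -> R) : a @ \oo --> 0 -> (fun j => c * a j) @ \oo --> 0.
      by move=> a0; rewrite -(mulr0 c); exact: cvgMr.
    apply: (cvg0 _ _ _ (cvgc _ _ th_cvg)); apply: (cvg0 _ _ _ Lt_cvg).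
    apply: (cvg0 _ _ _ Le_cvg); apply: (cvg0 _ _ _ eta_cvg); exact: (cvgc _ _ A_cvg).
  have H2 := cvgr_le _ b_cvg _ t2.
  near=> j.
  have pj : pat (mesh_size e j) (tau j) by near: j; exact: pat_near.
  have oj : osc1 j <= eta j ^+ 2 by near: j; exact: eta_osc.
  have [Hj _] := (wP j).2 pj oj; apply: le_trans Hj _.
  have H1j : e j ^+ d * #|` X j|%:R <= L + t / 2 / (C + 1) by near: j; exact: H1.
  have H2j : (Mphi + C) * A j + eta j + L * e j + L * tau j + (Mphi + C) * (L * (1 - theta j)) <= t / 2.
    by near: j; exact: H2.
  have -> : #|` I j|%:R * f j = L - A j - gap j.
    by rewrite -cardI /gap mulrBr opprB addrC subrK.
  have X1 : C * (e j ^+ d * #|` X j|%:R - (L - A j - gap j)) <=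
      C * (t / 2 / (C + 1)) + C * A j + C * gap j.
    rewrite -!mulrDr; apply: ler_wpM2l => //; move: H1j.
    by move: (_ * _) (t / 2 / _) (A j) (gap j) => y1 y2 y3 y4; lra.
  have X2 : C * (t / 2 / (C + 1)) <= t / 2.
    apply: (@le_trans _ _ ((C + 1) * (t / 2 / (C + 1)))); last by rewrite mulrC divfK// gt_eqF.
    by apply: ler_wpM2r; [exact: ltW|rewrite lerDl].
  have X3 : (Mphi + C) * gap j <= (Mphi + C) * (L * (1 - theta j)).
    by apply: ler_wpM2l; [exact: addr_ge0|exact: gap_le].
  apply: le_trans (lerD (lexx _) X1) _; move: X2 X3 H2j; rewrite !mulrDl.
  move: (C * (t / 2 / (C + 1))) (C * A j) (Mphi * A j) (C * gap j) (Mphi * gap j) => y1 y2 y3 y4 y5.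
  move: (Mphi * (L * (1 - theta j))) (C * (L * (1 - theta j))) (L * e j) (L * tau j) (eta j) => y6 y7 y8 y9 ya.
  by move: (\int[lam]_(x in _) _) => yb *; lra.
Unshelve. all: by end_near. Qed.

End upper_bound.

(** * Gamma-convergence *)

Section ereal_limits.
Context {R : realType}.

Lemma limn_esup_le_near (v : nat -> R) (a : R) :
  (forall eta, 0 < eta -> \forall j \near \oo, v j <= a + eta) ->
  (limn_esup (fun j => (v j)%:E) <= a%:E)%E.
Proof.
move=> H; apply/lee_addgt0Pr => eta eta0; rewrite /limn_esup limf_esupE.
apply: (@le_trans _ _ (ereal_sup ((fun j => (v j)%:E) @` [set j | v j <= a + eta]))).
  by apply: ereal_inf_lbound; exists [set j | v j <= a + eta] => //; exact: H.
by apply: ge_ereal_sup => _ [j /= vj <-]; rewrite -EFinD lee_fin.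
Qed.

Lemma limn_einf_ge_near (v : nat -> R) (a : R) :
  (forall eta, 0 < eta -> \forall j \near \oo, a - eta <= v j) ->
  (a%:E <= limn_einf (fun j => (v j)%:E))%E.
Proof.
move=> H; rewrite /limn_einf leeNr -EFinN.
apply: (@limn_esup_le_near (fun j => - v j) (- a)) => eta eta0.
have := H eta eta0; apply: filterS => j; lra.
Qed.

Lemma cvg_sum_seq (I : Type) (J : seq I) (a : I -> nat -> R) :
  (forall i, a i @ \oo --> 0) -> \sum_(i <- J) a i j @[j --> \oo] --> (0 : R).
Proof.
move=> a0; elim: J => [|i J IH].
  rewrite (_ : (fun j => _) = fun=> 0); first exact: cvg_cst.
  by apply/funext => j; rewrite big_nil.
rewrite (_ : (fun j => _) = fun j => a i j + \sum_(i <- J) a i j).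
  by rewrite -[X in _ --> X]addr0; apply: cvgD; [exact: a0|exact: IH].
by apply/funext => j; rewrite big_cons.
Qed.

End ereal_limits.

Section clip.
Context {R : realType} {N : nat}.
Local Notation E := 'rV[R]_N.

Lemma measurable_uball : measurable (@uball R N).
Proof.
have md : measurable_fun setT (fun z : E => dotv z z).
  by apply: measurable_sum => i; apply: measurable_funM; exact: measurable_coord.
have -> : @uball R N = (fun z => dotv z z) @^-1` `]-oo, 1]%classic.
  apply/seteqP; split => z /=; rewrite in_itv /uball /= -sqr_enorm.
    by move=> z1; rewrite exprn_ile1// enorm_ge0.
  by rewrite -[X in _ <= X -> _](expr1n R 2) ler_pXn2r ?nnegrE ?enorm_ge0.
by rewrite -[X in measurable X]setTI; apply: md => //; exact: measurable_itv.
Qed.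

Lemma measurable_in_uball : measurable_fun setT (fun z : E => `[< uball z >]).
Proof.
apply: (measurable_fun_bool true); rewrite setTI.
rewrite (_ : _ @^-1` _ = @uball R N); first exact: measurable_uball.
by apply/seteqP; split => z /=; [move/asboolP|move=> ?; exact/asboolP].
Qed.

(** The limit u takes values in the ball only almost everywhere; clipping gives a measurable
    representative with values in it everywhere. *)
Definition clip (z : E) : E := if `[< uball z >] then z else 0.

Lemma measurable_clip : measurable_fun setT clip.
Proof. by apply: measurable_fun_ifT; [exact: measurable_in_uball|exact: measurable_id|]. Qed.

Lemma clip_uball z : uball (clip z).
Proof. by rewrite /clip; case: asboolP => // _; rewrite /uball /= enorm0. Qed.

Lemma clip_id z : uball z -> clip z = z.
Proof. by rewrite /clip; case: asboolP. Qed.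

End clip.

Section gamma_limit.
Context {R : realType} {m N : nat} (hN : (2 <= N)%N) (rho : R).
Context (G : 'rV[R]_m.+1 -> 'rV[R]_m.+1 -> 'rV[R]_N -> 'rV[R]_N -> R).
Context (D : lattice_density R m.+1 N).
Context (Drange : ld_range D = lattice_range rho) (Dfun : ld_fun D = lattice_fun G).
Local Notation d := m.+1.
Local Notation T := 'rV[R]_d.
Local Notation E := 'rV[R]_N.
Local Notation lam := (@lebesgue_rV R d).
Context (Omega : set T) (oO : open Omega) (bO : bounded_set Omega).
Context (nullO : lam (closure Omega) = lam Omega).

Let d0 : (0 < d)%N := isT.
Let mO : measurable Omega. Proof. exact: open_measurable_rV. Qed.
Let O1 : (lam Omega < +oo)%E. Proof. exact: bounded_lebesgue_lty. Qed.

Let Mphi := pair_cost (ld_range D) (ld_bound D) + phi_rate D.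
Let phiM z : uball z -> `|phi D z| <= Mphi. Proof. by move=> zB; exact: phi_bounded. Qed.

(** Semicontinuity of [phi] is available on the ball only, so [phi] is composed with [clip] there,
    and outside [Ghom] is constantly infinite. *)
Lemma measurable_Ghom : measurable_fun setT (Ghom rho G).
Proof.
rewrite (_ : Ghom rho G = fun z => if `[< uball z >] then (phi D (clip z))%:E else +oo%E).
  apply: measurable_fun_ifT => //; first exact: measurable_in_uball.
  apply/measurable_EFinP.
  apply: (measurable_lsc_comp phiM (phi_lsc d0 hN D) measurable_clip).
  by move=> z _; exact: clip_uball.
apply/funext => z; case: asboolP => zB; last exact: (Ghom_outside hN Drange Dfun).
by rewrite clip_id//; exact: (GhomE hN Drange Dfun).
Qed.

Section limit_function.
Context (u : T -> E) (uL : Linfty_uball Omega u).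

Let mu : measurable_fun Omega u. Proof. by case: uL. Qed.
Let u' x := clip (u x).

Let mu' : measurable_fun Omega u'.
Proof. exact: (measurableT_comp measurable_clip mu). Qed.

Let u'B x : Omega x -> uball (u' x). Proof. by move=> _; exact: clip_uball. Qed.

Lemma ae_clip : {ae lam, forall x, Omega x -> u' x = u x}.
Proof. by case: uL => _; apply: filterS => x H1 Ox; rewrite /u' clip_id//; exact: H1. Qed.

Lemma integrable_phi_clip : integrableR Omega (fun x => phi D (u' x)).
Proof. exact: integrable_phi. Qed.

Lemma ae_Ghom : ae_eq lam Omega (fun x => Ghom rho G (u x)) (fun x => (phi D (u' x))%:E).
Proof.
case: uL => _; apply: filterS => x H1 Ox.
by rewrite /u' clip_id ?(GhomE hN Drange Dfun)//; exact: H1.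
Qed.

Let mG : measurable_fun Omega (fun x => Ghom rho G (u x)).
Proof. exact: (measurableT_comp measurable_Ghom mu). Qed.

Lemma integrable_Ghom : lam.-integrable Omega (fun x => Ghom rho G (u x)).
Proof.
apply/integrableP; split => //.
have /integrableP[mphi phi1] := integrable_phi_clip.
rewrite (ae_eq_integral (fun x => `|(phi D (u' x))%:E|%E))//.
- exact: measurableT_comp mG.
- exact: measurableT_comp mphi.
- by have := ae_Ghom; apply: filterS => x H1 Ox; rewrite H1.
Qed.

Lemma integral_Ghom :
  (\int[lam]_(x in Omega) Ghom rho G (u x))%E = (\int[lam]_(x in Omega) phi D (u' x))%:E.
Proof.
have /integrableP[mphi phi1] := integrable_phi_clip.
rewrite (ae_eq_integral _ _ mO mG mphi ae_Ghom) /Rintegral fineK//.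
exact: integrable_fin_num integrable_phi_clip.
Qed.

Context (e : nat -> R) (e0 : forall j, 0 < e j) (e_cvg : e @ \oo --> 0).

Lemma gamma_liminf (u_ : nat -> T -> E) : (forall j, discrete_fun (e j) Omega (u_ j)) ->
  weak_star_cvg Omega (fun j => pc_ext (e j) (u_ j)) u ->
  (\int[lam]_(x in Omega) Ghom rho G (u x) <=
   limn_einf (fun j => (energy rho G (e j) Omega (u_ j))%:E))%E.
Proof.
move=> u_S wcvg; have [c cS] := exists_usphere hN (R := R).
(* [u_ j] is unit only on the lattice points whose cell meets [Omega]. The constant c makes the
   field unit on the whole lattice without changing it over [Omega]. *)
pose w j k := if `[< usphere (u_ j (e j *: intv k)) >] then u_ j (e j *: intv k) else c.
have wS j : sphere_valued (w j) by move=> k; rewrite /w; case: asboolP.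
have wE j x : Omega x -> w j (corner (e j) x) = pc_ext (e j) (u_ j) x.
  move=> Ox; rewrite pc_extE /w; case: asboolP => // nS; exfalso; apply: nS.
  apply: u_S; split; first by exists (corner (e j) x).
  by exists x; split => //; exact: gcell_corner.
rewrite integral_Ghom; apply: limn_einf_ge_near => eta eta0.
have w_cvg i Q : measurable Q -> Q `<=` Omega ->
    \int[lam]_(x in Q) w j (corner (e j) x) ord0 i @[j --> \oo] --> \int[lam]_(x in Q) u' x ord0 i.
  move=> mQ QO.
  (* Testing against the indicator of Q times a basis vector gives the integral of one coordinate
     over Q. *)
  have test (v : T -> E) : \int[lam]_(x in Omega) dotv (\1_Q x *: delta_mx ord0 i) (v x) =
      \int[lam]_(x in Q) v x ord0 i.
    rewrite -[in RHS](setIidr QO) Rintegral_mkcondr patch_indic.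
    apply: eq_Rintegral => x _ /=; rewrite dotvZl mulrC; congr (_ * _).
    rewrite /dotv (bigD1 i)//= mxE !eqxx mul1r big1 ?addr0// => i' i'i.
    by rewrite mxE (negbTE i'i) andbF mul0r.
  have -> : \int[lam]_(x in Q) u' x ord0 i = \int[lam]_(x in Omega) dotv (\1_Q x *: delta_mx ord0 i) (u x).
    rewrite test /Rintegral; congr fine; apply: ae_eq_integral => //.
    - apply/measurable_EFinP; apply: measurable_funS QO _ => //.
      exact: (measurableT_comp (measurable_coord i) mu').
    - apply/measurable_EFinP; apply: measurable_funS QO _ => //.
      exact: (measurableT_comp (measurable_coord i) mu).
    - by have := ae_clip; apply: filterS => x H1 Qx; rewrite H1//; exact: QO.
  rewrite (_ : (fun j => _) = (fun j => \int[lam]_(x in Omega)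
      dotv (\1_Q x *: delta_mx ord0 i) (pc_ext (e j) (u_ j) x))); last first.
    apply/funext => j; rewrite test; apply: eq_Rintegral => x /set_mem Qx.
    by rewrite wE//; exact: QO.
  apply: wcvg => i'.
  rewrite (_ : (fun x => _) = EFin \o (fun x => (i' == i)%:R * \1_Q x)).
    by apply: integrableRZ => //; exact: integrableR_indic.
  by apply/funext => x /=; rewrite !mxE eqxx mulrC.
have lower := energy_lower d0 hN D oO bO nullO mu' u'B e0 e_cvg wS w_cvg eta0.
near=> j; rewrite energy_lattice// -Drange -Dfun.
rewrite (@eq_pair_energy _ _ _ _ _ _ _ (w j)); first by near: j; exact: lower.
move=> k; rewrite (in_lattice bO)// inE => kO.
have := wE j _ kO; rewrite corner_intv// => ->.
by rewrite pc_extE corner_intv.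
Unshelve. all: by end_near. Qed.

Lemma gamma_limsup : exists u_ : nat -> T -> E,
  [/\ forall j, discrete_fun (e j) Omega (u_ j),
      weak_star_cvg Omega (fun j => pc_ext (e j) (u_ j)) u &
      (limn_esup (fun j => (energy rho G (e j) Omega (u_ j))%:E) <=
       \int[lam]_(x in Omega) Ghom rho G (u x))%E].
Proof.
have [w [wS w_cvg upper]] := upper_sequence d0 hN D oO bO nullO mu' u'B e0 e_cvg.
exists (fun j a => w j (corner (e j) a)).
have pcE j x : pc_ext (e j) (fun a => w j (corner (e j) a)) x = w j (corner (e j) x).
  by rewrite pc_extE corner_intv.
split.
- by move=> j a _; exact: wS.
- move=> h Ih.
  have I1 i : integrableR Omega (fun x => h x ord0 i) by exact: Ih.
  have Iw j i : integrableR Omega (fun x => h x ord0 i * w j (corner (e j) x) ord0 i).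
    apply: (integrableR_mul mO (I1 i) (M := 1)).
      by apply: measurable_funTS; exact: (@measurable_corner _ _ _ (fun q => w j q ord0 i)).
    by move=> x _; apply: le_trans (abs_coord_le_enorm _ _) _; rewrite (wS j).
  have Iu i : integrableR Omega (fun x => h x ord0 i * u' x ord0 i).
    apply: (integrableR_mul mO (I1 i) (M := 1)).
      exact: (measurableT_comp (measurable_coord i) mu').
    by move=> x Ox; apply: le_trans (abs_coord_le_enorm _ _) _; exact: u'B.
  (* The pairing sees u only up to a null set, so its clipped representative may replace it. *)
  have hu : \int[lam]_(x in Omega) dotv (h x) (u x) = \int[lam]_(x in Omega) dotv (h x) (u' x).
    have mh i : measurable_fun Omega (fun x => h x ord0 i) by exact: integrableR_measurable (I1 i).
    rewrite /Rintegral; congr fine; apply: ae_eq_integral => //.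
    + apply/measurable_EFinP; apply: measurable_sum => i; apply: measurable_funM => //.
      exact: (measurableT_comp (measurable_coord i) mu).
    + apply/measurable_EFinP; apply: measurable_sum => i; apply: measurable_funM => //.
      exact: (measurableT_comp (measurable_coord i) mu').
    + by have := ae_clip; apply: filterS => x H1 Qx; rewrite H1.
  rewrite hu (_ : (fun j => _) = (fun j => \int[lam]_(x in Omega) dotv (h x) (u' x) +
    \sum_(i < N) \int[lam]_(x in Omega) (h x ord0 i * (w j (corner (e j) x) ord0 i - u' x ord0 i)))).
    rewrite -[X in _ --> X]addr0; apply: cvgD; first exact: cvg_cst.
    by apply: cvg_sum_seq => i; exact: w_cvg.
  apply/funext => j.
  have -> : \int[lam]_(x in Omega) dotv (h x) (u' x) =
      \sum_(i < N) \int[lam]_(x in Omega) (h x ord0 i * u' x ord0 i).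
    exact: Rintegral_sum.
  have -> : \int[lam]_(x in Omega) dotv (h x) (pc_ext (e j) (fun a => w j (corner (e j) a)) x) =
      \sum_(i < N) \int[lam]_(x in Omega) (h x ord0 i * w j (corner (e j) x) ord0 i).
    rewrite -Rintegral_sum//; apply: eq_Rintegral => x _.
    by rewrite pcE.
  have Id i : integrableR Omega (fun x => h x ord0 i * (w j (corner (e j) x) ord0 i - u' x ord0 i)).
    rewrite (_ : (fun x => _) = (fun x => h x ord0 i * w j (corner (e j) x) ord0 i - h x ord0 i * u' x ord0 i)).
      exact: integrableRB.
    by apply/funext => x; rewrite mulrBr.
  rewrite -big_split /=; apply: eq_bigr => i _; rewrite -RintegralD//.
  - by apply: eq_Rintegral => x _; rewrite -mulrDr subrKC.
  - exact: Iu.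
  - exact: Id.
rewrite integral_Ghom; apply: limn_esup_le_near => eta eta0.
have := upper eta eta0; apply: filterS => j.
rewrite energy_lattice// -Drange -Dfun.
rewrite (@eq_pair_energy _ _ _ _ _ _ _ (w j))// => k _.
by rewrite corner_intv.
Qed.

End limit_function.
End gamma_limit.

(* MathComp-Analysis. The dimension m >= 1 is written m.+1. *)
Theorem theorem1 (R : realType) (m N : nat) (hN : (2 <= N)%N)
  (rho : R) (hrho : 0 < rho)
  (Omega : set 'rV[R]_m.+1) (hOmega : lipschitz_domain Omega)
  (G : 'rV[R]_m.+1 -> 'rV[R]_m.+1 -> 'rV[R]_N -> 'rV[R]_N -> R)
  (G_borel : measurable_fun (@density_dom R m.+1 N) (uncurry4 G))
  (G_bounded : exists M : R, forall a b u v,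
     usphere u -> usphere v -> `|G a b u v| <= M)
  (G_periodic : exists2 l : nat, (1 <= l)%N & forall a b u v i,
     usphere u -> usphere v ->
     G (a + l%:R *: delta_mx ord0 i) (b + l%:R *: delta_mx ord0 i) u v =
     G a b u v)
  (G_lsc : lower_semicontinuous
     ((fun p => (uncurry4 G p)%:E) :
        subspace (@density_dom R m.+1 N) -> \bar R)) :
  [/\ forall z : 'rV[R]_N, uball z ->
        Ghom rho G z \is a fin_num /\
        cell_energy rho G z T @[T --> +oo%R] --> Ghom rho G z,
      forall u : 'rV[R]_m.+1 -> 'rV[R]_N, Linfty_uball Omega u ->
        (lebesgue_rV m.+1).-integrable Omega (fun x => Ghom rho G (u x)) &
      gamma_cvg Omega (fun e u => energy rho G e Omega u)
        (fun u => \int[lebesgue_rV m.+1]_(x in Omega) Ghom rho G (u x))%E].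

Proof.
have [M GM] := G_bounded; have [l l0 Gl] := G_periodic.
have [_ oO _ bO lipO] := hOmega.
have nullO := null_boundary oO bO lipO.
pose D := density_of rho GM l0 Gl G_lsc.
have Drange : ld_range D = lattice_range rho by [].
have Dfun : ld_fun D = lattice_fun G by [].
split.
- move=> z zB; rewrite (GhomE hN Drange Dfun zB); split => //.
  exact: (cell_energy_cvg hN Drange Dfun zB).
- by move=> u uL; exact: (integrable_Ghom hN Drange Dfun oO bO uL).
- move=> e e0 e_cvg u uL; split.
    move=> u_ u_S u_cvg.
    exact: (gamma_liminf hN Drange Dfun oO bO nullO uL e0 e_cvg u_S u_cvg).
  exact: (gamma_limsup hN Drange Dfun oO bO nullO uL e0 e_cvg).
Qed.
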